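(* Let $b\in\mathbb{R}$, $\sigma>0$, and assume that $$r_{n,k}+1=\exp\left(\frac bn+\frac{\sigma}{\sqrt n}\,\xi_{n,k}\right),$$ where, for each $n\geq 1$, the random variables $\xi_{n,k}$, $k=1,2,\ldots$, are independent and identically distributed with zero mean and unit variance, and, for every $a>0$, $$\lim_{n\to\infty}n\,\mathbb{E}\big[|\xi_{n,1}|^2I(|\xi_{n,1}|>a\sqrt n)\big]=0.$$ Set $W^{n,f}_t=\prod_{k=1}^{\lfloor nt\rfloor}(1+fr_{n,k})$, let $\mu=b+\frac{\sigma^2}{2}$, let $B=(B_t)_{t\ge 0}$ be a standard Brownian motion, and set $$W^f_t=\exp\left(\left(f\mu-\frac{f^2\sigma^2}{2}\right)t+f\sigma B_t\right).$$ Then, for every $T>0$ and every $f\in[0,1]$, the sequence of processes $(W^{n,f}_t,\ n\geq1,\ t\in[0,T])$ converges in law, as $n\to\infty$, to the process $(W^f_t,\ t\in[0,T])$.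
   Context: $\lfloor x\rfloor$ is the integer part of $x$; the empty product equals $1$; $I(\cdot)$ is the indicator function. Convergence in law is weak convergence in the Skorokhod space of right-continuous functions with left limits on $[0,T]$. *)

(* Defs.v *)
From HB Require Import structures.
From mathcomp Require Import all_boot all_order all_algebra finmap.
From mathcomp Require Import all_classical all_reals all_analysis.

Set Implicit Arguments.
Unset Strict Implicit.
Unset Printing Implicit Defensive.

Import Order.TTheory GRing.Theory Num.Theory.
Import numFieldNormedType.Exports.

Local Open Scope classical_set_scope.
Local Open Scope ring_scope.

Definition cadlag (R : realType) (T : R) (x : R -> R) : Prop :=
  (forall t, 0 <= t < T -> x s @[s --> t^'+] --> x t) /\
  (forall t, 0 < t <= T -> cvg (x s @[s --> t^'-])).

(* Elements of D[0,T] are represented by functions on the whole line of which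
   only the restriction to [0,T] matters: two representatives that agree on
   [0,T] are at Skorokhod distance 0, so every continuous functional takes the
   same value at both and every open set contains both or neither. *)
Record skorokhod (R : realType) (T : R) := Skorokhod {
  skorokhod_fun :> R -> R ;
  skorokhod_cadlag : cadlag T skorokhod_fun }.

Definition time_change (R : realType) (T : R) (l : R -> R) : Prop :=
  [/\ {in `[0, T] &, {homo l : s t / s < t}},
      {within `[0, T], continuous l} &
      l @` `[0, T]%classic = `[0, T]%classic].

Definition skorokhod_dist (R : realType) (T : R) (x y : R -> R) : \bar R :=
  ereal_inf [set ereal_sup
      [set (Num.max `|l t - t| `|x t - y (l t)|)%:E | t in `[0, T]%classic]
    | l in time_change T].

Section time_change_theory.
Variables (R : realType) (T : R).
Implicit Types l : R -> R.

Lemma time_change_mono l : {in `[0, T] &, {homo l : s t / s < t}} ->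
  {in `[0, T] &, {mono l : s t / s <= t}}.
Proof. exact: le_mono_in. Qed.

Lemma time_changeP l : {in `[0, T] &, {homo l : s t / s < t}} ->
  l @` `[0, T]%classic = `[0, T]%classic -> time_change T l.
Proof.
move=> lmono lim; split => //.
have [T0|T0] := ltP T 0.
  rewrite (_ : `[0, T]%classic = set0); first exact: continuous_subspace0.
  apply/seteqP; split => // x /=; rewrite in_itv /= => /andP[/le_trans] /[apply].
  by rewrite leNgt T0.
have lle := time_change_mono lmono.
have m0 : (0 : R) \in `[0, T] by rewrite in_itv /= lexx.
have mT : T \in `[0, T] by rewrite in_itv /= lexx T0.
have limin t : t \in `[0, T] -> l t \in `[0, T].
  move=> tT; have : (l @` `[0, T]%classic) (l t) by exists t.
  by rewrite lim.
have l0 : l 0 = 0.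
  have : (l @` `[0, T]%classic) 0 by rewrite lim.
  move=> [s sT ls0]; apply/eqP; rewrite eq_le; apply/andP; split.
    rewrite -[leRHS]ls0 lle//.
    by move: sT; rewrite /= in_itv /= => /andP[].
  by have := limin _ m0; rewrite in_itv /= => /andP[].
have lT : l T = T.
  have : (l @` `[0, T]%classic) T by rewrite lim.
  move=> [s sT lsT]; apply/eqP; rewrite eq_le; apply/andP; split.
    by have := limin _ mT; rewrite in_itv /= => /andP[].
  rewrite -[leLHS]lsT lle//.
  by move: sT; rewrite /= in_itv /= => /andP[].
apply: segment_inc_surj_continuous => //.
by rewrite l0 lT => y; rewrite -{1}lim.
Qed.

Lemma time_change_id : time_change T id.
Proof. by apply: time_changeP => [s t _ _ //|]; rewrite image_id. Qed.

Lemma time_change_in l t : time_change T l -> t \in `[0, T] -> l t \in `[0, T].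
Proof.
move=> [_ _ lim] tT; have : (l @` `[0, T]%classic) (l t) by exists t.
by rewrite lim.
Qed.

Lemma time_change_comp l1 l2 : time_change T l1 -> time_change T l2 ->
  time_change T (l2 \o l1).
Proof.
move=> tl1 tl2; have [l1m _ l1i] := tl1; have [l2m _ l2i] := tl2.
apply: time_changeP => [s t sT tT st /=|].
  by apply: l2m; rewrite ?time_change_in//; exact: l1m.
by rewrite -image_comp l1i l2i.
Qed.

Lemma time_change_inv l : time_change T l -> exists l',
  [/\ time_change T l', {in `[0, T], cancel l l'} & {in `[0, T], cancel l' l}].
Proof.
move=> tl; have [lm _ li] := tl.
have lle := time_change_mono lm.
have /choice[g gP] : forall y, exists x, y \in `[0, T] -> x \in `[0, T] /\ l x = y.
  move=> y; have [yT|_] := boolP (y \in `[0, T]); last by exists 0.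
  have : (l @` `[0, T]%classic) y by rewrite li.
  by move=> [x xT lx]; exists x.
have gl : {in `[0, T], cancel l g}.
  move=> x xT; have [gT lg] := gP _ (time_change_in tl xT).
  by apply: (inc_inj_in lle).
exists g; split => //; last by move=> y /gP[].
apply: time_changeP.
  move=> s t /gP[gsT lgs] /gP[gtT lgt] st.
  by rewrite -(leW_mono_in lle)// lgs lgt.
apply/seteqP; split => [_ [y yT <-]|x xT]; first by have [] := gP _ yT.
by exists (l x); [exact: time_change_in|exact: gl].
Qed.

End time_change_theory.

Section skorokhod_dist_theory.
Variables (R : realType) (T : R).
Implicit Types x y z : R -> R.

Lemma skorokhod_dist_ltP x y (e : R) : 0 < e ->
  (skorokhod_dist T x y < e%:E)%E <->
  exists l (r : R), [/\ time_change T l, r < e &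
    forall t, t \in `[0, T] -> `|l t - t| <= r /\ `|x t - y (l t)| <= r].
Proof.
move=> e0; split=> [/ereal_inf_lt[_ [l tl <-] supe]|[l [r [tl re lP]]]].
  pose S := ereal_sup
    [set (Num.max `|l t - t| `|x t - y (l t)|)%:E | t in `[0, T]%classic].
  exists l, (Num.max 0 (fine S)).
  have Sub t : t \in `[0, T] ->
      ((Num.max `|l t - t| `|x t - y (l t)|)%:E <= S)%E.
    by move=> tT; apply: ereal_sup_ubound; exists t.
  move: supe Sub; rewrite -/S; case: S => [s| |] //= supe Sub; split => //.
  - by rewrite gt_max e0 -lte_fin supe.
  - move=> t /Sub; rewrite lee_fin ge_max => /andP[a b].
    by rewrite !le_max a b !orbT.
  - by rewrite gt_max e0.
  - by move=> t /Sub.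
apply: (@le_lt_trans _ _ r%:E); last by rewrite lte_fin.
apply: le_trans.
  by apply: ereal_inf_lbound; exists l.
apply: ge_ereal_sup => _ [t tT <-].
by rewrite lee_fin ge_max; apply/andP; exact: lP.
Qed.

Lemma skorokhod_dist_center x (e : R) : 0 < e -> (skorokhod_dist T x x < e%:E)%E.
Proof.
move=> e0; apply/skorokhod_dist_ltP => //; exists id, 0.
split=> // [|t _]; first exact: time_change_id.
by rewrite !subrr normr0.
Qed.

Lemma skorokhod_dist_lt_sym x y (e : R) : 0 < e ->
  (skorokhod_dist T x y < e%:E)%E -> (skorokhod_dist T y x < e%:E)%E.
Proof.
move=> e0 /skorokhod_dist_ltP => /(_ e0)[l [r [tl re lP]]].
have [l' [tl' ll' l'l]] := time_change_inv tl.
apply/skorokhod_dist_ltP => //; exists l', r; split=> // t tT.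
have [] := lP _ (time_change_in tl' tT).
by rewrite l'l// distrC (distrC (x _)).
Qed.

Lemma skorokhod_dist_lt_trans x y z (e1 e2 : R) : 0 < e1 -> 0 < e2 ->
  (skorokhod_dist T x y < e1%:E)%E -> (skorokhod_dist T y z < e2%:E)%E ->
  (skorokhod_dist T x z < (e1 + e2)%:E)%E.
Proof.
move=> e10 e20 /skorokhod_dist_ltP => /(_ e10)[l1 [r1 [tl1 re1 lP1]]].
move=> /skorokhod_dist_ltP => /(_ e20)[l2 [r2 [tl2 re2 lP2]]].
apply/skorokhod_dist_ltP; first exact: addr_gt0.
exists (l2 \o l1), (r1 + r2); split; first exact: time_change_comp.
  exact: ltrD.
move=> t tT; have [a1 b1] := lP1 _ tT.
have [a2 b2] := lP2 _ (time_change_in tl1 tT).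
split=> /=.
  by rewrite (le_trans (ler_distD (l1 t) _ _))// addrC lerD.
by rewrite (le_trans (ler_distD (y (l1 t)) _ _))// lerD.
Qed.

End skorokhod_dist_theory.

Section skorokhod_instances.
Variables (R : realType) (T : R).
Let D := skorokhod T.

HB.instance Definition _ := gen_eqMixin D.
HB.instance Definition _ := gen_choiceMixin D.

Let cadlag_cst : cadlag T (fun=> 0 : R).
Proof.
split=> t _; first exact: cvg_cst.
exact: is_cvg_cst.
Qed.

HB.instance Definition _ := isPointed.Build D (Skorokhod cadlag_cst).

(* The guard makes the balls of nonpositive radius empty also when [T < 0],
   where the distance is -oo. *)
Definition skorokhod_ball (x : D) (e : R) : set D :=
  [set y | 0 < e /\ (skorokhod_dist T x y < e%:E)%E].

Let ent : set_system (D * D) := entourage_ skorokhod_ball.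

HB.instance Definition _ := hasNbhs.Build D (nbhs_ ent).

Let ball_center x (e : R) : 0 < e -> skorokhod_ball x e x.
Proof. by move=> e0; split=> //; exact: skorokhod_dist_center. Qed.

Let ball_sym x y (e : R) : skorokhod_ball x e y -> skorokhod_ball y e x.
Proof. by move=> [e0 xy]; split=> //; exact: skorokhod_dist_lt_sym. Qed.

Let ball_triangle x y z (e1 e2 : R) :
  skorokhod_ball x e1 y -> skorokhod_ball y e2 z -> skorokhod_ball x (e1 + e2) z.
Proof.
move=> [e10 xy] [e20 yz]; split; first exact: addr_gt0.
exact: skorokhod_dist_lt_trans xy yz.
Qed.

HB.instance Definition _ := @Nbhs_isPseudoMetric.Build R D
  ent erefl skorokhod_ball ball_center ball_sym ball_triangle erefl.

End skorokhod_instances.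

Definition random_element d (Omega : measurableType d) (S : ptopologicalType)
    (X : Omega -> S) : Prop :=
  measurable_fun [set: Omega] (X : Omega -> g_sigma_algebraType (@open S)).

(* Weak convergence of the laws on the Borel sigma-algebra of [S], written with
   expectations on the underlying probability spaces, which may differ. *)
Definition cvg_in_law (R : realType) (S : ptopologicalType)
    (d : nat -> measure_display) (Omega : forall n, measurableType (d n))
    (P : forall n, probability (Omega n) R) (X : forall n, Omega n -> S)
    (d' : measure_display) (Omega' : measurableType d')
    (Q : probability Omega' R) (Y : Omega' -> S) : Prop :=
  [/\ forall n, random_element (X n),
      random_element Y &
      forall Phi : S -> R, continuous Phi ->
        (exists M, forall x, `|Phi x| <= M) ->
        ('E_(P n)[Phi \o X n])%E @[n --> \oo] --> ('E_Q[Phi \o Y])%E].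

Definition mutually_independent (R : realType) d (Omega : measurableType d)
    (P : probability Omega R) (I : choiceType) (D : set I)
    (X : I -> Omega -> R) : Prop :=
  forall (J : {fset I}) (A : I -> set R),
    (forall i, i \in J -> D i) -> (forall i, measurable (A i)) ->
    (P (\bigcap_(i in [set` J]) (X i @^-1` A i)) =
     \prod_(i <- J) P (X i @^-1` A i))%E.

Definition identically_distributed (R : realType) d (Omega : measurableType d)
    (P : probability Omega R) (X Y : {RV P >-> R}) : Prop :=
  forall A : set R, measurable A -> distribution P X A = distribution P Y A.

(* Times range over the whole line for convenience; nothing but measurability
   is imposed at negative times. *)
Record brownian_motion (R : realType) d (Omega : measurableType d)
    (P : probability Omega R) := BrownianMotion {
  bm :> R -> {RV P >-> R} ;
  bm_start : {ae P, forall w, bm 0 w = 0} ;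
  bm_independent_increments : forall t : nat -> R,
    0 <= t 0%N -> {homo t : i j / (i <= j)%N >-> i <= j} ->
    mutually_independent P setT (fun i => bm (t i.+1) \- bm (t i)) ;
  (* the second parameter of [normal_prob] is the standard deviation *)
  bm_gaussian_increments : forall s t : R, 0 <= s -> s < t ->
    forall A : set R, measurable A ->
      P ((bm t \- bm s) @^-1` A) = normal_prob 0 (Num.sqrt (t - s)) A ;
  bm_continuous : forall w, {within `[0, +oo[, continuous (fun t => bm t w)} }.

Arguments bm_continuous {R d Omega P} b w.

Section paths.
Variables (R : realType) (T : R).

Lemma cadlag_continuous (x : R -> R) :
  {within `[0, +oo[, continuous x} -> cadlag T x.
Proof.
move=> /continuous_within_itvcyP[xc x0]; split=> [t /andP[+ _]|t /andP[t0 _]].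
  rewrite le_eqVlt => /predU1P[<- //|t0].
  by apply: cvg_at_right_filter; apply: xc; rewrite in_itv/= t0.
apply: (@cvgP _ _ (x t)).
by apply: cvg_at_left_filter; apply: xc; rewrite in_itv/= t0.
Qed.

Lemma cadlag_truncn (n : nat) (g : nat -> R) :
  cadlag T (fun t => g (Num.truncn (n%:R * t))).
Proof.
case: n => [|n].
  rewrite (_ : (fun _ => _) = fun=> g 0%N); last first.
    by apply/funext => t; rewrite mul0r truncn0.
  by split=> t _; [exact: cvg_cst|exact: is_cvg_cst].
have n0 : 0 < n.+1%:R :> R by rewrite ltr0n.
split=> [t /andP[t0 _]|t /andP[t0 _]].
  have /andP[m1 m2] := @truncn_itv _ (n.+1%:R * t) (mulr_ge0 (ltW n0) t0).
  apply: cvg_near_cst; near=> s; congr (g _); apply: truncn_def.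
  rewrite (le_trans m1)/=; last by rewrite ler_pM2l//; near: s; exact: nbhs_right_ge.
  rewrite mulrC -ltr_pdivlMr//; near: s; apply: nbhs_right_lt.
  by rewrite ltr_pdivlMr// mulrC.
have nt0 : 0 <= n.+1%:R * t by rewrite mulr_ge0// ltW.
have [m /andP[mt tm]] : exists m : nat, m%:R < n.+1%:R * t <= m.+1%:R.
  have /andP[m1 m2] := truncn_itv nt0.
  move: m1; rewrite le_eqVlt => /predU1P[m1|m1]; last first.
    by exists (Num.truncn (n.+1%:R * t)); rewrite m1 ltW.
  case E : (Num.truncn (n.+1%:R * t)) m1 => [|m] m1.
    by move: (mulr_gt0 n0 t0); rewrite -m1 ltxx.
  by exists m; rewrite -m1 ltr_nat ltnSn lexx.
apply: (@is_cvg_near_cst _ _ (g m)); near=> s; congr (g _); apply: truncn_def.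
apply/andP; split.
  rewrite ltW// mulrC -ltr_pdivrMr//; near: s; apply: nbhs_left_gt.
  by rewrite ltr_pdivrMr// mulrC.
by rewrite (lt_le_trans _ tm)// ltr_pM2l//; near: s; exact: nbhs_left_lt.
Unshelve. all: by end_near. Qed.

Definition wealth (n : nat) (f : R) (r : nat -> R) : skorokhod T :=
  Skorokhod (cadlag_truncn n
    (fun m => \prod_(1 <= k < m.+1) (1 + f * r k))).

Lemma continuous_limit_wealth (mu sigma f : R) (B : R -> R) :
  {within `[0, +oo[, continuous B} ->
  {within `[0, +oo[, continuous (fun t =>
    expR ((f * mu - f ^+ 2 * sigma ^+ 2 / 2) * t + f * sigma * B t))}.
Proof.
move=> cB t; apply: continuous_comp; last exact: continuous_expR.
apply: continuousD; last by apply: continuousM; [exact: cvg_cst|exact: cB].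
apply: continuousM; first exact: cvg_cst.
by apply: continuous_subspaceT => ?; exact: cvg_id.
Qed.

Definition limit_wealth (mu sigma f : R) (B : R -> R)
    (cB : {within `[0, +oo[, continuous B}) : skorokhod T :=
  Skorokhod (cadlag_continuous (@continuous_limit_wealth mu sigma f B cB)).

End paths.

Arguments wealth {R} T n f r.
Arguments limit_wealth {R} T mu sigma f {B} cB.

(* Main.v *)
Require Import Defs.
From HB Require Import structures.
From mathcomp Require Import all_boot all_order all_algebra finmap.
From mathcomp Require Import ring lra zify.
From mathcomp Require Import all_classical all_reals all_analysis measurable_realfun.

Set Implicit Arguments.
Unset Strict Implicit.
Unset Printing Implicit Defensive.

Import Order.TTheory GRing.Theory Num.Theory.
Import numFieldNormedType.Exports.

Local Open Scope classical_set_scope.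
Local Open Scope ring_scope.

(* The wealth process is the exponential of a walk whose increments are the
   log-returns psi(h) = ln (1 - f + f e^h).  We compare the law of this walk with
   that of the drifted Brownian motion sampled at the times k/n, which is a walk
   with i.i.d. Gaussian increments of the same first two moments up to o(1/n).
   For a bounded functional of the path, Lipschitz for the uniform distance,
   the comparison proceeds in blocks of n/u steps.  The oscillation of either
   walk inside the blocks is controlled by a supersolution for the running
   maximum; the laws of the finitely many block sums are then exchanged by
   Lindeberg's replacement of one increment at a time.  A bounded Skorokhod
   continuous functional is the increasing limit, along continuous paths, of its
   inf-convolutions with the uniform distance, which are bounded and Lipschitz;
   since the sampled Brownian paths converge uniformly, this bounds the limit
   inferior of the expectations of the functional and of its opposite. *)

(** * Taylor estimates *)

(** The obstacle is the oscillation inside blocks. Over [n / u] steps a second-moment bound gives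
    probability of order [1 / u] to an oscillation above a fixed level, and summing over about [u]
    blocks loses everything; order [1 / u ^ 2] is needed. A fourth moment would give it, but only
    two moments are assumed: hence a bounded function [p] of order [x ^ 4] at 0, and a supersolution
    built on it. The increments need not be centred either, so the argument uses one-step drifts
    instead of a martingale inequality. Tightness and finite-dimensional laws do not appear. The
    limit process is given, so the two laws are compared directly through expectation functionals,
    even though the walks live on different spaces. Inf-convolutions are used because a continuous
    [Phi] need not be uniformly continuous. The uniform distance is the right one for them: through
    the identity time change it dominates the Skorokhod distance, and the grid samples of a
    continuous path converge for it. *)

Section calculus.
Variable R : realType.
Implicit Types (r dr phi : R -> R).

Lemma mvt_itv r dr (x y c : R) : x <= y ->
  (forall z, x <= z <= y -> is_derive z 1 r (dr z)) ->
  (forall z, x <= z <= y -> `|dr z| <= c) ->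
  `|r y - r x| <= c * (y - x).
Proof.
move=> xy dr1 drc.
have [||z zxy ->] := @MVT_segment R r dr x y xy.
- by move=> z; rewrite in_itv/= => /andP[xz zy]; apply: dr1; rewrite !ltW.
- apply: derivable_within_continuous => z; rewrite in_itv/= => /dr1 ?.
  exact: ex_derive.
- rewrite normrM (@ger0_norm _ (y - x)) ?subr_ge0// ler_wpM2r ?subr_ge0//.
  by apply: drc; rewrite in_itv/= in zxy.
Qed.

Lemma mvt_le r dr (x y c : R) : (forall z : R, is_derive z 1 r (dr z)) ->
  (forall z, `|z - x| <= `|y - x| -> `|dr z| <= c) ->
  `|r y - r x| <= c * `|y - x|.
Proof.
move=> dr1 drc; have [xy|/ltW yx] := leP x y.
  rewrite (@ger0_norm _ (y - x)) ?subr_ge0//.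
  apply: (mvt_itv xy) => // z /andP[xz zy].
  by apply: drc; rewrite !ger0_norm ?subr_ge0//; lra.
rewrite distrC (distrC y) (@ger0_norm _ (x - y)) ?subr_ge0//.
apply: (mvt_itv yx) => // z /andP[xz zy].
by apply: drc; rewrite !ler0_norm ?subr_le0//; lra.
Qed.

(** Primitives on [[- N, N]], normalised to vanish at 0, agree wherever two of them are defined, so
    they glue to a global one. *)
Lemma antiderivative phi : continuous phi ->
  exists F : R -> R, forall x : R, is_derive x 1 F (phi x).
Proof.
move=> cphi.
pose F0 N x := \int[lebesgue_measure]_(t in `[(- N)%R, x]%classic) phi t.
pose F N x := F0 N x - F0 N 0.
have dF N (x : R) : - N < x < N -> is_derive x 1 (F N) (phi x).
  move=> /andP[Nx xN].
  have ci : (@lebesgue_measure R).-integrable `[- N, N]%classic (EFin \o phi).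
    apply: continuous_compact_integrable; first exact: segment_compact.
    exact: continuous_subspaceT.
  have [d1 d2] := @continuous_FTC1_closed R phi (- N) x N xN ci Nx (cphi x).
  rewrite (_ : phi x = phi x - 0); last by rewrite subr0.
  apply: is_deriveB.
  by apply: (DeriveDef d1); rewrite -derive1E; exact: d2.
have F0E N : F N 0 = 0 by rewrite /F subrr.
have FE N M (x : R) : - N < x < N -> - M < x < M -> F N x = F M x.
  move=> /andP[N1 N2] /andP[M1 M2].
  have dD (z : R) : `|z| <= `|x| -> is_derive z 1 (F N \- F M) (phi z - phi z).
    move=> zx; have /andP[z1 z2] : - N < z < N.
      by rewrite -ltr_norml (le_lt_trans zx)// ltr_norml N1.
    have /andP[z3 z4] : - M < z < M.
      by rewrite -ltr_norml (le_lt_trans zx)// ltr_norml M1.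
    by apply: is_deriveB; apply: dF; apply/andP.
  suff : `|(F N \- F M) x - (F N \- F M) 0| <= 0 * `|x|.
    by rewrite mul0r normr_le0 /= !F0E !subr0 subr_eq0 => /eqP.
  have [x0|/ltW x0] := leP 0 x.
    rewrite (@ger0_norm _ x)// -[X in _ * X](subr0 x).
    apply: (@mvt_itv _ (fun z => phi z - phi z)) => // z /andP[z0 zx].
      by apply: dD; rewrite !ger0_norm.
    by rewrite subrr normr0.
  rewrite distrC (@ler0_norm _ x)// -[X in _ * X]add0r.
  apply: (@mvt_itv _ (fun z => phi z - phi z)) => // z /andP[z0 zx].
    by apply: dD; rewrite !ler0_norm// lerN2.
  by rewrite subrr normr0.
exists (fun x => F (`|x| + 1) x) => x.
have xN (y e : R) : 0 < e -> - (`|y| + e) < y < `|y| + e.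
  by move=> e0; rewrite -ltr_norml ltrDl.
(* The radius [|y| + 1] moves with [y]; for [y] near [x] the fixed radius [|x| + 2] gives the same
   value. *)
have := dF _ _ (xN x 2 (ltr0Sn _ _)); apply: near_eq_is_derive; near=> y.
apply: FE; last exact: xN.
have yx : `|y - x| < 1.
  by rewrite distrC; near: y; exact: (@nbhsx_ballx R R^o x 1).
rewrite -ltr_norml -(subrK x y) (le_lt_trans (ler_normD _ _))//.
by rewrite addrC ltrD2l (lt_trans yx)// ltr1n.
Unshelve. all: by end_near. Qed.

Lemma derive_bound_lip r dr (c : R) : (forall z : R, is_derive z 1 r (dr z)) ->
  (forall z, `|dr z| <= c) -> forall x y, `|r x - r y| <= c * `|x - y|.
Proof. by move=> dr1 drc x y; exact: mvt_le. Qed.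

Lemma is_derive_translate r dr (x z : R) : (forall z : R, is_derive z 1 r (dr z)) ->
  is_derive z 1 (fun z => r (x + z)) (dr (x + z)).
Proof.
move=> dr1; apply: (@is_derive_eq _ _ _ _ _ _ _ (dr (x + z) * 1)); last by rewrite mulr1.
apply: (@is_derive1_comp _ r (fun z => x + z)).
by apply: is_derive_eq; rewrite add0r mulr1.
Qed.

(** The remainder, as a function of the increment, has derivative [dr (x + z) - dr x]. The mean
    value inequality yields [c] instead of the sharp [c / 2], which does no harm. *)
Lemma taylor_lip r dr (c x y : R) : (forall z : R, is_derive z 1 r (dr z)) ->
  (forall x y, `|dr x - dr y| <= c * `|x - y|) ->
  `|r (x + y) - r x - y * dr x| <= c * y ^+ 2.
Proof.
move=> dr1 drL; have c0 : 0 <= c.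
  by have := drL 1 0; rewrite subr0 normr1 mulr1; exact: le_trans.
pose rem z := r (x + z) - r x - z * dr x.
have dz (z : R) : is_derive z 1 rem (dr (x + z) - dr x).
  have d1 := is_derive_translate x z dr1.
  by rewrite /rem; apply: is_derive_eq; rewrite /GRing.scale/=; ring.
have := @mvt_le rem _ 0 y (c * `|y|) dz.
rewrite /rem !addr0 mul0r subrr !subr0 -(mulrA c) -normrM -expr2 ger0_norm ?sqr_ge0//.
apply=> z; rewrite subr0 => zy; rewrite (le_trans (drL _ _))//.
by rewrite ler_wpM2l// addrAC subrr add0r.
Qed.

(** The derivative of the remainder in the increment is the first-order remainder of [dr]. A
    Lipschitz [ddr] is enough, so the lemma applies to the double antiderivative of a Lipschitz
    function. *)
Lemma taylor_lip2 r dr ddr (c x y : R) : (forall z : R, is_derive z 1 r (dr z)) ->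
  (forall z : R, is_derive z 1 dr (ddr z)) ->
  (forall x y, `|ddr x - ddr y| <= c * `|x - y|) ->
  `|r (x + y) - r x - y * dr x - y ^+ 2 / 2 * ddr x| <= c * `|y| ^+ 3.
Proof.
move=> dr1 dr2 drL; have c0 : 0 <= c.
  by have := drL 1 0; rewrite subr0 normr1 mulr1; exact: le_trans.
pose rem z := r (x + z) - r x - z * dr x - z ^+ 2 / 2 * ddr x.
have dz (z : R) : is_derive z 1 rem (dr (x + z) - dr x - z * ddr x).
  have d1 := is_derive_translate x z dr1.
  rewrite /rem; apply: is_derive_eq.
  by rewrite /GRing.scale/=; field.
have := @mvt_le rem _ 0 y (c * `|y| ^+ 2) dz.
rewrite /rem !addr0 mul0r subrr expr0n !mul0r !subr0 -(mulrA c) -exprSr.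
apply=> z; rewrite subr0 => zy; rewrite (le_trans (taylor_lip _ _ dr2 drL))//.
by rewrite ler_wpM2l// -(real_normK (num_real z)) lerXn2r// nnegrE.
Qed.

End calculus.

(** * Iterated means *)

Section mean.
Variable R : realType.
Implicit Types (I : (R -> R) -> R) (f g : R -> R) (F G : seq R -> R).

(** A single constant for the bound and for the slope: translation and averaging then preserve the
    class with the same constant. *)
Definition bdlip_by (C : R) f :=
  (forall x, `|f x| <= C) /\ (forall x y, `|f x - f y| <= C * `|x - y|).

Definition bdlip f := exists C, bdlip_by C f.

Lemma bdlip_by_ge0 C f : bdlip_by C f -> 0 <= C.
Proof. by move=> [fC _]; exact: le_trans (fC 0). Qed.

Lemma bdlip_cst c : bdlip (fun=> c).
Proof.
by exists `|c|; split=> [//|x y]; rewrite subrr normr0 mulr_ge0.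
Qed.

Lemma bdlip_lin a f g : bdlip f -> bdlip g -> bdlip (fun x => a * f x + g x).
Proof.
move=> [C [fC fL]] [D [gD gL]]; exists (`|a| * C + D); split=> [x|x y].
  by rewrite (le_trans (ler_normD _ _))// lerD// normrM ler_wpM2l.
have -> : a * f x + g x - (a * f y + g y) = a * (f x - f y) + (g x - g y).
  by ring.
rewrite (le_trans (ler_normD _ _))// mulrDl lerD// normrM -mulrA.
exact: ler_wpM2l.
Qed.

Lemma bdlip_by_shift C f x : bdlip_by C f -> bdlip_by C (fun y => f (x + y)).
Proof.
by move=> [fC fL]; split=> [//|y z]; rewrite (le_trans (fL _ _))// opprD addrACA subrr add0r.
Qed.

(* A probability law on the line is represented by its expectation functional on
   bounded Lipschitz functions. *)
Record mean I : Prop := Mean {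
  mean_lin : forall a f g, bdlip f -> bdlip g ->
    I (fun x => a * f x + g x) = a * I f + I g ;
  mean_le : forall f g, bdlip f -> bdlip g -> (forall x, f x <= g x) ->
    I f <= I g ;
  mean_cst : forall c, I (fun=> c) = c }.

Lemma mean_le_add I f g e : mean I -> bdlip f -> bdlip g ->
  (forall x, f x <= g x + e) -> I f <= I g + e.
Proof.
move=> mI fb gb fg; rewrite -[X in _ + X](mean_cst mI) -[I g]mul1r -(mean_lin mI)//; last first.
  exact: bdlip_cst.
apply: mean_le => //; first by apply: bdlip_lin => //; exact: bdlip_cst.
by move=> x; rewrite mul1r.
Qed.

Lemma mean_dist I f g e : mean I -> bdlip f -> bdlip g ->
  (forall x, `|f x - g x| <= e) -> `|I f - I g| <= e.
Proof.
move=> mI fb gb fg; rewrite ler_distlC; apply/andP; split.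
  rewrite lerBlDr; apply: mean_le_add => // x.
  by have := fg x; rewrite distrC ler_distlC => /andP[]; lra.
apply: mean_le_add => // x.
by have := fg x; rewrite ler_distlC => /andP[]; lra.
Qed.

Lemma mean_bdlip_by I C f : mean I -> bdlip_by C f ->
  bdlip_by C (fun x => I (fun y => f (x + y))).
Proof.
move=> mI bf; have [fC fL] := bf.
have bs x : bdlip (fun y => f (x + y)) by exists C; exact: bdlip_by_shift.
split=> [x|x y].
  rewrite -[X in `|X|]subr0 -[X in _ - X](mean_cst mI); apply: mean_dist => //.
    exact: bdlip_cst.
  by move=> z; rewrite subr0.
apply: mean_dist => // z.
by rewrite (le_trans (fL _ _))// opprD addrACA subrr addr0.
Qed.

(** The l1 distance, meant for sequences of equal size. It controls all partial sums at once, hence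
    the uniform distance of the walks. *)
Fixpoint sdist (s t : seq R) : R :=
  match s, t with
  | x :: s', y :: t' => `|x - y| + sdist s' t'
  | _, _ => 0
  end.

Lemma sdist_ge0 s t : 0 <= sdist s t.
Proof. by elim: s t => [|x s IH] [|y t] //=; rewrite addr_ge0. Qed.

Lemma sdistss s : sdist s s = 0.
Proof. by elim: s => //= x s ->; rewrite subrr normr0 addr0. Qed.

Lemma sdist_cat s t s' t' : size s = size t ->
  sdist (s ++ s') (t ++ t') = sdist s t + sdist s' t'.
Proof.
elim: s t => [|x s IH] [|y t] //=; first by rewrite add0r.
by move=> [st]; rewrite IH// addrA.
Qed.

Definition blip (C : R) F := (forall s, `|F s| <= C) /\
  forall s t, size s = size t -> `|F s - F t| <= C * sdist s t.

Lemma blip_ge0 C F : blip C F -> 0 <= C.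
Proof. by move=> [FC _]; exact: le_trans (FC [::]). Qed.

Lemma blip_cat C F s : blip C F -> blip C (fun t => F (s ++ t)).
Proof.
move=> [FC FL]; split=> // t t' tt'.
by rewrite (le_trans (FL _ _ _)) ?size_cat ?tt'// sdist_cat// sdistss add0r.
Qed.

Lemma blip_cons C F x : blip C F -> blip C (fun t => F (x :: t)).
Proof. exact: (@blip_cat _ _ [:: x]). Qed.

Lemma blip_cst c : blip `|c| (fun=> c).
Proof. by split=> // s t _; rewrite subrr normr0 mulr_ge0// sdist_ge0. Qed.

Lemma blip_lin C D a F G : blip C F -> blip D G ->
  blip (`|a| * C + D) (fun s => a * F s + G s).
Proof.
move=> [FC FL] [GD GL]; split=> [s|s t st].
  by rewrite (le_trans (ler_normD _ _))// lerD// normrM ler_wpM2l.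
have -> : a * F s + G s - (a * F t + G t) = a * (F s - F t) + (G s - G t).
  by ring.
rewrite (le_trans (ler_normD _ _))// mulrDl lerD ?GL// normrM -mulrA.
by apply: ler_wpM2l => //; exact: FL.
Qed.

(* [imean I n F] integrates [F] against the law of [n] independent variables of
   law [I]. *)
Fixpoint imean I (n : nat) F : R :=
  if n is n'.+1 then I (fun y => imean I n' (fun s => F (y :: s))) else F [::].

Lemma eq_imean I n F G : (forall s, size s = n -> F s = G s) -> imean I n F = imean I n G.
Proof.
elim: n F G => [|n IH] F G FG /=; first exact: FG.
by congr I; apply/funext => y; apply: IH => s sn; apply: FG; rewrite /= sn.
Qed.

Lemma imean_cst I n c : mean I -> imean I n (fun=> c) = c.
Proof. by move=> mI; elim: n => //= n ->; rewrite mean_cst. Qed.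

(** Regularity and comparison go in one induction: to compare under the outer [I], the inner
    iterated means must already be known to be bounded Lipschitz. *)
Let imean_add I n C D F G e : mean I -> blip C F -> blip D G ->
  (forall s, size s = n -> `|F s - G s| <= e) ->
  (bdlip_by C (fun y => imean I n (fun s => F (y :: s)))) /\ `|imean I n F - imean I n G| <= e.
Proof.
move=> mI; elim: n C D F G e => [|n IH] C D F G e bF bG FG.
  split; last exact: FG.
  split=> [x|x y] /=; first by have [] := bF.
  by have [_ /(_ [:: x] [:: y] erefl)] := bF; rewrite /= addr0.
have bI D' F' : blip D' F' -> bdlip_by D' (fun y => imean I n (fun s => F' (y :: s))).
  by move=> bF'; have [] := IH D' D' F' F' 0 bF' bF' (fun _ _ => ltac:(by rewrite subrr normr0)).
split.
  have [FC FL] := bF.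
  split=> [x|x y] /=.
    rewrite -[X in `|X|]subr0 -[X in _ - X](mean_cst mI); apply: mean_dist => //.
    - by exists C; apply: (bI C (fun s => F (x :: s))); exact: blip_cons.
    - exact: bdlip_cst.
    - move=> z; have [_] := IH _ _ (fun s => F [:: x, z & s]) (fun=> 0) C
        (blip_cons z (blip_cons x bF)) (blip_cst 0) (fun s _ => ltac:(by rewrite subr0)).
      by rewrite imean_cst.
  apply: mean_dist => //.
  - by exists C; apply: (bI C (fun s => F (x :: s))); exact: blip_cons.
  - by exists C; apply: (bI C (fun s => F (y :: s))); exact: blip_cons.
  - move=> z; have [_] := IH _ _ (fun s => F [:: x, z & s]) (fun s => F [:: y, z & s])
        (C * `|x - y|)
        (blip_cons z (blip_cons x bF)) (blip_cons z (blip_cons y bF))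
        (fun s _ => ltac:(by rewrite (le_trans (FL _ _ _))//= sdistss subrr normr0 !addr0)).
    by [].
apply: mean_dist => //.
- by exists C; exact: bI.
- by exists D; exact: bI.
- move=> y; have [_] := IH _ _ (fun s => F (y :: s)) (fun s => G (y :: s)) e
   (blip_cons y bF) (blip_cons y bG) (fun s sn => FG (y :: s) (f_equal S sn)).
  by [].
Qed.

Lemma imean_bdlip I n C F : mean I -> blip C F ->
  bdlip_by C (fun y => imean I n (fun s => F (y :: s))).
Proof.
move=> mI bF; have [] := imean_add mI bF bF (n := n) (e := 0) => // s _.
by rewrite subrr normr0.
Qed.

Lemma imean_dist I n C D F G e : mean I -> blip C F -> blip D G ->
  (forall s, size s = n -> `|F s - G s| <= e) -> `|imean I n F - imean I n G| <= e.
Proof. by move=> mI bF bG FG; have [] := imean_add mI bF bG FG. Qed.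

Lemma imean_lin I n C D a F G : mean I -> blip C F -> blip D G ->
  imean I n (fun s => a * F s + G s) = a * imean I n F + imean I n G.
Proof.
move=> mI; elim: n F G => //= n IH F G bF bG.
rewrite -mean_lin//; last 2 first.
- by exists C; exact: imean_bdlip.
- by exists D; exact: imean_bdlip.
by congr I; apply/funext => y; rewrite IH//; exact: blip_cons.
Qed.

Lemma imean_le I n C D F G : mean I -> blip C F -> blip D G ->
  (forall s, size s = n -> F s <= G s) -> imean I n F <= imean I n G.
Proof.
move=> mI; elim: n F G => [|n IH] F G bF bG FG /=; first exact: FG.
apply: mean_le => //.
- by exists C; exact: imean_bdlip.
- by exists D; exact: imean_bdlip.
by move=> y; apply: IH => [||s sn]; [exact: blip_cons..|apply: FG; rewrite /= sn].
Qed.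

Lemma imean_cat I m n F :
  imean I (m + n) F = imean I m (fun s => imean I n (fun t => F (s ++ t))).
Proof.
elim: m F => //= m IH F; congr I; apply/funext => y; exact: IH.
Qed.

End mean.

(** * Block sums, running maxima and the exchange of increments *)

Section blocks.
Variable R : realType.
Implicit Types (I : (R -> R) -> R) (f g : R -> R) (F G : seq R -> R).

Definition sumk (s : seq R) (k : nat) : R := \sum_(i < k) s`_i.

Lemma sumk0 s : sumk s 0 = 0. Proof. by rewrite /sumk big_ord0. Qed.

Lemma sumkD s m k : sumk s (m + k) = sumk s m + sumk (drop m s) k.
Proof.
rewrite /sumk big_split_ord/=; congr (_ + _).
by apply: eq_bigr => i _; rewrite nth_drop.
Qed.

Lemma sumk_cons y s k : sumk (y :: s) k.+1 = y + sumk s k.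
Proof. by rewrite /sumk big_ord_recl. Qed.

Lemma sumk_catl s t k : (k <= size s)%N -> sumk (s ++ t) k = sumk s k.
Proof.
move=> ks; apply: eq_bigr => i _.
by rewrite nth_cat (leq_trans (ltn_ord i)).
Qed.

Lemma sumk_take s m k : (k <= m)%N -> sumk (take m s) k = sumk s k.
Proof.
by move=> km; apply: eq_bigr => i _; rewrite nth_take// (leq_trans (ltn_ord i)).
Qed.

Lemma sumk_lip s t k : size s = size t ->
  `|sumk s k - sumk t k| <= sdist s t.
Proof.
elim: k s t => [|k IH] s t.
  by rewrite !sumk0 subrr normr0 sdist_ge0.
case: s t => [|x s] [|y t] // st.
  by rewrite subrr normr0.
rewrite !sumk_cons opprD addrACA (le_trans (ler_normD _ _))//= lerD//.
by apply: IH; case: st.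
Qed.

Lemma blip_sumk C f x k : bdlip_by C f -> blip C (fun s => f (x + sumk s k)).
Proof.
move=> bf; have [fC fL] := bf; split=> // s t st.
rewrite (le_trans (fL _ _))// ler_wpM2l ?(bdlip_by_ge0 bf)//.
by rewrite opprD addrACA subrr add0r sumk_lip.
Qed.

Lemma blip_sumk0 C f k : bdlip_by C f -> blip C (fun s => f (sumk s k)).
Proof.
move=> bf; have := blip_sumk 0 k bf.
by under eq_fun do rewrite add0r.
Qed.

Definition block I (m : nat) f : R := imean I m (fun s => f (sumk s m)).

Lemma mean_block I m : mean I -> mean (block I m).
Proof.
move=> mI; split=> [a f g [C bf] [D bg]|f g [C bf] [D bg] fg|c].
- rewrite /block (@imean_lin _ _ _ C D _ (fun s => f (sumk s m)) (fun s => g (sumk s m)))//.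
    exact: blip_sumk0.
  exact: blip_sumk0.
- by apply: (@imean_le _ _ _ C D) => //; exact: blip_sumk0.
- by rewrite /block imean_cst.
Qed.

Fixpoint coarsen (m q : nat) (s : seq R) : seq R :=
  if q is q'.+1 then sumk s m :: coarsen m q' (drop m s) else [::].

Lemma sumk_coarsen m q s j : (j <= q)%N -> sumk (coarsen m q s) j = sumk s (j * m).
Proof.
elim: q s j => [|q IH] s [|j] //= jq; rewrite ?sumk0//.
by rewrite sumk_cons mulSn sumkD IH.
Qed.

(** The blocks use disjoint coordinates, so [imean_cat] factors the integral one block at a time:
    block sums are independent with law [block I m]. *)
Lemma imean_block I m q F : imean I (q * m) (fun s => F (coarsen m q s)) = imean (block I m) q F.
Proof.
elim: q F => [//|q IH] F; rewrite mulSn imean_cat /= /block.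
apply: eq_imean => s sm; rewrite -IH; apply: eq_imean => t _ /=.
by rewrite sumk_catl ?sm// drop_size_cat.
Qed.

(** Coordinates are exchanged one at a time. With the later ones integrated out, a function of one
    variable in the same class [bdlip_by C] remains, so each exchange costs [d]. *)
Lemma imean_compare I I' C q F d : mean I -> mean I' ->
  (forall f, bdlip_by C f -> `|I f - I' f| <= d) ->
  blip C F -> `|imean I q F - imean I' q F| <= q%:R * d.
Proof.
move=> mI mI' II'; elim: q F => [|q IH] F bF /=.
  by rewrite mul0r subrr normr0.
rewrite -[in leRHS]addn1 natrD mulrDl mul1r.
rewrite (le_trans (ler_distD (I (fun y => imean I' q (fun s => F (y :: s)))) _ _))//.
apply: lerD; last by apply: II'; exact: imean_bdlip.
apply: mean_dist => //; [exists C; exact: imean_bdlip..|].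
by move=> y; apply: IH; exact: blip_cons.
Qed.

(** Plays the part of a union bound: for [F] the running maximum of a [ramp], it dominates the
    indicator that some block oscillates too much. *)
Fixpoint sum_blocks (m q : nat) F (s : seq R) : R :=
  if q is q'.+1 then F (take m s) + sum_blocks m q' F (drop m s) else 0.

Lemma sdist_take_drop m (s t : seq R) : size s = size t ->
  sdist s t = sdist (take m s) (take m t) + sdist (drop m s) (drop m t).
Proof.
move=> st; rewrite -sdist_cat ?cat_take_drop//.
by rewrite !size_take st.
Qed.

Lemma blip_sum_blocks m q C F : blip C F -> blip (q%:R * C) (sum_blocks m q F).
Proof.
move=> bF; have [FC FL] := bF; elim: q => [|q [IH1 IH2]].
  by rewrite mul0r; split=> [s|s t _]; rewrite /= ?subrr normr0// mul0r.
rewrite -addn1 natrD mulrDl mul1r addn1 addrC.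
split=> [s|s t st] /=.
  by rewrite (le_trans (ler_normD _ _))// lerD.
rewrite opprD addrACA (le_trans (ler_normD _ _))// mulrDl; apply: lerD.
  rewrite (le_trans (FL _ _ _)) ?size_take ?st//.
  by rewrite ler_wpM2l ?(blip_ge0 bF)// (sdist_take_drop m st) lerDl sdist_ge0.
rewrite (le_trans (IH2 _ _ _)) ?size_drop ?st//.
rewrite ler_wpM2l ?mulr_ge0 ?(blip_ge0 bF)// (sdist_take_drop m st).
by rewrite lerDr sdist_ge0.
Qed.

Lemma imean_sum_blocks I m q C F : mean I -> blip C F ->
  imean I (q * m) (sum_blocks m q F) = q%:R * imean I m F.
Proof.
move=> mI bF; elim: q => [|q IH]; first by rewrite mul0r.
rewrite mulSn imean_cat -[in RHS]addn1 natrD mulrDl mul1r.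
rewrite (@eq_imean _ _ _ _ (fun s => 1 * F s + q%:R * imean I m F)); last first.
  move=> s sm.
  rewrite (@eq_imean _ _ _ _ (fun t => 1 * F s + sum_blocks m q F t)); last first.
    by move=> t _; rewrite /= mul1r take_size_cat// drop_size_cat.
  rewrite (@imean_lin _ _ _ `|F s| (q%:R * C) 1 (fun=> F s) (sum_blocks m q F) mI)//.
  - by rewrite imean_cst// IH.
  - exact: blip_cst.
  - exact: blip_sum_blocks.
rewrite (@imean_lin _ _ _ C `|q%:R * imean I m F| 1 F (fun=> q%:R * imean I m F) mI)//.
  by rewrite imean_cst// mul1r addrC.
exact: blip_cst.
Qed.

Lemma sum_blocks_ge m q F s j : (forall t, 0 <= F t) -> (j < q)%N ->
  F (take m (drop (j * m) s)) <= sum_blocks m q F s.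
Proof.
move=> F0; have bsum0 q' s' : 0 <= sum_blocks m q' F s'.
  by elim: q' s' => //= q' IH s'; rewrite addr_ge0.
elim: q s j => [//|q IH] s [_|j jq] /=.
  by rewrite mul0n drop0 lerDl.
rewrite mulSn addnC -drop_drop ler_wpDl//; exact: IH.
Qed.

(** The start [x] counts among the visited points, and the recursion peels off the first increment,
    in step with [imean]. *)
Fixpoint run_max f x (s : seq R) : R :=
  if s is y :: s' then Num.max (f x) (run_max f (x + y) s') else f x.

Lemma max_dist (a b c d e : R) : `|a - c| <= e -> `|b - d| <= e ->
  `|Num.max a b - Num.max c d| <= e.
Proof.
rewrite !ler_distlC => /andP[a1 a2] /andP[b1 b2]; apply/andP; split.
  by rewrite lerBlDr ge_max -!lerBlDr !le_max; apply/andP; split; apply/orP; lra.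
by rewrite ge_max -!lerBlDr !le_max; apply/andP; split; apply/orP; lra.
Qed.

Lemma run_max_lip C f x x' s t : bdlip_by C f -> size s = size t ->
  `|run_max f x s - run_max f x' t| <= C * (`|x - x'| + sdist s t).
Proof.
move=> bf; have [fC fL] := bf; have C0 := bdlip_by_ge0 bf.
elim: s t x x' => [|y s IH] [|z t] x x' // st.
  by rewrite /= addr0.
apply: max_dist.
  by rewrite (le_trans (fL _ _))// ler_wpM2l// lerDl sdist_ge0.
rewrite (le_trans (IH t _ _ _))//=; first by case: st.
by rewrite ler_wpM2l// addrA lerD2r opprD addrACA ler_normD.
Qed.

Lemma run_max_bound C f x s : (forall x, `|f x| <= C) -> `|run_max f x s| <= C.
Proof.
move=> fC; elim: s x => //= y s IH x.
by rewrite maxEge; case: ifP.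
Qed.

Lemma blip_run_max C f x : bdlip_by C f -> blip C (run_max f x).
Proof.
move=> bf; split=> [s|s t st]; first by apply: run_max_bound; case: bf.
by have := run_max_lip x x bf st; rewrite subrr normr0 add0r.
Qed.

Lemma run_max_ge f x s k : (k <= size s)%N -> f (x + sumk s k) <= run_max f x s.
Proof.
elim: s x k => [|y s IH] x [|k] //= ks; rewrite ?sumk0 ?addr0// le_max ?lexx//.
by rewrite sumk_cons addrA IH ?orbT.
Qed.

(** The convolution operator of the [m]-step walk. The free starting point makes it iterable;
    [block] is its value at 0. *)
Definition sum_mean I m f x := imean I m (fun s => f (x + sumk s m)).

Lemma sum_mean0 I f x : sum_mean I 0 f x = f x.
Proof. by rewrite /sum_mean /= sumk0 addr0. Qed.

Lemma sum_meanS I m f x : sum_mean I m.+1 f x = I (fun y => sum_mean I m f (x + y)).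
Proof.
rewrite /sum_mean /=; congr I; apply/funext => y; apply: eq_imean => s _.
by rewrite sumk_cons addrA.
Qed.

Lemma bdlip_sum_mean I m C f : mean I -> bdlip_by C f -> bdlip_by C (sum_mean I m f).
Proof.
move=> mI bf; elim: m => [|m IH].
  by rewrite (_ : sum_mean I 0 f = f)//; apply/funext => x; rewrite sum_mean0.
rewrite (_ : sum_mean I m.+1 f = fun x => I (fun y => sum_mean I m f (x + y))).
  exact: mean_bdlip_by.
by apply/funext => x; rewrite sum_meanS.
Qed.

(* The truncation at [y ^+ 2] is what makes the Lindeberg condition sufficient:
   no third moment is assumed. *)
Definition min23 (y : R) := Num.min (y ^+ 2) (`|y| ^+ 3).

(** [f1] and [f2] stand for the derivatives, but only through the Taylor estimate: nothing is
    differentiated. The class is thus stable under averaging, with the same [K], without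
    differentiation under the integral sign. *)
Record smooth (K : R) (f f1 f2 : R -> R) : Prop := Smooth {
  smooth_bl : bdlip f ;
  smooth_bl1 : bdlip f1 ;
  smooth_bl2 : bdlip f2 ;
  smooth_b1 : forall x, `|f1 x| <= K ;
  smooth_b2 : forall x, `|f2 x| <= K ;
  smooth_taylor : forall x y,
    `|f (x + y) - f x - y * f1 x - y ^+ 2 / 2 * f2 x| <= K * min23 y }.

(** The Taylor remainder is linear in [f], [f1], [f2], so that of the averages is the average of the
    translated remainders, each at most [K * min23 y]. *)
Lemma smooth_mean I K f f1 f2 : mean I -> smooth K f f1 f2 ->
  smooth K (fun x => I (fun y => f (x + y))) (fun x => I (fun y => f1 (x + y)))
    (fun x => I (fun y => f2 (x + y))).
Proof.
move=> mI [[C bf] [C1 bf1] [C2 bf2] b1 b2 ft].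
have bs D (h : R -> R) x : bdlip_by D h -> bdlip (fun y => h (x + y)).
  by move=> ?; exists D; exact: bdlip_by_shift.
have bd h x : bdlip (fun y => h (x + y)) -> (forall x, `|h x| <= K) ->
  `|I (fun y => h (x + y))| <= K.
  move=> bh hK; rewrite -[X in `|X|]subr0 -[X in _ - X](mean_cst mI).
  by apply: mean_dist => [//|//||y]; [exact: bdlip_cst|rewrite subr0].
split.
- by exists C; exact: (mean_bdlip_by mI bf).
- by exists C1; exact: (mean_bdlip_by mI bf1).
- by exists C2; exact: (mean_bdlip_by mI bf2).
- by move=> x; apply: bd => //; exact: (bs C1).
- by move=> x; apply: bd => //; exact: (bs C2).
move=> x y.
have -> : I (fun z => f (x + y + z)) - I (fun z => f (x + z)) -
    y * I (fun z => f1 (x + z)) - y ^+ 2 / 2 * I (fun z => f2 (x + z)) =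
    I (fun z => (- (y ^+ 2 / 2)) * f2 (x + z) +
      ((- y) * f1 (x + z) + ((-1) * f (x + z) + f (x + y + z)))) - I (fun=> 0).
  rewrite !mean_lin//; do ?[apply: bdlip_lin|exact: (bs C)|exact: (bs C1)|exact: (bs C2)].
  by rewrite mean_cst//; ring.
apply: mean_dist => //.
- by do ?[apply: bdlip_lin|exact: (bs C)|exact: (bs C1)|exact: (bs C2)].
- exact: bdlip_cst.
move=> z; rewrite (le_trans _ (ft (x + z) y))//.
rewrite le_eqVlt; apply/orP; left; apply/eqP; congr `|_|.
by rewrite (addrAC x z y); ring.
Qed.

(** [a] and [v] stand for the first two uncentred moments and [d] for the mean of [min23]. They are
    defined by their effect on [smooth] functions, since a [mean] is controlled on bounded Lipschitz
    functions only, which excludes [y] and [y ^+ 2]. *)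
Definition moments I (a v d : R) := forall K f f1 f2, smooth K f f1 f2 ->
  forall x, `|I (fun y => f (x + y)) - f x - a * f1 x - v / 2 * f2 x| <= K * d.

Lemma smooth_sum_mean I K m f f1 f2 : mean I -> smooth K f f1 f2 ->
  smooth K (sum_mean I m f) (sum_mean I m f1) (sum_mean I m f2).
Proof.
move=> mI sf; elim: m => [|m IH].
  have P0E h : sum_mean I 0 h = h by apply/funext => x; rewrite sum_mean0.
  by rewrite !P0E.
have PSE h : sum_mean I m.+1 h = fun x => I (fun y => sum_mean I m h (x + y)).
  by apply/funext => x; rewrite sum_meanS.
by rewrite !PSE; exact: smooth_mean.
Qed.

Lemma swap_one I I' a v d a' v' d' K f f1 f2 x : mean I -> mean I' ->
  moments I a v d -> moments I' a' v' d' -> smooth K f f1 f2 ->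
  `|I (fun y => f (x + y)) - I' (fun y => f (x + y))| <=
    K * (`|a - a'| + `|v - v'| + d + d').
Proof.
move=> mI mI' mo mo' sf.
have h := mo _ _ _ _ sf x; have h' := mo' _ _ _ _ sf x.
have := smooth_b1 sf x; have := smooth_b2 sf x => b2 b1.
set u := I _ in h *; set u' := I' _ in h' *.
have -> : u - u' = (u - f x - a * f1 x - v / 2 * f2 x) -
   (u' - f x - a' * f1 x - v' / 2 * f2 x) + (a - a') * f1 x + (v - v') * (f2 x / 2).
  by ring.
have e1 : `|(a - a') * f1 x| <= K * `|a - a'| by rewrite normrM mulrC ler_wpM2r.
have e2 : `|(v - v') * (f2 x / 2)| <= K * `|v - v'|.
  rewrite normrM mulrC ler_wpM2r// normrM (@ger0_norm _ (2^-1)) ?invr_ge0//.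
  by move: (normr_ge0 (f2 x)) b2; lra.
rewrite !mulrDr.
apply: (le_trans (ler_normD _ _)); apply: (le_trans (lerD (ler_normD _ _) (lexx _))).
apply: (le_trans (lerD (lerD (ler_normB _ _) (lexx _)) (lexx _))).
by move: h h' e1 e2; lra.
Qed.

(** Lindeberg's telescoping: one increment is exchanged while the following ones already have law
    [I']. By [smooth_sum_mean] the averaged function keeps its [K], so the errors add up
    linearly. *)
Lemma swap_many I I' a v d a' v' d' K f f1 f2 m x : mean I -> mean I' ->
  moments I a v d -> moments I' a' v' d' -> smooth K f f1 f2 ->
  `|sum_mean I m f x - sum_mean I' m f x| <= m%:R * (K * (`|a - a'| + `|v - v'| + d + d')).
Proof.
move=> mI mI' mo mo' sf; elim: m x => [|m IH] x.
  by rewrite !sum_mean0 subrr normr0 mul0r.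
rewrite !sum_meanS -[in leRHS]addn1 natrD mulrDl mul1r.
rewrite (le_trans (ler_distD (I (fun y => sum_mean I' m f (x + y))) _ _))//.
have [C bf] := smooth_bl sf.
apply: lerD; last first.
  by apply: swap_one mo mo' _ => //; exact: smooth_sum_mean sf.
apply: mean_dist => //; by exists C; apply/bdlip_by_shift/bdlip_sum_mean.
Qed.

Lemma swap_bdlip I I' a v d a' v' d' K e C f f0 f1 f2 m : mean I -> mean I' ->
  moments I a v d -> moments I' a' v' d' ->
  bdlip_by C f -> smooth K f0 f1 f2 -> (forall x, `|f x - f0 x| <= e) ->
  `|block I m f - block I' m f| <=
    2 * e + m%:R * (K * (`|a - a'| + `|v - v'| + d + d')).
Proof.
move=> mI mI' mo mo' bf sf ff0.
have bE I0 h : block I0 m h = sum_mean I0 m h 0.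
  by rewrite /block /sum_mean; apply: eq_imean => s _; rewrite add0r.
have close I0 : mean I0 -> `|block I0 m f - block I0 m f0| <= e.
  move=> mI0; apply: mean_dist => //; first exact: mean_block.
    by exists C.
  exact: smooth_bl sf.
have := swap_many m 0 mI mI' mo mo' sf; rewrite -!bE => h.
have h1 := close _ mI; have h2 := close _ mI'.
apply: (le_trans (ler_distD (block I m f0) _ _)).
apply: (le_trans (lerD (lexx _) (ler_distD (block I' m f0) _ _))).
by move: h h1 h2; rewrite (distrC (block I' m f0)); lra.
Qed.

(* The barrier [v + j b w + (j b)^2 + j K d] is a supersolution of the
   recursion satisfied by [imean I j (run_max chi x)]. *)
Lemma imean_run_max_le I a v d K (b c : R) chi p p1 p2 w w1 w2 j x : mean I ->
  moments I a v d -> smooth K p p1 p2 -> smooth K w w1 w2 ->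
  0 < c -> 0 <= d ->
  (forall x, 0 <= p x) -> (forall x, 0 <= w x) ->
  (forall x, w x <= 1) ->
  (forall x, `|p1 x| <= K * w x) -> (forall x, `|p2 x| <= K * w x) ->
  bdlip chi -> (forall x, 0 <= chi x <= 1) ->
  (forall x, c <= p x \/ chi x = 0) ->
  b = K * (`|a| + `|v| + d) ->
  imean I j (run_max chi x) <=
    c^-1 * (p x + j%:R * b * w x + (j%:R * b) ^+ 2 + j%:R * (K * d)).
Proof.
move=> mI mo sp sw c0 d0 pp ww w1le p1w p2w [Cc bchi] chi01 chip bE.
have K0 : 0 <= K by apply: le_trans (smooth_b1 sp 0).
have b0 : 0 <= b by rewrite bE mulr_ge0// !addr_ge0.
have [Cp bp] := smooth_bl sp; have [Cw bw] := smooth_bl sw.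
have mx1 s y : run_max chi y s <= 1.
  by elim: s y => [|z s IH] y /=; rewrite ?ge_max ?IH ?andbT; have /andP[] := chi01 y.
pose V j x : R := p x + j%:R * b * w x + (j%:R * b) ^+ 2 + j%:R * (K * d).
have bV j' y : bdlip (fun z => V j' (y + z)).
  rewrite (_ : (fun z => V j' (y + z)) = fun z =>
     1 * p (y + z) + (j'%:R * b * w (y + z) + ((j'%:R * b) ^+ 2 + j'%:R * (K * d)))).
    apply: bdlip_lin; first by exists Cp; exact: bdlip_by_shift.
    apply: bdlip_lin; first by exists Cw; exact: bdlip_by_shift.
    exact: bdlip_cst.
  by apply/funext => z; rewrite /V; ring.
have V0 j' y : 0 <= V j' y.
  by rewrite /V !addr_ge0// ?sqr_ge0// !mulr_ge0.
(* Boundary condition: where [c <= p], the barrier divided by [c] is at least 1, which bounds the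
   running maximum. The recursion is then needed only at zeros of [chi]. *)
have big y j' : c <= p y -> 1 <= c^-1 * V j' y.
  move=> cp; rewrite mulrC ler_pdivlMr// mul1r (le_trans cp)// /V -!addrA lerDl.
  by rewrite !addr_ge0 ?sqr_ge0// !mulr_ge0.
rewrite -/(V j x); elim: j x => [|j IH] x.
  have [cp|chi0] := chip x; last first.
    by rewrite /= chi0 mulr_ge0 ?V0// invr_ge0 ltW.
  by rewrite (le_trans _ (big x 0%N cp))//=; have /andP[] := chi01 x.
have [cp|chi0] := chip x.
  rewrite (le_trans _ (big x _ cp))// -[leRHS](imean_cst j.+1 1 mI).
  apply: (@imean_le _ _ _ Cc `|1|) => //; [exact: blip_run_max|exact: blip_cst].
rewrite /=.
(* At a zero of [chi] the starting point drops out of the maximum and the recursion becomes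
   linear. *)
have mxE y s : Num.max (chi x) (run_max chi (x + y) s) = run_max chi (x + y) s.
  rewrite chi0; apply/max_idPr.
  have : 0 <= chi (x + y + sumk s 0) by have /andP[] := chi01 (x + y + sumk s 0).
  by move=> /le_trans -> //; exact: run_max_ge.
under eq_fun do under eq_fun do rewrite mxE.
have bJ : bdlip (fun y => imean I j (run_max chi (x + y))).
  exists Cc; apply: (@bdlip_by_shift _ _ (fun y => imean I j (run_max chi y))).
  split=> [y|y z].
    rewrite -[X in `|X|]subr0 -[X in _ - X](imean_cst j _ mI).
    apply: (@imean_dist _ _ _ Cc `|0|) => //; [exact: blip_run_max|exact: blip_cst|].
    by move=> s _; rewrite subr0; apply: run_max_bound; case: bchi.
  apply: (@imean_dist _ _ _ Cc Cc) => //; [exact: blip_run_max..|].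
  by move=> s _; rewrite (le_trans (run_max_lip _ _ bchi (erefl (size s))))// sdistss addr0.
apply: (@le_trans _ _ (I (fun y => c^-1 * V j (x + y) + 0))).
  apply: mean_le => //; first by apply: bdlip_lin => //; exact: bdlip_cst.
  by move=> y; rewrite addr0; exact: IH.
rewrite mean_lin//; last exact: bdlip_cst.
rewrite mean_cst// addr0 ler_wpM2l ?invr_ge0 ?(ltW c0)//.
have -> : I (fun y => V j (x + y)) = I (fun y => p (x + y)) +
    j%:R * b * I (fun y => w (x + y)) + (j%:R * b) ^+ 2 + j%:R * (K * d).
  rewrite (_ : (fun z => V j (x + z)) = fun z =>
     1 * p (x + z) + (j%:R * b * w (x + z) + ((j%:R * b) ^+ 2 + j%:R * (K * d)))).
    have bp' : bdlip (fun z => p (x + z)) by exists Cp; exact: bdlip_by_shift.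
    have bw' : bdlip (fun z => w (x + z)) by exists Cw; exact: bdlip_by_shift.
    have bc := @bdlip_cst R ((j%:R * b) ^+ 2 + j%:R * (K * d)).
    rewrite (mean_lin mI 1 bp' (bdlip_lin _ bw' bc)) (mean_lin mI _ bw' bc).
    by rewrite mean_cst//; ring.
  by apply/funext => z; rewrite /V; ring.
have bound q q1 q2 : `|I (fun y => q (x + y)) - q x - a * q1 x - v / 2 * q2 x| <= K * d ->
   forall L, `|q1 x| <= L -> `|q2 x| <= L ->
   I (fun y => q (x + y)) <= q x + L * (`|a| + `|v|) + K * d.
  move=> h L l1 l2.
  have e1 : a * q1 x <= L * `|a|.
    by rewrite (le_trans (ler_norm _))// normrM mulrC ler_wpM2r.
  have e2 : v / 2 * q2 x <= L * `|v|.
    rewrite (le_trans (ler_norm _))// normrM mulrC ler_pM//.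
    by rewrite normrM (@ger0_norm _ (2^-1)) ?invr_ge0//; move: (normr_ge0 v); lra.
  by move: h e1 e2; rewrite ler_norml mulrDr => /andP[_]; lra.
have hp := bound _ _ _ (mo _ _ _ _ sp x) _ (p1w x) (p2w x).
have hw := bound _ _ _ (mo _ _ _ _ sw x) _ (smooth_b1 sw x) (smooth_b2 sw x).
have hw' : j%:R * b * I (fun y => w (x + y)) <= j%:R * b * (w x + b).
  by apply: ler_wpM2l; [rewrite mulr_ge0|move: hw; rewrite bE; lra].
(* Up to [K * d], the drift of [p] is at most [b * w x], which raises the coefficient of [w] from
   [j b] to [(j + 1) b]. The drift of [w] is at most [b], and the resulting [j b ^ 2] is absorbed by
   the growth of the square. *)
have hb : K * w x * (`|a| + `|v|) <= b * w x.
  by rewrite bE mulrAC ler_wpM2r// ler_wpM2l// lerDl.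
rewrite /V -(addn1 j) natrD.
have h2 : (j%:R * b) ^+ 2 + j%:R * b * b <= ((j%:R + 1) * b) ^+ 2.
  rewrite -subr_ge0 (_ : _ - _ = j%:R * b ^+ 2 + b ^+ 2); last by ring.
  by rewrite addr_ge0 ?mulr_ge0 ?sqr_ge0.
rewrite mulrDr in hw'.
by move: hp hw' hb h2; rewrite !mulrDl !mul1r; lra.
Qed.

End blocks.

(** * Smooth approximation and the barrier functions *)

Section smoothing.
Variable R : realType.

Lemma min23_le2 (y : R) : min23 y <= y ^+ 2.
Proof. by rewrite /min23 ge_min lexx. Qed.

Lemma min23_le3 (y : R) : min23 y <= `|y| ^+ 3.
Proof. by rewrite /min23 ge_min lexx orbT. Qed.

Lemma min23_ge0 (y : R) : 0 <= min23 y.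
Proof. by rewrite /min23 le_min sqr_ge0 exprn_ge0. Qed.

Lemma le_min23 (a K y : R) : a <= K * y ^+ 2 -> a <= K * `|y| ^+ 3 -> a <= K * min23 y.
Proof. by rewrite /min23 minEge; case: ifP. Qed.

Lemma smooth_of_derive (K : R) (f f1 f2 f3 : R -> R) :
  (forall x : R, is_derive x 1 f (f1 x)) ->
  (forall x : R, is_derive x 1 f1 (f2 x)) ->
  (forall x : R, is_derive x 1 f2 (f3 x)) ->
  (forall x, `|f x| <= K) -> (forall x, `|f1 x| <= K) ->
  (forall x, `|f2 x| <= K) -> (forall x, `|f3 x| <= K) ->
  smooth (2 * K) f f1 f2.
Proof.
move=> d1 d2 d3 b b1 b2 b3.
have K0 : 0 <= K by apply: le_trans (b 0).
have l := derive_bound_lip d1 b1; have l1 := derive_bound_lip d2 b2.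
have l2 := derive_bound_lip d3 b3.
have K2 : K <= 2 * K by lra.
split.
- by exists K.
- by exists K.
- by exists K.
- by move=> x; rewrite (le_trans (b1 x)).
- by move=> x; rewrite (le_trans (b2 x)).
move=> x y; apply: le_min23.
  rewrite (le_trans (ler_normB _ _))//.
  have t := taylor_lip x y d1 l1.
  have : `|y ^+ 2 / 2 * f2 x| <= K * y ^+ 2.
    rewrite normrM mulrC ler_pM// normrM !ger0_norm ?sqr_ge0 ?invr_ge0//.
    by move: (sqr_ge0 y); lra.
  by move: t; lra.
by rewrite (le_trans (taylor_lip2 x y d1 d2 l2))// ler_wpM2r// exprn_ge0.
Qed.

(* The approximant is a second difference quotient of a double antiderivative. *)
Lemma smoothing (C e : R) : 0 <= C -> 0 < e -> exists K, forall f : R -> R,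
  bdlip_by C f -> exists f0 f1 f2,
    smooth K f0 f1 f2 /\ forall x, `|f x - f0 x| <= e.
Proof.
move=> C0 e0.
(* Divided by [h ^+ 2], the Taylor errors at [h] and [2 * h] amount to [2 C h] and [8 C h], hence
   10. The [+ 1] covers [C = 0]. *)
pose h := e / (10 * (C + 1)).
have h0 : 0 < h by rewrite divr_gt0// mulr_gt0// ltr_pwDr.
have hC : 10 * C * h <= e.
  have -> : e = 10 * (C + 1) * h.
    by rewrite /h mulrC divfK// gt_eqF// mulr_gt0// ltr_pwDr.
  by rewrite ler_wpM2r ?(ltW h0)//; lra.
(* [K] is fixed before [f]: the functions to be smoothed will vary with [n], the constant must
   not. *)
clearbody h; exists (2 * C / h + 8 * C / h ^+ 2) => f [fC fL].
have cf : continuous f.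
  move=> x; apply/cvgrPdist_lt => d d0; near=> y.
  rewrite (le_lt_trans (fL x y))// (@le_lt_trans _ _ ((C + 1) * `|x - y|))//.
    by rewrite ler_wpM2r//; lra.
  rewrite mulrC -ltr_pdivlMr ?ltr_pwDr//; near: y.
  by apply: (@nbhsx_ballx R R^o); rewrite divr_gt0// ltr_pwDr.
have [F1 dF1] := antiderivative cf.
have [F2 dF2] : exists F : R -> R, forall x : R, is_derive x 1 F (F1 x).
  apply: antiderivative => x.
  apply: (@differentiable_continuous _ R^o R^o).
  by apply/derivable1_diffP; have [] := dF1 x.
(* [D] commutes with differentiation, so [D F2], [D F1], [D f] are successive derivatives; they are
   bounded although [F2] and [F1] need not be. *)
pose D (u : R -> R) x := (u (x + 2 * h) - 2 * u (x + h) + u x) / h ^+ 2.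
have h20 : 0 < h ^+ 2 by rewrite exprn_gt0.
have dD (u du : R -> R) : (forall x : R, is_derive x 1 u (du x)) ->
    forall x : R, is_derive x 1 (D u) (D du x).
  move=> d1 x.
  have e1 : is_derive x 1 (fun x => u (x + h)) (du (x + h)).
    rewrite (_ : (fun x => u (x + h)) = fun x => u (h + x)) 1?addrC.
      exact: is_derive_translate.
    by apply/funext => z; rewrite addrC.
  have e2 : is_derive x 1 (fun x => u (x + 2 * h)) (du (x + 2 * h)).
    rewrite (_ : (fun x => u (x + 2 * h)) = fun x => u (2 * h + x)) 1?addrC.
      exact: is_derive_translate.
    by apply/funext => z; rewrite addrC.
  by rewrite /D; apply: is_derive_eq; rewrite /GRing.scale/=; ring.
have F1L := derive_bound_lip dF1 fC.
have DB (u : R -> R) M : (forall x, `|u x| <= M) -> forall x, `|D u x| <= 4 * M / h ^+ 2.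
  move=> uM x; rewrite /D normrM (@ger0_norm _ (_^-1)) ?invr_ge0 ?(ltW h20)//.
  rewrite ler_wpM2r ?invr_ge0 ?(ltW h20)//.
  have := uM x; have := uM (x + h); have := uM (x + 2 * h).
  by rewrite !ler_norml => /andP[? ?] /andP[? ?] /andP[? ?]; apply/andP; split; lra.
have DL (u : R -> R) M : (forall x y, `|u x - u y| <= M * `|x - y|) ->
    forall x, `|D u x| <= 2 * M / h.
  move=> uM x; rewrite /D normrM (@ger0_norm _ (_^-1)) ?invr_ge0 ?(ltW h20)//.
  rewrite ler_pdivrMr// (_ : 2 * M / h * h ^+ 2 = 2 * (M * h)); last first.
    by field; rewrite gt_eqF.
  have := uM (x + 2 * h) (x + h); have := uM (x + h) x.
  rewrite (_ : x + h - x = h); last by ring.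
  rewrite (_ : x + 2 * h - (x + h) = h); last by ring.
  rewrite (gtr0_norm h0) !ler_norml => /andP[? ?] /andP[? ?].
  by apply/andP; split; lra.
have G1B := DL _ _ F1L; have G2B := DB _ _ fC.
have f2L x y : `|D f x - D f y| <= 4 * C / h ^+ 2 * `|x - y|.
  have -> : D f x - D f y = D (fun z => f z - f (z - (x - y))) x.
    rewrite /D; have -> : x + 2 * h - (x - y) = y + 2 * h by ring.
    have -> : x + h - (x - y) = y + h by ring.
    have -> : x - (x - y) = y by ring.
    by ring.
  rewrite (_ : _ * _ * _ = 4 * (C * `|x - y|) / h ^+ 2); last by ring.
  apply: DB => z; rewrite (le_trans (fL _ _))//.
  by rewrite (_ : z - (z - (x - y)) = x - y)//; ring.
have t2 x y : `|F2 (x + y) - F2 x - y * F1 x - y ^+ 2 / 2 * f x| <= 2 * C * y ^+ 2.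
  rewrite (le_trans (ler_normB _ _))//.
  have t := taylor_lip x y dF2 F1L.
  have : `|y ^+ 2 / 2 * f x| <= C * y ^+ 2.
    rewrite normrM mulrC ler_pM// normrM !ger0_norm ?sqr_ge0 ?invr_ge0//.
    by move: (sqr_ge0 y); lra.
  by move: t; lra.
have t3 x y := taylor_lip2 x y dF2 dF1 fL.
have close x : `|f x - D F2 x| <= e.
  have a1 := t3 x h; have a2 := t3 x (2 * h).
  apply: le_trans hC.
  rewrite -(@ler_pM2r _ (h ^+ 2))// -{1}(ger0_norm (ltW h20)) -normrM.
  have -> : (f x - D F2 x) * h ^+ 2 =
    2 * (F2 (x + h) - F2 x - h * F1 x - h ^+ 2 / 2 * f x) -
    (F2 (x + 2 * h) - F2 x - 2 * h * F1 x - (2 * h) ^+ 2 / 2 * f x).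
    by rewrite /D mulrBl divfK ?gt_eqF//; field.
  rewrite (le_trans (ler_normB _ _))// normrM (@ger0_norm _ 2)//.
  move: a1 a2; rewrite normrM (gtr0_norm h0) (@ger0_norm _ 2)// exprMn => a1 a2.
  have -> : 10 * C * h * h ^+ 2 = 2 * (C * h ^+ 3) + C * (2 ^+ 3 * h ^+ 3) by ring.
  lra.
have k1 : 0 <= C / h by rewrite divr_ge0// ltW.
have k2 : 0 <= C / h ^+ 2 by rewrite divr_ge0// ltW.
exists (D F2), (D F1), (D f); split=> //.
split.
- exists (C + e + 2 * C / h); split=> [x|x y].
    have := close x; have := fC x.
    by rewrite !ler_norml => /andP[? ?] /andP[? ?]; apply/andP; split; lra.
  rewrite (le_trans (derive_bound_lip (dD _ _ dF2) G1B _ _))//.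
  by rewrite ler_wpM2r//; lra.
- exists (2 * C / h + 4 * C / h ^+ 2); split=> [x|x y].
    by rewrite (le_trans (G1B x))//; lra.
  rewrite (le_trans (derive_bound_lip (dD _ _ dF1) G2B _ _))//.
  by rewrite ler_wpM2r//; lra.
- by exists (4 * C / h ^+ 2); split.
- by move=> x; rewrite (le_trans (G1B x))//; lra.
- by move=> x; rewrite (le_trans (G2B x))//; lra.
move=> x y.
(* By linearity and translation invariance, the Taylor remainder of [D F2] is [D] applied to that of
   [F2]; a uniform bound on the latter costs a factor [4 / h ^+ 2]. *)
pose T x := F2 (x + y) - F2 x - y * F1 x - y ^+ 2 / 2 * f x.
have -> : D F2 (x + y) - D F2 x - y * D F1 x - y ^+ 2 / 2 * D f x = D T x.
  by rewrite /D /T !(addrAC x y); ring.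
have TB z : `|T z| <= 2 * C * min23 y.
  apply: le_min23; first exact: t2.
  apply: le_trans (t3 z y) _; rewrite ler_wpM2r ?exprn_ge0//.
  by rewrite ler_peMl// ler1n.
rewrite (le_trans (DB _ _ TB x))//.
rewrite (_ : 4 * (2 * C * min23 y) / h ^+ 2 = 8 * C / h ^+ 2 * min23 y); last by ring.
by rewrite ler_wpM2r ?min23_ge0//; lra.
Unshelve. all: by end_near. Qed.

(** [w] is [x ^+ 2 / (1 + x ^+ 2)] and [p] is its square: bounded substitutes for [x ^ 2] and
    [x ^ 4]. The domination of [p1] and [p2] by [w] lets the drift of [p] be paid by the [w] term of
    the supersolution. *)
Lemma barrier : exists (K : R) (p p1 p2 w w1 w2 : R -> R),
  [/\ smooth K p p1 p2, smooth K w w1 w2,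
      (forall x, [/\ 0 <= p x, 0 <= w x & w x <= 1]),
      (forall x, `|p1 x| <= K * w x /\ `|p2 x| <= K * w x) &
      [/\ p 0 = 0, w 0 = 0 & forall e, 0 < e -> exists2 c, 0 < c &
        forall x, e <= `|x| -> c <= p x]].
Proof.
pose z (x : R) := (1 + x ^+ 2)^-1.
have q0 (x : R) : 0 < 1 + x ^+ 2 by rewrite ltr_pwDl// sqr_ge0.
have z0 x : 0 < z x by rewrite invr_gt0.
have zE x : z x * (1 + x ^+ 2) = 1 by rewrite mulVf// gt_eqF.
have zE2 x : x ^+ 2 * z x = 1 - z x by rewrite -[in RHS](zE x); ring.
have z1 x : z x <= 1 by have := zE2 x; have := mulr_ge0 (sqr_ge0 x) (ltW (z0 x)); lra.
have dz (x : R) : is_derive x 1 z (- 2 * x * z x ^+ 2).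
  rewrite /z.
  have d : is_derive x 1 (fun x : R => 1 + x ^+ 2) (2 * x).
    by apply: is_derive_eq; rewrite /GRing.scale/=; ring.
  have := @is_deriveV _ (fun x : R => 1 + x ^+ 2) x (2 * x) 1 (lt0r_neq0 (q0 x)) d.
  move/is_derive_eq; apply; rewrite /GRing.scale/= exprVn; by ring.
pose w (x : R) : R := 1 - z x.
pose w1 (x : R) : R := 2 * x * z x ^+ 2.
pose w2 (x : R) : R := 2 * z x ^+ 2 - 8 * x ^+ 2 * z x ^+ 3.
pose w3 (x : R) : R := -24 * x * z x ^+ 3 + 48 * x ^+ 3 * z x ^+ 4.
have dw (x : R) : is_derive x 1 w (w1 x).
  by have d := dz x; rewrite /w /w1; apply: is_derive_eq; rewrite /GRing.scale/=; ring.
have dw1 (x : R) : is_derive x 1 w1 (w2 x).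
  by have d := dz x; rewrite /w1 /w2; apply: is_derive_eq; rewrite /GRing.scale/=; ring.
have dw2 (x : R) : is_derive x 1 w2 (w3 x).
  by have d := dz x; rewrite /w2 /w3; apply: is_derive_eq; rewrite /GRing.scale/=; ring.
have xz x : `|x * z x| <= 1.
  rewrite -(@ler_pXn2r _ 2)// ?nnegrE// expr1n -normrX.
  have -> : (x * z x) ^+ 2 = (x ^+ 2 * z x) * z x by ring.
  rewrite zE2 ger0_norm ?mulr_ge0 ?subr_ge0 ?(ltW (z0 x))//.
  by rewrite -[leRHS]mulr1 ler_pM ?subr_ge0// ?(ltW (z0 x))//; have := z0 x; lra.
have zn x : `|z x| <= 1 by rewrite gtr0_norm.
have w01 x : 0 <= w x <= 1 by rewrite /w subr_ge0 z1/=; have := z0 x; lra.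
have wn x : `|w x| <= 1 by rewrite ger0_norm; have /andP[] := w01 x.
have xxz x : `|x ^+ 2 * z x| <= 1 by rewrite zE2 -/(w x).
have N1 (a b : R) : `|a| <= 1 -> `|b| <= 1 -> `|a * b| <= 1.
  by move=> ha hb; rewrite normrM -[leRHS]mulr1 ler_pM.
have w1n x : `|w1 x| <= 2.
  have -> : w1 x = 2 * (x * z x * z x) by rewrite /w1; ring.
  by rewrite normrM (@ger0_norm _ 2)// ler_piMr// N1.
have w2n x : `|w2 x| <= 10.
  have -> : w2 x = 2 * (z x * z x) - 8 * (x ^+ 2 * z x * (z x * z x)).
    by rewrite /w2; ring.
  have a1 : `|z x * z x| <= 1 by exact: N1.
  have a2 : `|x ^+ 2 * z x * (z x * z x)| <= 1 by do ?apply: N1.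
  rewrite (le_trans (ler_normB _ _))// (@normrM _ 2) (@normrM _ 8).
  by rewrite !normr_nat; lra.
have w3n x : `|w3 x| <= 72.
  have -> : w3 x = -24 * (x * z x * (z x * z x)) + 48 * (x ^+ 2 * z x * ((x * z x) * (z x * z x))).
    by rewrite /w3; ring.
  have a1 : `|x * z x * (z x * z x)| <= 1 by apply: (N1 _ _ (xz x)); apply: N1.
  have a2 : `|x ^+ 2 * z x * ((x * z x) * (z x * z x))| <= 1.
    by apply: (N1 _ _ (xxz x)); apply: (N1 _ _ (xz x)); apply: N1.
  rewrite (le_trans (ler_normD _ _))// (@normrM _ (-24)) (@normrM _ 48).
  by rewrite normrN !normr_nat; lra.
(* The term [w1 ^+ 2] of [p2] has no factor [w]; but [w1] vanishes to first order at 0, so its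
   square is comparable to [w]. *)
have W1w x : w1 x ^+ 2 <= 4 * w x.
  have -> : w1 x ^+ 2 = 4 * ((x ^+ 2 * z x) * (z x) ^+ 3) by rewrite /w1; ring.
  rewrite zE2 -/(w x) ler_pM2l// ler_piMr//; first by have /andP[] := w01 x.
  by rewrite exprn_ile1// ltW.
have sw : smooth (2 * 432) w w1 w2.
  apply: (smooth_of_derive dw dw1 dw2) => x.
  - by rewrite (le_trans (wn x))//; lra.
  - by rewrite (le_trans (w1n x))//; lra.
  - by rewrite (le_trans (w2n x))//; lra.
  - by rewrite (le_trans (w3n x))//; lra.
pose p (x : R) : R := w x ^+ 2.
pose p1 (x : R) : R := 2 * (w x * w1 x).
pose p2 (x : R) : R := 2 * (w1 x ^+ 2 + w x * w2 x).
pose p3 (x : R) : R := 6 * (w1 x * w2 x) + 2 * (w x * w3 x).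
have dp (x : R) : is_derive x 1 p (p1 x).
  by have d := dw x; rewrite /p /p1; apply: is_derive_eq; rewrite /GRing.scale/=; ring.
have dp1 (x : R) : is_derive x 1 p1 (p2 x).
  have d := dw x; have d1 := dw1 x; rewrite /p1 /p2; apply: is_derive_eq.
  by rewrite /GRing.scale/=; ring.
have dp2 (x : R) : is_derive x 1 p2 (p3 x).
  have d := dw x; have d1 := dw1 x; have d2 := dw2 x; rewrite /p2 /p3; apply: is_derive_eq.
  by rewrite /GRing.scale/=; ring.
have NM (a b A B : R) : `|a| <= A -> `|b| <= B -> `|a * b| <= A * B.
  by move=> ha hb; rewrite normrM ler_pM.
have p1w x : `|p1 x| <= 4 * w x.
  have /andP[w0 _] := w01 x.
  rewrite /p1 normrM ger0_norm// normrM (ger0_norm w0).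
  by have : w x * `|w1 x| <= w x * 2 by [exact: ler_wpM2l]; lra.
have p2w x : `|p2 x| <= 28 * w x.
  have /andP[w0 _] := w01 x.
  rewrite /p2 normrM ger0_norm// (_ : 28 * w x = 2 * (4 * w x + w x * 10)); last by ring.
  rewrite ler_pM2l// (le_trans (ler_normD _ _))// lerD//.
    by rewrite ger0_norm ?sqr_ge0.
  by rewrite normrM (ger0_norm w0) ler_wpM2l.
have sp : smooth (2 * 432) p p1 p2.
  apply: (smooth_of_derive dp dp1 dp2) => x.
  - by rewrite /p expr2 (le_trans (N1 _ _ (wn x) (wn x)))//; lra.
  - by rewrite (le_trans (p1w x))//; have /andP[] := w01 x; lra.
  - by rewrite (le_trans (p2w x))//; have /andP[] := w01 x; lra.
  - rewrite /p3 (le_trans (ler_normD _ _))// (@normrM _ 6) (@normrM _ 2).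
    have := NM _ _ _ _ (w1n x) (w2n x); have := NM _ _ _ _ (wn x) (w3n x).
    by rewrite !normr_nat; lra.
exists (2 * 432), p, p1, p2, w, w1, w2; split=> //.
- by move=> x; have /andP[? ?] := w01 x; split=> //; exact: sqr_ge0.
- move=> x; have /andP[w0 _] := w01 x.
  by split; [rewrite (le_trans (p1w x))|rewrite (le_trans (p2w x))]; lra.
split.
- by rewrite /p /w /z expr0n addr0 invr1 subrr expr0n.
- by rewrite /w /z expr0n addr0 invr1 subrr.
move=> e e0; exists (w e ^+ 2).
  rewrite exprn_gt0// /w -zE2 mulr_gt0// exprn_gt0//.
move=> x ex; rewrite /p lerXn2r ?nnegrE//; first by have /andP[] := w01 e.
  by have /andP[] := w01 x.
rewrite /w lerB// /z lef_pV2 ?posrE// lerD2l -[leRHS](real_normK (num_real x)).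
by rewrite lerXn2r// nnegrE ltW.
Qed.

End smoothing.

(** * Comparison of two walks through their block sums *)

Section comparison.
Variable R : realType.
Implicit Types (I : (R -> R) -> R) (Th : (nat -> R) -> R).

(** [N] is the last index that is read: with [e = 0] the second clause makes the functional blind to
    later values. *)
Definition plip (N : nat) (M L : R) Th :=
  (forall p, `|Th p| <= M) /\
  (forall (p p' : nat -> R) e, (forall k, (k <= N)%N -> `|p k - p' k| <= e) ->
    `|Th p - Th p'| <= L * e).

Lemma blip_plip N M L Th (g : seq R -> nat -> R) : 0 <= L -> plip N M L Th ->
  (forall s t k, size s = size t -> `|g s k - g t k| <= sdist s t) ->
  blip (M + L) (fun s => Th (g s)).
Proof.
move=> L0 [ThM ThL] gL; have M0 : 0 <= M := le_trans (normr_ge0 _) (ThM (fun=> 0)).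
split=> [s|s t st]; first by rewrite (le_trans (ThM _))// lerDl.
rewrite (le_trans (ThL _ _ (sdist s t) _))//; first by move=> k _; exact: gL.
by rewrite ler_wpM2r ?sdist_ge0// lerDr.
Qed.

Lemma imean_widen I N N' M L Th : mean I -> plip N M L Th -> (N <= N')%N ->
  imean I N (fun s => Th (sumk s)) = imean I N' (fun s => Th (sumk s)).
Proof.
move=> mI [_ ThL] NN'; rewrite -(subnKC NN') imean_cat; apply: eq_imean => s sN.
rewrite -[LHS](imean_cst (N' - N) _ mI); apply: eq_imean => t _.
apply/eqP; rewrite -subr_eq0 -normr_le0 -(mulr0 L); apply: ThL => k kN.
by rewrite sumk_catl ?sN// subrr normr0.
Qed.

Lemma min_dist (a b c d e : R) : `|a - c| <= e -> `|b - d| <= e ->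
  `|Num.min a b - Num.min c d| <= e.
Proof.
rewrite !ler_distlC => /andP[a1 a2] /andP[b1 b2]; apply/andP; split.
  by rewrite le_min !lerBlDr !ge_min; apply/andP; split; apply/orP; lra.
by rewrite -lerBlDr le_min !lerBlDr !ge_min; apply/andP; split; apply/orP; lra.
Qed.

(** A Lipschitz substitute for the indicator of [e <= |x|], because means are controlled on bounded
    Lipschitz functions only. *)
Definition ramp (e : R) (x : R) : R := Num.min 1 (Num.max 0 (2 * `|x| / e - 1)).

Lemma ramp01 e x : 0 <= ramp e x <= 1.
Proof. by rewrite /ramp le_min ge_min ler01 !le_max !lexx. Qed.

Lemma ramp1 e x : 0 < e -> e <= `|x| -> ramp e x = 1.
Proof.
move=> e0 ex; apply/min_idPl; rewrite le_max; apply/orP; right.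
by rewrite lerBrDr ler_pdivlMr//; lra.
Qed.

Lemma ramp0 e x : 0 < e -> `|x| < e / 2 -> ramp e x = 0.
Proof.
move=> e0 ex; rewrite /ramp (_ : Num.max _ _ = 0); first exact/min_idPr.
apply/max_idPl; rewrite subr_le0 ler_pdivrMr//; lra.
Qed.

Lemma bdlip_ramp e : 0 < e -> bdlip_by (1 + 2 / e) (ramp e).
Proof.
move=> e0; have ei : 0 <= 2 / e by rewrite divr_ge0// ltW.
split=> [x|x y].
  by have /andP[r0 r1] := ramp01 e x; rewrite ger0_norm// (le_trans r1)// lerDl.
have h : `|(2 * `|x| / e - 1) - (2 * `|y| / e - 1)| <= (1 + 2 / e) * `|x - y|.
  have -> : 2 * `|x| / e - 1 - (2 * `|y| / e - 1) = 2 / e * (`|x| - `|y|) by ring.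
  rewrite normrM (ger0_norm ei) ler_pM//; first by rewrite lerDr.
  exact: ler_dist_dist.
have z : `|(0 : R) - 0| <= (1 + 2 / e) * `|x - y|.
  by rewrite subrr normr0 mulr_ge0// addr_ge0.
apply: min_dist; first by rewrite subrr -(subrr (0 : R)).
exact: max_dist.
Qed.

(** Either the path stays within [e] of its value at the start of the current block, at cost
    [L * e]; or some block moves by more than [e], its running maximum reaches 1 and pays for the
    trivial bound [2 * M]. *)
Lemma coarse_bound N M L Th m q e s : (0 < m)%N -> 0 < e -> 0 <= L ->
  (N < q * m)%N -> size s = (q * m)%N -> plip N M L Th ->
  `|Th (sumk s) - Th (fun k => sumk (coarsen m q s) (k %/ m))| <=
    L * e + 2 * M * sum_blocks m q (run_max (ramp e) 0) s.
Proof.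
move=> m0 e0 L0 Nq ss [ThM ThL].
have M0 : 0 <= M := le_trans (normr_ge0 _) (ThM (fun=> 0)).
have mx0 x t : 0 <= run_max (ramp e) x t.
  have := @run_max_ge _ (ramp e) x t 0 (leq0n _); apply: le_trans.
  by have /andP[] := ramp01 e (x + sumk t 0).
have bsum0 : 0 <= sum_blocks m q (run_max (ramp e) 0) s.
  by elim: q (s) {Nq ss} => //= q IH s'; rewrite addr_ge0.
have [allk|/existsNP[k /not_implyP[kN /negP ke]]] :=
    pselect (forall k, (k <= N)%N -> `|sumk s k - sumk (coarsen m q s) (k %/ m)| <= e).
  by rewrite (le_trans (ThL _ _ _ allk))// lerDl mulr_ge0// mulr_ge0.
rewrite -ltNge in ke.
have jq : (k %/ m < q)%N by rewrite ltn_divLR// (leq_ltn_trans kN).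
have blockn : 1 <= run_max (ramp e) 0 (take m (drop (k %/ m * m) s)).
  have km : (k %% m < m)%N by rewrite ltn_pmod.
  have sz : (k %% m <= size (take m (drop (k %/ m * m) s)))%N.
    rewrite size_take_min size_drop ss -mulnBl leq_min (ltnW km)/=.
    by rewrite (leq_trans (ltnW km))// leq_pmull// subn_gt0.
  have := @run_max_ge _ (ramp e) 0 _ _ sz; apply: le_trans.
  rewrite add0r sumk_take ?(ltnW km)// ramp1//.
  rewrite sumk_coarsen 1?ltnW// in ke.
  by rewrite [in sumk s k](divn_eq k m) sumkD addrAC subrr add0r in ke; exact: ltW.
have b1 : 1 <= sum_blocks m q (run_max (ramp e) 0) s.
  by rewrite (le_trans blockn)//; apply: sum_blocks_ge.
rewrite (le_trans (ler_normB _ _))//.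
have := ThM (sumk s); have := ThM (fun k => sumk (coarsen m q s) (k %/ m)).
have : 2 * M <= 2 * M * sum_blocks m q (run_max (ramp e) 0) s by rewrite ler_peMr// mulr_ge0.
have : 0 <= L * e by rewrite mulr_ge0// ltW.
lra.
Qed.

Lemma coarse_mean I N M L Th m q e B : mean I -> (0 < m)%N -> 0 < e -> 0 <= L ->
  (N < q * m)%N -> plip N M L Th -> imean I m (run_max (ramp e) 0) <= B ->
  `|imean I N (fun s => Th (sumk s)) -
    imean (block I m) q (fun d => Th (fun k => sumk d (k %/ m)))| <=
    L * e + 2 * M * (q%:R * B).
Proof.
move=> mI m0 e0 L0 Nq ThL JB; have [ThM _] := ThL.
have M0 : 0 <= M := le_trans (normr_ge0 _) (ThM (fun=> 0)).
rewrite (imean_widen mI ThL (ltnW Nq)).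
rewrite -(imean_block I m q (fun d => Th (fun k => sumk d (k %/ m)))).
have bF : blip (M + L) (fun s => Th (sumk s)).
  by apply: (blip_plip L0 ThL) => s t k st; exact: sumk_lip.
have bG : blip (M + L) (fun s => Th (fun k => sumk (coarsen m q s) (k %/ m))).
  apply: (blip_plip L0 ThL) => s t k st.
  have [kq|kq] := leqP (k %/ m) q; first by rewrite !sumk_coarsen// sumk_lip.
  (* Past the last block the missing entries read as 0, so the partial sum stays at its final
     value. *)
  have big (u : seq R) : sumk (coarsen m q u) (k %/ m) = sumk (coarsen m q u) q.
    have sb : size (coarsen m q u) = q by elim: {Nq kq JB} q u => //= q IH u; rewrite IH.
    rewrite -(subnKC (ltnW kq)) sumkD drop_oversize ?sb// [X in _ + X]big1 ?addr0//.
    by move=> i _; rewrite nth_nil.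
  by rewrite !big !sumk_coarsen// sumk_lip.
have bR := blip_run_max 0 (bdlip_ramp e0).
have bS := blip_sum_blocks m q bR.
pose H (s : seq R) := 2 * M * sum_blocks m q (run_max (ramp e) 0) s + L * e.
have bH : blip (`|2 * M| * (q%:R * (1 + 2 / e)) + `|L * e|) H.
  by apply: blip_lin => //; exact: blip_cst.
have JH : imean I (q * m) H <= L * e + 2 * M * (q%:R * B).
  rewrite (imean_lin _ _ mI bS (blip_cst (L * e))) imean_cst// (imean_sum_blocks _ _ mI bR) addrC lerD2l.
  by rewrite ler_wpM2l ?mulr_ge0// ler_wpM2l.
rewrite (le_trans _ JH)//.
(* The bound [H] depends on the path, so the uniform estimate [imean_dist] does not apply;
   [- H <= D <= H] is integrated by monotonicity. *)
pose D (s : seq R) := (-1) * Th (fun k => sumk (coarsen m q s) (k %/ m)) + Th (sumk s).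
have bD := blip_lin (-1) bG bF; rewrite -/D in bD.
have -> : imean I (q * m) (fun s => Th (sumk s)) -
    imean I (q * m) (fun s => Th (fun k => sumk (coarsen m q s) (k %/ m))) = imean I (q * m) D.
  by rewrite (imean_lin _ _ mI bG bF) mulN1r addrC.
have cb s : size s = (q * m)%N -> `|D s| <= H s.
  move=> ss; rewrite /D /H mulN1r addrC [leRHS]addrC.
  exact: coarse_bound ThL.
rewrite ler_norml; apply/andP; split; last first.
  apply: (imean_le mI bD bH) => s /cb; exact: le_trans (ler_norm _).
have bH' := blip_lin (-1) bH (blip_cst (0 : R)).
have -> : - imean I (q * m) H = imean I (q * m) (fun s => (-1) * H s + 0).
  by rewrite (imean_lin _ _ mI bH (blip_cst (0 : R))) imean_cst// addr0 mulN1r.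
apply: (imean_le mI bH' bD) => s /cb.
by rewrite addr0 mulN1r ler_norml => /andP[].
Qed.

(** The choices are nested: oscillation level [e1], barrier height [c], number [u] of blocks per [n]
    steps, smoothing precision [e2] with its constant [K], and last [kap]. None depends on [n], on
    the laws or on [Th]. The budget is [eps / 3] for each of the two coarsenings and [eps / 3] for
    the exchange of block sums. *)
Lemma lindeberg_swap (A M L T eps : R) : 0 <= A -> 0 <= M -> 0 <= L -> 0 <= T -> 0 < eps ->
  exists (kap : R) (n0 : nat), 0 < kap /\
  forall n I I' a v d a' v' d' N Th, (n0 <= n)%N ->
    mean I -> mean I' -> moments I a v d -> moments I' a' v' d' ->
    0 <= d -> 0 <= d' ->
    n%:R * (`|a| + `|v|) <= A -> n%:R * (`|a'| + `|v'|) <= A ->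
    n%:R * (`|a - a'| + `|v - v'| + d + d') <= kap ->
    N%:R <= T * n%:R -> plip N M L Th ->
    `|imean I N (fun s => Th (sumk s)) - imean I' N (fun s => Th (sumk s))| <= eps.
Proof.
move=> A0 M0 L0 T0 eps0.
pose e1 := eps / (6 * (L + 1)).
have L10 : 0 < L + 1 by rewrite ltr_pwDr.
have e10 : 0 < e1 by rewrite divr_gt0// mulr_gt0.
have Le1 : L * e1 <= eps / 6.
  rewrite (_ : eps / 6 = (L + 1) * e1); last by rewrite /e1; field; rewrite gt_eqF.
  by rewrite ler_wpM2r ?(ltW e10)// lerDl.
have [K0 [p [p1 [p2 [w [w1 [w2 [sp sw pw p12 [p00 w00 pc]]]]]]]]] := barrier R.
have [c c0 cp] := pc (e1 / 2) (divr_gt0 e10 (ltr0Sn _ _)).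
have K00 : 0 <= K0 by apply: le_trans (smooth_b1 sp 0).
pose tau := (Num.truncn T).+1.
have Ttau : T < tau%:R by have /andP[] := truncn_itv T0.
have tau0 : (0 : R) < tau%:R by rewrite ltr0n.
(* Quadratic term of the barrier summed over [tau * u] blocks, each of order
   [(2 K0 (A + 1) / u) ^ 2]: one factor [u] against two leaves [B1 / u]. The term linear in [d]
   gives [B2 * kap]. *)
pose B1 := 2 * M * tau%:R * c^-1 * (4 * (K0 * (A + 1)) ^+ 2).
have B10 : 0 <= B1.
  rewrite /B1; apply: mulr_ge0; last by rewrite mulr_ge0// sqr_ge0.
  by rewrite !mulr_ge0// invr_ge0 ltW.
pose u := (Num.truncn (12 * B1 / eps)).+1.
have uB : B1 / u%:R <= eps / 12.
  have : 12 * B1 / eps < u%:R.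
    by have /andP[] := @truncn_itv _ (12 * B1 / eps) (divr_ge0 (mulr_ge0 (ler0n _ _) B10) (ltW eps0)).
  rewrite ltr_pdivrMr// => h; rewrite ler_pdivrMr ?ltr0n//; lra.
have u0 : (0 : R) < u%:R by rewrite ltr0n.
(* Each of the [tau * u] exchanges pays twice the smoothing error, a total of [eps / 6]. *)
pose e2 := eps / (12 * tau%:R * u%:R).
have e20 : 0 < e2 by rewrite divr_gt0// !mulr_gt0.
have [K smoothK] := smoothing (addr_ge0 M0 L0) e20.
pose B2 := 2 * M * tau%:R * c^-1 * (2 * K0).
have B20 : 0 <= B2 by rewrite /B2 !mulr_ge0// ?invr_ge0 ltW.
pose kap := Num.min 1 (Num.min (eps / (12 * (B2 + 1))) (eps / (12 * (tau%:R * `|K| + 1)))).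
have B210 : 0 < B2 + 1 by rewrite ltr_pwDr.
have K10 : 0 < tau%:R * `|K| + 1 by rewrite ltr_pwDr// mulr_ge0// ltW.
have kap0 : 0 < kap by rewrite !lt_min ltr01 !divr_gt0// mulr_gt0.
have kap1 : kap <= 1 by rewrite /kap ge_min lexx.
have kapB : B2 * kap <= eps / 12.
  have : kap <= eps / (12 * (B2 + 1)) by rewrite /kap !ge_min lexx !orbT.
  rewrite ler_pdivlMr ?mulr_gt0// => h.
  have : B2 * kap <= (B2 + 1) * kap by rewrite ler_wpM2r ?(ltW kap0)// lerDl.
  by lra.
have kapK : tau%:R * `|K| * kap <= eps / 12.
  have : kap <= eps / (12 * (tau%:R * `|K| + 1)) by rewrite /kap !ge_min lexx !orbT.
  rewrite ler_pdivlMr ?mulr_gt0// => h.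
  have : tau%:R * `|K| * kap <= (tau%:R * `|K| + 1) * kap.
    by rewrite ler_wpM2r ?(ltW kap0)// lerDl.
  by lra.
(* From [u <= n] the block length [m] is at most [2 n / u]. *)
exists kap, u; split=> // n I I' a v d a' v' d' N Th un mI mI' mo mo' d0 d'0 nA nA' nk NT ThL.
have n0 : (0 < n)%N by exact: leq_trans un.
have n0R : (0 : R) < n%:R by rewrite ltr0n.
pose m := (n %/ u).+1.
pose q := (tau * u)%N.
have num : (n < u * m)%N by rewrite mulnC ltn_ceil.
have Nq : (N < q * m)%N.
  rewrite -(@ltr_nat R) (le_lt_trans NT)//.
  rewrite (@lt_le_trans _ _ (tau%:R * n%:R))//; first by rewrite ltr_pM2r.
  by rewrite -natrM ler_nat /q -mulnA leq_mul2l (ltnW num) orbT.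
have mnu : m%:R / n%:R <= 2 / u%:R :> R.
  rewrite ler_pdivrMr// mulrAC ler_pdivlMr// -!natrM ler_nat.
  by rewrite (mulSn (n %/ u)) mul2n -addnn leq_add// leq_divM.
have mn0 : 0 <= m%:R / n%:R :> R by rewrite divr_ge0.
have bd I0 a0 v0 d0' : mean I0 -> moments I0 a0 v0 d0' -> 0 <= d0' ->
    n%:R * (`|a0| + `|v0|) <= A -> n%:R * d0' <= kap ->
    `|imean I0 N (fun s => Th (sumk s)) -
    imean (block I0 m) q (fun d => Th (fun k => sumk d (k %/ m)))| <= eps / 3.
  move=> mI0 mo0 d00 nA0 nd0.
  pose b := K0 * (`|a0| + `|v0| + d0').
  have b0 : 0 <= b by rewrite mulr_ge0// !addr_ge0.
  have jb : imean I0 m (run_max (ramp e1) 0) <= c^-1 * ((m%:R * b) ^+ 2 + m%:R * (K0 * d0')).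
    have -> : (m%:R * b) ^+ 2 + m%:R * (K0 * d0') =
       p 0 + m%:R * b * w 0 + (m%:R * b) ^+ 2 + m%:R * (K0 * d0').
      by rewrite p00 w00; ring.
    apply: (imean_run_max_le m 0 mI0 mo0 sp sw c0 d00) => //.
    - by move=> x; have [] := pw x.
    - by move=> x; have [] := pw x.
    - by move=> x; have [] := pw x.
    - by move=> x; have [] := p12 x.
    - by move=> x; have [] := p12 x.
    - by exists (1 + 2 / e1); exact: bdlip_ramp.
    - exact: ramp01.
    - move=> x; have [ex|ex] := leP (e1 / 2) `|x|; first by left; exact: cp.
      by right; exact: ramp0.
  rewrite (le_trans (coarse_mean mI0 (ltn0Sn _) e10 L0 Nq ThL jb))//.
  have nb : n%:R * b <= K0 * (A + 1).
    by rewrite mulrCA ler_wpM2l// mulrDr; lra.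
  have mb : m%:R * b <= 2 * (K0 * (A + 1)) / u%:R.
    have -> : m%:R * b = m%:R / n%:R * (n%:R * b) by field; rewrite gt_eqF.
    rewrite (mulrAC 2); exact: (ler_pM mn0 (mulr_ge0 (ltW n0R) b0) mnu nb).
  have md : m%:R * (K0 * d0') <= 2 * K0 * kap / u%:R.
    have -> : m%:R * (K0 * d0') = m%:R / n%:R * (K0 * (n%:R * d0')).
      by field; rewrite gt_eqF.
    rewrite (_ : 2 * K0 * kap / u%:R = 2 / u%:R * (K0 * kap)); last by ring.
    apply: (ler_pM mn0 _ mnu); first by rewrite !mulr_ge0.
    by rewrite ler_wpM2l.
  have mb2 : (m%:R * b) ^+ 2 <= (2 * (K0 * (A + 1)) / u%:R) ^+ 2.
    have mb0 : 0 <= m%:R * b by rewrite mulr_ge0.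
    by rewrite lerXn2r// nnegrE// (le_trans mb0).
  have : 2 * M * (q%:R * (c^-1 * ((m%:R * b) ^+ 2 + m%:R * (K0 * d0')))) <=
     2 * M * (q%:R * (c^-1 * ((2 * (K0 * (A + 1)) / u%:R) ^+ 2 + 2 * K0 * kap / u%:R))).
    by do ?[apply: ler_wpM2l; first by rewrite ?mulr_ge0// ?invr_ge0 ltW]; exact: lerD.
  have -> : 2 * M * (q%:R * (c^-1 * ((2 * (K0 * (A + 1)) / u%:R) ^+ 2 + 2 * K0 * kap / u%:R)))
      = B1 / u%:R + B2 * kap.
    by rewrite /q natrM /B1 /B2; field; rewrite !gt_eqF.
  by move: uB kapB Le1; lra.
have bdI : n%:R * d <= kap.
  rewrite (le_trans _ nk)// ler_pM2l//.
  by move: (normr_ge0 (a - a')) (normr_ge0 (v - v')); lra.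
have bdI' : n%:R * d' <= kap.
  rewrite (le_trans _ nk)// ler_pM2l//.
  by move: (normr_ge0 (a - a')) (normr_ge0 (v - v')); lra.
have h1 := bd _ _ _ _ mI mo d0 nA bdI; have h2 := bd _ _ _ _ mI' mo' d'0 nA' bdI'.
have h3 : `|imean (block I m) q (fun d => Th (fun k => sumk d (k %/ m))) -
    imean (block I' m) q (fun d => Th (fun k => sumk d (k %/ m)))| <= eps / 3.
  have bG : blip (M + L) (fun d => Th (fun k => sumk d (k %/ m))).
    by apply: (blip_plip L0 ThL) => s t k st; exact: sumk_lip.
  have sb f : bdlip_by (M + L) f -> `|block I m f - block I' m f| <=
      2 * e2 + 2 * `|K| * kap / u%:R.
    move=> bf; have [f0 [f1 [f2 [sf ff0]]]] := smoothK f bf.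
    rewrite (le_trans (swap_bdlip m mI mI' mo mo' bf sf ff0))// lerD2l.
    set k' := _ + d' in nk *.
    have k'0 : 0 <= k' by rewrite !addr_ge0.
    have -> : m%:R * (K * k') = m%:R / n%:R * (K * (n%:R * k')).
      by field; rewrite gt_eqF.
    rewrite (_ : 2 * `|K| * kap / u%:R = 2 / u%:R * (`|K| * kap)); last by ring.
    rewrite (@le_trans _ _ (m%:R / n%:R * (`|K| * (n%:R * k'))))//.
      by rewrite ler_wpM2l// ler_wpM2r ?mulr_ge0// ler_norm.
    apply: (ler_pM mn0 _ mnu); first by rewrite !mulr_ge0.
    by rewrite ler_wpM2l.
  have := imean_compare q (mean_block m mI) (mean_block m mI') sb bG.
  have -> : q%:R * (2 * e2 + 2 * `|K| * kap / u%:R) = eps / 6 + 2 * (tau%:R * `|K| * kap).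
    by rewrite /q natrM /e2; field; rewrite !gt_eqF.
  by move/le_trans; apply; move: kapK; lra.
set x := imean I N _ in h1 *; set y := imean (block I m) q _ in h1 h3.
set x' := imean I' N _ in h2 *; set y' := imean (block I' m) q _ in h2 h3.
move: h1 h2 h3; rewrite !ler_norml => /andP[? ?] /andP[? ?] /andP[? ?].
by apply/andP; split; lra.
Qed.

End comparison.

(** * Random elements and laws *)

Section borel.
Import HBSimple.
Context d (Omega : measurableType d) (R : realType).

Definition borel (S : topologicalType) (Z : Omega -> S) :=
  forall U : set S, open U -> measurable (Z @^-1` U).

Lemma borel_random_element (S : ptopologicalType) (Z : Omega -> S) :
  borel Z -> random_element Z.
Proof.
move=> mZ; apply: (@measurability _ _ Omega (g_sigma_algebraType (@open S)) setT Z (@open S)) => //.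
by move=> _ [U oU <-]; rewrite setTI; exact: mZ.
Qed.

Lemma borel_cst (S : topologicalType) (z : S) : borel (fun=> z).
Proof.
by move=> U _; have [h|h] := pselect (U z);
  [rewrite preimage_cst mem_set|rewrite preimage_cst memNset].
Qed.

Lemma borel_comp (S S' : topologicalType) (Z : Omega -> S) (h : S -> S') :
  continuous h -> borel Z -> borel (h \o Z).
Proof. by move=> ch mZ U oU; rewrite comp_preimage; apply: mZ; exact: open_comp. Qed.

Lemma borel_measurable (Z : Omega -> R) : borel Z -> measurable_fun setT Z.
Proof.
move=> mZ; apply: (measurability _ (measurable_realfun.RGenOpens.measurableE R)).
move=> _ [_ [a [b ->]] <-]; rewrite setTI; apply: mZ; exact: interval_open.
Qed.

(** [Z w] lies in [U] exactly when, for some [j], the [Zn n w] eventually lie in [V j], made of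
    points with a margin of order [1 / j] inside [U]. Interiors are taken because balls need not be
    open. *)
Lemma borel_cvg (S : pseudoMetricType R) (Zn : nat -> Omega -> S) (Z : Omega -> S) :
  (forall n, borel (Zn n)) -> (forall w, Zn n w @[n --> \oo] --> Z w) -> borel Z.
Proof.
move=> mZn Znl U oU.
pose V j := \bigcup_(x in [set x | ball x (2 / j.+1%:R) `<=` U]) (ball x (j.+1%:R^-1))°.
have -> : Z @^-1` U = \bigcup_j \bigcup_m \bigcap_n (Zn (m + n)%N @^-1` V j).
  apply/seteqP; split => [w Uw|w [j _ [m _ Vw]]].
    have /nbhs_ballP[e e0 eU] : nbhs (Z w) U by exact: open_nbhs_nbhs.
    have [j je] : exists j : nat, 2 / j.+1%:R < e.
      exists (Num.truncn (2 / e)); rewrite ltr_pdivrMr// mulrC -ltr_pdivrMr//.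
      by have /andP[] := @truncn_itv _ (2 / e) (divr_ge0 (ler0n _ _) (ltW e0)).
    exists j => //.
    have j0 : 0 < j.+1%:R^-1 :> R by rewrite invr_gt0.
    have [m _ mP] := Znl w _ (nbhs_interior (nbhsx_ballx (Z w) _ j0)).
    exists m => // n _; exists (Z w).
      by apply: subset_trans eU; apply: le_ball; exact: ltW.
    by apply: mP; rewrite /= leq_addr.
  have j0 : 0 < j.+1%:R^-1 :> R by rewrite invr_gt0.
  have [k _ kP] := Znl w _ (nbhsx_ballx (Z w) _ j0).
  have [x xU xZ] := Vw k I.
  apply: xU; rewrite (_ : 2 / j.+1%:R = j.+1%:R^-1 + j.+1%:R^-1); last by ring.
  apply: (ball_triangle (interior_subset xZ)); apply: ball_sym.
  by apply: kP; rewrite /= leq_addl.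
apply: bigcupT_measurable => j; apply: bigcupT_measurable => m.
apply: bigcapT_measurable => n; apply: mZn.
by apply: bigcup_open => x _; exact: open_interior.
Qed.

(** The identity of the line is approximated rather than a given variable: [rho k \o X] is then a
    simple function of [X], and independence of the [X] applies to it. *)
Lemma simple_approx : exists rho : nat -> R -> R,
  [/\ forall k, exists s : seq R, uniq s /\ forall y, rho k y \in s,
      forall k, measurable_fun setT (rho k) &
      forall y, rho k y @[k --> \oo] --> y].
Proof.
have mE : measurable_fun [set: R] (@EFin R) by exact: EFin_measurable.
have [g gP] := approximation_sfun measurableT mE.
exists (fun k (y : R) => g k y); split.
- move=> k; exists (fset_set (range (g k))); split; first exact: fset_uniq.
  move=> y; rewrite in_fset_set; last exact: fimfunP.
  by rewrite inE; exists y.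
- by move=> k; exact: measurable_funPT.
- move=> y; have := gP y I; rewrite fine_cvgP => -[_]; exact.
Qed.

Definition sample (X : nat -> Omega -> R) i N w := [seq X l w | l <- iota i N].

(** Separate continuity in each coordinate: the variables will be approximated one at a time. *)
Definition seqcont (S : topologicalType) (F : seq R -> S) :=
  forall s t (u : nat -> R) (y : R), u k @[k --> \oo] --> y ->
    F (s ++ u k :: t) @[k --> \oo] --> F (s ++ y :: t).

Lemma seqcont_cons (S : topologicalType) (F : seq R -> S) v :
  seqcont F -> seqcont (fun s => F (v :: s)).
Proof. by move=> cF s t u y uy; exact: (cF (v :: s)). Qed.

(** If the first coordinate takes finitely many values, the preimage of an open set is a finite
    union over them; [borel_cvg] then removes the discretization. No product sigma-algebra is
    involved. *)
Lemma borel_sample (S : pseudoMetricType R) (X : nat -> Omega -> R) (F : seq R -> S) i N :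
  (forall l, measurable_fun setT (X l)) -> seqcont F ->
  borel (fun w => F (sample X i N w)).
Proof.
move=> mX; have [rho [rhoF rhoM rhoC]] := simple_approx.
elim: N F i => [|N IH] F i cF; first exact: (borel_cst (F [::])).
apply: (@borel_cvg S (fun k w => F (rho k (X i w) :: sample X i.+1 N w))).
  move=> k U oU; have [s [_ sP]] := rhoF k.
  rewrite (_ : _ @^-1` _ = \bigcup_(v in [set` s])
     ((X i @^-1` (rho k @^-1` [set v])) `&` ((fun w => F (v :: sample X i.+1 N w)) @^-1` U))).
    apply: fin_bigcup_measurable; first exact: finite_seq.
    move=> v _; apply: measurableI; last first.
      by apply: (IH (fun s => F (v :: s))) => //; exact: seqcont_cons.
    rewrite -[X in measurable X]setTI; apply: mX => //.
    by rewrite -[X in measurable X]setTI; apply: rhoM.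
  apply/seteqP; split => [w Fw|w [v _ [/= <- //]]].
  by exists (rho k (X i w)); [exact: sP|split].
move=> w; exact: (cF [::]).
Qed.

Lemma blip_seqcont C (F : seq R -> R) : blip C F -> seqcont F.
Proof.
move=> bF s t u y uy; apply/cvgrPdist_lt => e e0.
have C0 := blip_ge0 bF.
move/cvgrPdist_lt : uy => /(_ (e / (C + 1))) [].
  by rewrite divr_gt0// ltr_pwDr.
move=> m _ mP; exists m => // k /mP /=; have [_ /(_ (s ++ y :: t) (s ++ u k :: t))] := bF.
rewrite !size_cat/= => /(_ erefl) h.
rewrite ltr_pdivlMr ?ltr_pwDr//; apply: le_lt_trans; apply: le_trans h _.
rewrite sdist_cat// sdistss add0r /= sdistss addr0 mulrC ler_wpM2l//.
by rewrite lerDl.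
Qed.

End borel.

Section expectation.
Context d (Omega : measurableType d) (R : realType) (P : probability Omega R).
Implicit Types (X Y : Omega -> R) (C : R).

Lemma bounded_integrable X C : measurable_fun setT X ->
  (forall w, `|X w| <= C) -> P.-integrable setT (EFin \o X).
Proof.
move=> mX XC; apply: measurable_bounded_integrable => //.
  exact: fin_num_fun_lty.
exists C; split; first by rewrite num_real.
by move=> M CM w _ /=; rewrite (le_trans (XC w))// ltW.
Qed.

Lemma Rint_lin a X Y : P.-integrable setT (EFin \o X) ->
  P.-integrable setT (EFin \o Y) ->
  \int[P]_w (a * X w + Y w) = a * \int[P]_w X w + \int[P]_w Y w.
Proof.
move=> iX iY; rewrite RintegralD//; first by rewrite RintegralZl.
by have := integrableZl measurableT a iX.
Qed.

Lemma Rint_cst c : \int[P]_w (fun=> c) w = c.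
Proof. by rewrite Rintegral_cst//= probability_setT mulr1. Qed.

Lemma Rint_cvg (Xn : nat -> Omega -> R) X C :
  (forall n, measurable_fun setT (Xn n)) -> measurable_fun setT X ->
  (forall n w, `|Xn n w| <= C) ->
  (forall w, Xn n w @[n --> \oo] --> X w) ->
  \int[P]_w Xn n w @[n --> \oo] --> \int[P]_w X w.
Proof.
move=> mXn mX XnC Xnl.
have C0 : 0 <= C by apply: le_trans (XnC 0%N point).
have XC w : `|X w| <= C.
  rewrite -(cvg_lim _ (cvg_norm (Xnl w)))//; apply: limr_le => //.
    by apply: is_cvg_norm; apply/cvg_ex; exists (X w).
  by apply: nearW => n; exact: XnC.
have iX : P.-integrable setT (EFin \o X) by exact: bounded_integrable XC.
have iXn n : P.-integrable setT (EFin \o Xn n) by exact: bounded_integrable (XnC n).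
have h : (\int[P]_w (Xn n w)%:E)%E @[n --> \oo] --> (\int[P]_w (X w)%:E)%E.
  apply: (@dominated_cvg _ _ _ P setT measurableT _ _ (fun=> C%:E)) => //.
  - by move=> n; apply/measurable_EFinP.
  - by move=> w _; apply: cvg_EFin; [exact: nearW|exact: Xnl].
  - exact: finite_measure_integrable_cst.
  - by move=> n w _; rewrite lee_fin.
rewrite /Rintegral; apply: fine_cvg; rewrite fineK//.
exact: integrable_fin_num.
Qed.

Lemma Rint_sum (I : Type) (s : seq I) (h : I -> Omega -> R) C :
  (forall i, measurable_fun setT (h i)) -> (forall i w, `|h i w| <= C) ->
  \int[P]_w (\sum_(i <- s) h i w) = \sum_(i <- s) \int[P]_w h i w.
Proof.
move=> mh hC; elim: s => [|i s IH].
  by rewrite big_nil; under eq_Rintegral do rewrite big_nil; rewrite Rint_cst.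
rewrite big_cons -IH; under eq_Rintegral do rewrite big_cons.
rewrite RintegralD//; first exact: bounded_integrable (hC i).
apply: (@bounded_integrable _ ((size s)%:R * C)); first exact: measurable_sum.
move=> w; elim: s {IH} => [|j s IH]; first by rewrite big_nil normr0 mul0r.
rewrite big_cons/= -add1n natrD mulrDl mul1r (le_trans (ler_normD _ _))//.
exact: lerD.
Qed.

Lemma bdlip_continuous C (f : R -> R) : bdlip_by C f -> continuous f.
Proof.
move=> bf x; have [_ fL] := bf; have C0 := bdlip_by_ge0 bf.
apply/cvgrPdist_lt => e e0; near=> y.
rewrite (le_lt_trans (fL x y))// (@le_lt_trans _ _ ((C + 1) * `|x - y|))//.
  by rewrite ler_wpM2r// lerDl.
rewrite mulrC -ltr_pdivlMr ?ltr_pwDr//; near: y.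
by apply: (@nbhsx_ballx R R^o); rewrite divr_gt0// ltr_pwDr.
Unshelve. all: by end_near. Qed.

Lemma measurable_bdlip C (f : R -> R) X : bdlip_by C f -> measurable_fun setT X ->
  measurable_fun setT (f \o X).
Proof.
move=> bf mX; apply: measurableT_comp => //.
by apply: continuous_measurable_fun; exact: bdlip_continuous bf.
Qed.

Definition law X (f : R -> R) : R := \int[P]_w f (X w).

Lemma integrable_bdlip (f : R -> R) X : bdlip f -> measurable_fun setT X ->
  P.-integrable setT (EFin \o (f \o X)).
Proof.
move=> [C bf] mX; apply: (@bounded_integrable _ C).
  exact: (measurable_bdlip bf mX).
by move=> w; case: bf => fC _; exact: fC.
Qed.

Lemma mean_law X : measurable_fun setT X -> mean (law X).
Proof.
move=> mX; split.
- by move=> a f g bf bg; rewrite /law Rint_lin//; exact: integrable_bdlip.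
- move=> f g bf bg fg; apply: le_Rintegral => //; first exact: integrable_bdlip.
  exact: integrable_bdlip.
- by move=> c; rewrite /law Rint_cst.
Qed.

Definition iid (X : nat -> Omega -> R) :=
  [/\ forall l, measurable_fun setT (X l),
      forall l A, measurable A -> P (X l @^-1` A) = P (X 0%N @^-1` A) &
      mutually_independent P setT X].

Section iid.
Variable X : nat -> Omega -> R.
Hypothesis iidX : iid X.

Let mX l : measurable_fun setT (X l). Proof. by case: iidX. Qed.

Definition cyl i (B : nat -> set R) := \bigcap_(l in [set l | (l < i)%N]) (X l @^-1` B l).

Let measurable_pre l A : measurable A -> measurable (X l @^-1` A).
Proof. by move=> mA; rewrite -[X in measurable X]setTI; exact: mX. Qed.

Let measurable_cyl i B : (forall l, measurable (B l)) -> measurable (cyl i B).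
Proof. by move=> mB; apply: bigcap_measurableType => l _; exact: measurable_pre. Qed.

Let fP A := fine (P (X 0%N @^-1` A)).

Let P_cyl i B : (forall l, measurable (B l)) ->
  fine (P (cyl i B)) = \prod_(l < i) fP (B l).
Proof.
move=> mB; have [_ iX indX] := iidX.
have := indX [fset l | l in iota 0 i]%fset B (fun _ _ => I) mB.
rewrite (_ : \bigcap_(_ in _) _ = cyl i B); last first.
  by apply: eq_bigcapl; split=> l; rewrite /= !inE mem_iota.
move=> ->; rewrite (perm_big (iota 0 i)); last first.
  apply: uniq_perm; [exact: fset_uniq|exact: iota_uniq|].
  by move=> l; rewrite !inE.
have -> : iota 0 i = index_iota 0 i by rewrite /index_iota subn0.
rewrite big_mkord.
rewrite (eq_bigr (fun l : 'I_i => (fP (B l))%:E)); last first.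
  move=> l _; rewrite iX// /fP fineK//.
  by apply: fin_num_measure; exact: measurable_pre.
by rewrite prodEFin.
Qed.

(* Each variable is approximated by simple functions of it, for which independence
   is the product rule on cylinders. *)
Lemma imean_law_cyl N i B C F : (forall l, measurable (B l)) -> blip C F ->
  \int[P]_w (\1_(cyl i B) w * F (sample X i N w)) =
  \prod_(l < i) fP (B l) * imean (law (X 0%N)) N F.
Proof.
have mI := mean_law (mX 0%N); have [_ iX indX] := iidX.
have [rho [rhoF rhoM rhoC]] := @simple_approx R.
(* [i] and [B] are generalised because treating coordinate [i] moves an event on it into the
   cylinder. *)
elim: N i B F => [|N IH] i B F mB bF.
  rewrite -P_cyl//= -[LHS]/(\int[P]_w (\1_(cyl i B) w * F [::])) RintegralZr//; last first.
    apply: (@bounded_integrable _ 1).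
      exact/measurable_indicP/measurable_cyl.
    by move=> w; rewrite indicE; case: (_ \in _); rewrite ?normr1 ?normr0.
  congr (_ * _); rewrite /Rintegral integral_indic ?setIT//; exact: measurable_cyl.
have [FC FL] := bF; have C0 := blip_ge0 bF.
pose JF y := imean (law (X 0%N)) N (fun s => F (y :: s)).
have bJF : bdlip_by C JF by exact: imean_bdlip.
have mF G D i' N' : blip D G -> measurable_fun setT (fun w => G (sample X i' N' w)).
  move=> bG; apply: borel_measurable; apply: borel_sample => //.
  exact: blip_seqcont bG.
have m1 i' B' : (forall l, measurable (B' l)) -> measurable_fun setT (\1_(cyl i' B') : Omega -> R).
  by move=> mB'; exact/measurable_indicP/measurable_cyl.
have b1 (A : set Omega) (x : R) w : `|x| <= C -> `|\1_A w * x| <= C.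
  by move=> xC; rewrite indicE; case: (_ \in _); rewrite ?mul1r// mul0r normr0.
have step k : \int[P]_w (\1_(cyl i B) w * F (rho k (X i w) :: sample X i.+1 N w)) =
    \prod_(l < i) fP (B l) * law (X 0%N) (JF \o rho k).
  have [s [us sP]] := rhoF k.
  (* At coordinate [i] the cylinder receives the event that the discretized variable equals [v];
     summing over its finitely many values restores the integral. *)
  pose B' v l := if l == i then rho k @^-1` [set v] else B l.
  have mB' v l : measurable (B' v l).
    rewrite /B'; case: ifP => // _.
    by rewrite -[X in measurable X]setTI; apply: rhoM.
  have cylE v w : \1_(cyl i.+1 (B' v)) w = \1_(cyl i B) w * (rho k (X i w) == v)%:R :> R.
    rewrite !indicE -natrM mulnb; congr (_%:R); congr nat_of_bool.
    apply/idP/andP.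
      rewrite !inE => h; split.
        move=> l /= li; have := h l (ltnW li).
        by rewrite /B' /= ltn_eqF.
      by have := h i (ltnSn i); rewrite /B'/= eqxx => ->.
    rewrite !inE => -[h /eqP hi] l; rewrite /= ltnS leq_eqVlt /B' => /orP[/eqP ->|li].
      by rewrite eqxx.
    by rewrite ltn_eqF//; exact: h.
  have sel (G : R -> R) y : \sum_(v <- s) (rho k y == v)%:R * G v = G (rho k y).
    rewrite (bigD1_seq (rho k y))//= eqxx mul1r big1 ?addr0// => v.
    by rewrite eq_sym => /negbTE ->; rewrite mul0r.
  transitivity (\int[P]_w (\sum_(v <- s) (\1_(cyl i.+1 (B' v)) w * F (v :: sample X i.+1 N w)))).
    apply: eq_Rintegral => w _.
    under eq_bigr do rewrite cylE -mulrA.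
    by rewrite -mulr_sumr (sel (fun v => F (v :: sample X i.+1 N w))).
  rewrite (@Rint_sum _ _ _ C); last 2 first.
  - move=> v; apply: measurable_funM; first exact: m1.
    exact: (mF (fun t => F (v :: t)) C _ _ (blip_cons v bF)).
  - by move=> v w; exact: b1.
  transitivity (\sum_(v <- s) \prod_(l < i) fP (B l) * (fP (rho k @^-1` [set v]) * JF v)).
    apply: eq_bigr => v _; rewrite (IH _ _ (fun t => F (v :: t)))//; last exact: blip_cons.
    rewrite big_ord_recr/= mulrA /B' eqxx; congr (_ * _ * _).
    by apply: eq_bigr => l _; rewrite ltn_eqF.
  rewrite -mulr_sumr; congr (_ * _).
  transitivity (\int[P]_w (\sum_(v <- s) \1_(X 0%N @^-1` (rho k @^-1` [set v])) w * JF v)).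
    have mpre v : measurable (X 0%N @^-1` (rho k @^-1` [set v])).
      apply: measurable_pre; rewrite -[X in measurable X]setTI; exact: rhoM.
    rewrite (@Rint_sum _ _ _ C); last 2 first.
    - by move=> v; apply: measurable_funM => //; exact/measurable_indicP.
    - by move=> v w; apply: b1; case: bJF.
    apply: eq_bigr => v _; rewrite RintegralZr//; last first.
      apply: (@bounded_integrable _ 1); first exact/measurable_indicP.
      by move=> w; rewrite indicE; case: (_ \in _); rewrite ?normr1 ?normr0.
    congr (_ * _); rewrite /Rintegral integral_indic ?setIT//.
  apply: eq_Rintegral => w _; rewrite /= -[RHS]sel.
  apply: eq_bigr => v _; congr (_ * _); rewrite indicE; congr (_%:R).
  by congr nat_of_bool; apply/idP/idP; [rewrite inE /= => ->|move/eqP => ?; rewrite inE].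
have lim1 : \int[P]_w (\1_(cyl i B) w * F (rho k (X i w) :: sample X i.+1 N w)) @[k --> \oo]
    --> \int[P]_w (\1_(cyl i B) w * F (sample X i N.+1 w)).
  apply: (@Rint_cvg _ _ C).
  - move=> k; apply: measurable_funM; first exact: m1.
    pose Z l w := if l == i then rho k (X i w) else X l w.
    have -> : (fun w => F (rho k (X i w) :: sample X i.+1 N w)) = fun w => F (sample Z i N.+1 w).
      apply/funext => w; rewrite /sample/= /Z eqxx; congr (F (_ :: _)).
      apply/eq_in_map => l; rewrite mem_iota => /andP[il _].
      by rewrite gtn_eqF.
    apply: borel_measurable; apply: borel_sample; last exact: blip_seqcont bF.
    move=> l; rewrite /Z; case: (l == i) => //.
    exact: (measurableT_comp (rhoM k) (mX i)).
  - by apply: measurable_funM; [exact: m1|exact: mF bF].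
  - by move=> k w; exact: b1.
  - move=> w; apply: cvgMr.
    by have := blip_seqcont bF (s := [::]) (t := sample X i.+1 N w) (rhoC (X i w)).
have lim2 : \prod_(l < i) fP (B l) * law (X 0%N) (JF \o rho k) @[k --> \oo]
    --> \prod_(l < i) fP (B l) * law (X 0%N) JF.
  apply: cvgMr; apply: (@Rint_cvg _ _ C).
  - move=> k; apply: (measurable_bdlip (X := fun w => rho k (X 0%N w)) bJF).
    exact: (measurableT_comp (rhoM k) (mX 0%N)).
  - exact: (measurable_bdlip bJF).
  - by move=> k w; have [JC _] := bJF; exact: JC.
  - move=> w; have := bdlip_continuous bJF (x := X 0%N w).
    by apply: cvg_comp; exact: rhoC.
by move: lim1; under eq_cvg do rewrite step; move=> lim1; exact: cvg_unique lim1 lim2.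
Qed.

Lemma imean_law N C F : blip C F ->
  \int[P]_w F (sample X 0 N w) = imean (law (X 0%N)) N F.
Proof.
move=> bF; have := @imean_law_cyl N 0 (fun=> setT) C F (fun=> measurableT) bF.
rewrite big_ord0 mul1r => <-; apply: eq_Rintegral => w _.
by rewrite indicE mem_set ?mul1r// => l.
Qed.

End iid.

End expectation.

(** * Moments *)

Section moments.
Context d (Omega : measurableType d) (R : realType) (P : probability Omega R).
Implicit Types (X Y : Omega -> R) (C : R).

Definition square_integrable X :=
  measurable_fun setT X /\ P.-integrable setT (EFin \o (fun w => X w ^+ 2)).

Lemma dominated_integrable X Y : measurable_fun setT X ->
  P.-integrable setT (EFin \o Y) -> (forall w, `|X w| <= Y w) ->
  P.-integrable setT (EFin \o X).
Proof.
move=> mX iY XY; apply: le_integrable iY => //; first exact/measurable_EFinP.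
by move=> w _; rewrite /= lee_fin (le_trans (XY w))// ler_norm.
Qed.

Lemma Rint_norm_le X Y : measurable_fun setT X ->
  P.-integrable setT (EFin \o Y) -> (forall w, `|X w| <= Y w) ->
  `|\int[P]_w X w| <= \int[P]_w Y w.
Proof.
move=> mX iY XY; have iX := dominated_integrable mX iY XY.
rewrite (le_trans (le_normr_Rintegral _ _))//.
apply: le_Rintegral => //.
by apply: (dominated_integrable _ iY) => [|w]; [exact: measurableT_comp|rewrite normr_id].
Qed.

Lemma integrable_cst (c : R) : P.-integrable setT (EFin \o (fun=> c)).
Proof. exact: finite_measure_integrable_cst. Qed.

Lemma integrable_lin a X Y : P.-integrable setT (EFin \o X) ->
  P.-integrable setT (EFin \o Y) ->
  P.-integrable setT (EFin \o (fun w => a * X w + Y w)).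
Proof.
move=> iX iY; have := integrableD measurableT (integrableZl measurableT a iX) iY.
by apply: eq_integrable => // w _ /=; rewrite EFinD EFinM.
Qed.

Lemma sq_integrable1 X : square_integrable X -> P.-integrable setT (EFin \o X).
Proof.
move=> [mX iX]; have := integrable_lin 1 iX (integrable_cst 1).
move/dominated_integrable; apply => // w.
have := sqr_ge0 (`|X w| - 1); rewrite sqrrB real_normK ?num_real// mulr1 expr1n.
by have := normr_ge0 (X w); lra.
Qed.

Lemma measurable_min23 X : measurable_fun setT X -> measurable_fun setT (fun w => min23 (X w)).
Proof.
move=> mX; apply: measurable_minr; first exact: measurable_funX.
by apply: measurable_funX; exact: measurableT_comp.
Qed.

Lemma integrable_min23 X : square_integrable X ->
  P.-integrable setT (EFin \o (fun w => min23 (X w))).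
Proof.
move=> [mX iX]; apply: dominated_integrable iX _; first exact: measurable_min23.
by move=> w; rewrite ger0_norm ?min23_ge0// min23_le2.
Qed.

(** Pointwise integration of the Taylor estimate; the error term integrates to [K] times the mean of
    [min23]. *)
Lemma moments_law X : square_integrable X ->
  moments (law P X) (\int[P]_w X w) (\int[P]_w X w ^+ 2) (\int[P]_w min23 (X w)).
Proof.
move=> sX K f f1 f2 sf x; have iX := sq_integrable1 sX; have ig := integrable_min23 sX.
have [mX iX2] := sX.
have [C bf] := smooth_bl sf.
have if_ : P.-integrable setT (EFin \o (fun w => f (x + X w))).
  apply: (@integrable_bdlip _ _ _ P (fun y => f (x + y)) X) => //.
  by exists C; exact: bdlip_by_shift.
pose rem w := (- (f2 x / 2)) * X w ^+ 2 + ((- f1 x) * X w + (1 * f (x + X w) + - f x)).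
have -> : law P X (fun y => f (x + y)) - f x - (\int[P]_w X w) * f1 x -
    (\int[P]_w X w ^+ 2) / 2 * f2 x = \int[P]_w rem w.
  have i1 := integrable_lin 1 if_ (integrable_cst (- f x)).
  rewrite /rem Rint_lin//; last exact: integrable_lin.
  rewrite Rint_lin// Rint_lin//; last exact: integrable_cst.
  by rewrite Rint_cst /law; ring.
have irem : P.-integrable setT (EFin \o rem).
  by do 3!(apply: integrable_lin => //); exact: integrable_cst.
rewrite -RintegralZl//.
apply: Rint_norm_le.
- exact/measurable_EFinP/(measurable_int P irem).
- exact: (integrableZl measurableT K ig).
move=> w; apply: le_trans (smooth_taylor sf x (X w)).
rewrite le_eqVlt; apply/orP; left; apply/eqP; congr `|_|.
by rewrite /rem; ring.
Qed.

Lemma square_integrable_affine X a c : square_integrable X ->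
  square_integrable (fun w => a + c * X w).
Proof.
move=> sX; have [mX iX2] := sX; have iX := sq_integrable1 sX.
split; first by apply: measurable_funD => //; exact: measurable_funM.
have := integrable_lin (c ^+ 2) iX2 (integrable_lin (2 * a * c) iX (integrable_cst (a ^+ 2))).
by apply: eq_integrable => // w _ /=; congr (_%:E); ring.
Qed.

Lemma square_integrable_dom X Y : measurable_fun setT X ->
  (forall w, `|X w| <= `|Y w|) -> square_integrable Y -> square_integrable X.
Proof.
move=> mX XY [mY iY]; split=> //; apply: dominated_integrable iY _.
  exact: measurable_funX.
move=> w; rewrite normrX -(real_normK (num_real (Y w))).
by rewrite lerXn2r// nnegrE.
Qed.

End moments.

(** * Truncated third moment and log-return of the portfolio *)

Section min23.
Variable R : realType.

Lemma le_min23_norm (x y : R) : `|x| <= `|y| -> min23 x <= min23 y.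
Proof.
move=> xy; rewrite /min23 -(real_normK (num_real x)) -(real_normK (num_real y)).
by rewrite le_min !ge_min !lerXn2r ?nnegrE//= orbT.
Qed.

(** The sum is at most twice the larger term in absolute value, and doubling multiplies [min23] by
    at most [2 ^ 3]. *)
Lemma min23_add (x y : R) : min23 (x + y) <= 8 * (min23 x + min23 y).
Proof.
have g3D (z : R) : min23 (2 * z) <= 8 * min23 z.
  rewrite /min23 minr_pMr//= le_min !ge_min; apply/andP; split; apply/orP.
    left; rewrite exprMn; move: (sqr_ge0 z); lra.
  by right; rewrite normrM (@ger0_norm _ 2)// exprMn; lra.
have [xy|/ltW xy] := leP `|x| `|y|.
  have : min23 (x + y) <= min23 (2 * y).
    apply: le_min23_norm; rewrite (le_trans (ler_normD _ _))// normrM (@ger0_norm _ 2)//.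
    by move: xy; lra.
  by move/le_trans; apply; move: (g3D y) (min23_ge0 x); lra.
have : min23 (x + y) <= min23 (2 * x).
  apply: le_min23_norm; rewrite (le_trans (ler_normD _ _))// normrM (@ger0_norm _ 2)//.
  by move: xy; lra.
by move/le_trans; apply; move: (g3D x) (min23_ge0 y); lra.
Qed.

(** The cube serves below the level [a], the square above it, which leaves exactly a Lindeberg
    tail. *)
Lemma min23_split (a x : R) : 0 < a -> min23 x <= a * x ^+ 2 + x ^+ 2 * (a < `|x|)%R%:R.
Proof.
move=> a0; case: (ltP a `|x|) => ax /=.
  by rewrite mulr1 (le_trans (min23_le2 x))// lerDr mulr_ge0 ?sqr_ge0// ltW.
rewrite mulr0 addr0 (le_trans (min23_le3 x))// exprS real_normK ?num_real//.
by rewrite ler_wpM2r ?sqr_ge0.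
Qed.

(* If [x] is the log-return of the asset, [psi f x] is that of the portfolio that
   keeps the fraction [f] in it. *)
Definition psi (f x : R) := ln (1 - f + f * expR x).

Lemma psi_arg_gt0 (f x : R) : 0 <= f <= 1 -> 0 < 1 - f + f * expR x.
Proof.
move=> /andP[f0 f1]; have ex := expR_gt0 x.
have : 0 <= f * expR x by rewrite mulr_ge0// ltW.
have [f1'|f1'] := eqVneq f 1; first by rewrite f1' mul1r subrr add0r.
have : f < 1 by rewrite lt_neqAle f1'.
by move=> ? ?; lra.
Qed.

(** The derivative [p] of [psi f] is the fraction of wealth held in the asset after the move,
    between 0 and 1; the second derivative is [p * (1 - p)]. Both are 1-Lipschitz, and at 0 they
    equal [f] and [f * (1 - f)]. *)
Lemma psi_taylor (f x : R) : 0 <= f <= 1 ->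
  [/\ `|psi f x| <= `|x|,
      `|psi f x - (f * x + f * (1 - f) / 2 * x ^+ 2)| <= 2 * min23 x &
      `|psi f x ^+ 2 - f ^+ 2 * x ^+ 2| <= 4 * min23 x].
Proof.
move=> f01; have q0 y := psi_arg_gt0 y f01; have /andP[f0 f1] := f01.
pose q (y : R) := 1 - f + f * expR y.
pose p (y : R) := f * expR y / q y.
have p0 y : 0 <= p y by rewrite divr_ge0 ?(ltW (q0 y))// mulr_ge0// expR_ge0.
have p1 y : p y <= 1 by rewrite ler_pdivrMr ?q0// mul1r /q; lra.
have dpsi (y : R) : is_derive y 1 (psi f) (p y).
  have d : is_derive y 1 q (f * expR y).
    by rewrite /q; apply: is_derive_eq; rewrite /GRing.scale/=; ring.
  have := @is_derive1_comp _ (@ln R) q y _ _ (is_derive1_ln (q0 y)) d.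
  by move/is_derive_eq; apply; rewrite /p; ring.
have dp (y : R) : is_derive y 1 p (p y * (1 - p y)).
  have d : is_derive y 1 q (f * expR y).
    by rewrite /q; apply: is_derive_eq; rewrite /GRing.scale/=; ring.
  have d2 := @is_deriveV _ q y (f * expR y) 1 (lt0r_neq0 (q0 y)) d.
  have d3 : is_derive y 1 (fun y => f * expR y) (f * expR y).
    by apply: is_derive_eq; rewrite /GRing.scale/=; ring.
  rewrite /p; apply: is_derive_eq; rewrite /GRing.scale/= /p.
  have un : q y != 0 := lt0r_neq0 (q0 y).
  by move: (q y) un (f * expR y) => u u0 v; rewrite ?exprVn; field.
have pL x' y : `|p x' - p y| <= 1 * `|x' - y|.
  apply: (derive_bound_lip dp) => z; rewrite ger0_norm.
    by rewrite -[leRHS]mulr1 ler_pM// ?subr_ge0// gerBl.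
  by rewrite mulr_ge0 ?subr_ge0.
have dpL x' y : `|p x' * (1 - p x') - p y * (1 - p y)| <= 1 * `|x' - y|.
  have -> : p x' * (1 - p x') - p y * (1 - p y) = (p x' - p y) * (1 - p x' - p y) by ring.
  rewrite (le_trans _ (pL x' y))// normrM ler_piMr// ler_norml.
  by have := p0 x'; have := p1 x'; have := p0 y; have := p1 y; move=> *; apply/andP; split; lra.
have p00 : p 0 = f by rewrite /p /q expR0 mulr1 subrK divr1.
have psi00 : psi f 0 = 0 by rewrite /psi expR0 mulr1 subrK ln1.
have t1 := taylor_lip 0 x dpsi pL.
have t2 := taylor_lip2 0 x dpsi dp dpL.
rewrite add0r psi00 subr0 p00 mul1r in t1.
rewrite add0r psi00 subr0 p00 mul1r in t2.
have n1 : `|psi f x| <= `|x|.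
  have := @mvt_le _ _ _ 0 x 1 dpsi; rewrite psi00 !subr0 mul1r; apply => z _.
  by rewrite ger0_norm.
have f2 : 0 <= f * (1 - f) <= 1.
  by rewrite mulr_ge0 ?subr_ge0//= -[leRHS]mulr1 ler_pM ?subr_ge0// gerBl.
split=> //.
  have -> : f * x + f * (1 - f) / 2 * x ^+ 2 = x * f + x ^+ 2 / 2 * (f * (1 - f)) by ring.
  rewrite opprD addrA; apply: le_min23.
    rewrite (le_trans (ler_normB _ _))// mulrDl mul1r lerD//.
    rewrite normrM (@ger0_norm _ (f * _)); last by case/andP: f2.
    rewrite -[leRHS]mulr1 ler_pM//; [by case/andP: f2| |by case/andP: f2].
    by rewrite ger0_norm ?divr_ge0 ?sqr_ge0//; have := sqr_ge0 x; lra.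
  by rewrite (le_trans t2)// ler_peMl ?exprn_ge0// ler1n.
have -> : psi f x ^+ 2 - f ^+ 2 * x ^+ 2 = (psi f x - x * f) * (psi f x + x * f) by ring.
have fx : `|x * f| <= `|x| by rewrite normrM ler_piMr// ger0_norm.
have sum : `|psi f x + x * f| <= 2 * `|x|.
  by rewrite (le_trans (ler_normD _ _))//; lra.
have dif : `|psi f x - x * f| <= 2 * `|x|.
  by rewrite (le_trans (ler_normB _ _))//; lra.
rewrite normrM; apply: le_min23.
  rewrite -(real_normK (num_real x)).
  rewrite (_ : 4 * `|x| ^+ 2 = (2 * `|x|) * (2 * `|x|)); last by ring.
  exact: ler_pM.
rewrite (@le_trans _ _ (x ^+ 2 * (2 * `|x|)))//; first exact: ler_pM.
rewrite -(real_normK (num_real x)) mulrCA -exprSr.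
by rewrite ler_wpM2r ?exprn_ge0// ler_nat.
Qed.

End min23.

Section array_moments.
Variable R : realType.

Section row.
Context d (Omega : measurableType d) (P : probability Omega R).
Variables (n : nat) (b sigma : R) (xi : Omega -> R).
Hypotheses (n0 : (0 < n)%N) (sxi : square_integrable P xi).
Hypotheses (xi1 : \int[P]_w xi w = 0) (xi2 : \int[P]_w xi w ^+ 2 = 1).

Definition incr w := b / n%:R + sigma / Num.sqrt n%:R * xi w.

Let nR : 0 < n%:R :> R. Proof. by rewrite ltr0n. Qed.

Let sqr_sqrtn : (sigma / Num.sqrt n%:R) ^+ 2 = sigma ^+ 2 / n%:R.
Proof. by rewrite expr_div_n sqr_sqrtr// ltW. Qed.

Lemma sq_incr : square_integrable P incr.
Proof. exact: square_integrable_affine. Qed.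

Lemma incr_mean : \int[P]_w incr w = b / n%:R.
Proof.
have [mxi _] := sxi; have ixi := sq_integrable1 sxi.
under eq_Rintegral do rewrite /incr addrC.
by rewrite Rint_lin//; [rewrite xi1 mulr0 add0r Rint_cst|exact: integrable_cst].
Qed.

Lemma incr_sq : \int[P]_w incr w ^+ 2 = (b / n%:R) ^+ 2 + sigma ^+ 2 / n%:R.
Proof.
have [mxi ixi2] := sxi; have ixi := sq_integrable1 sxi.
have -> : \int[P]_w incr w ^+ 2 = \int[P]_w (sigma ^+ 2 / n%:R * xi w ^+ 2 +
   (2 * (b / n%:R) * (sigma / Num.sqrt n%:R) * xi w + (b / n%:R) ^+ 2)).
  by apply: eq_Rintegral => w _; rewrite /incr -sqr_sqrtn; ring.
have ic := integrable_cst P ((b / n%:R) ^+ 2).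
rewrite Rint_lin//; last exact: integrable_lin.
by rewrite Rint_lin// xi1 xi2 Rint_cst; ring.
Qed.

Definition tail2 (a : R) :=
  \int[P]_w (xi w ^+ 2 * (a * Num.sqrt n%:R < `|xi w|)%R%:R).

Lemma measurable_tail (a c : R) (X : Omega -> R) : measurable_fun setT X ->
  measurable_fun setT (fun w => X w ^+ 2 * (a < `|c * X w|)%R%:R).
Proof.
move=> mX; apply: measurable_funM; first exact: measurable_funX.
have mb : measurable_fun setT (fun w => a < `|c * X w|).
  apply: measurable_fun_ltr => //; apply: measurableT_comp => //.
  exact: measurable_funM.
have := measurable_fun_ifT mb (measurable_cst (1 : R)) (measurable_cst (0 : R)).
by apply: eq_measurable_fun => w _; case: ifP.
Qed.

Lemma integrable_tail (a c : R) :
  P.-integrable setT (EFin \o (fun w => xi w ^+ 2 * (a < `|c * xi w|)%R%:R)).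
Proof.
have [mxi ixi2] := sxi; apply: dominated_integrable ixi2 _.
  exact: measurable_tail.
move=> w; rewrite normrM (@ger0_norm _ (_ ^+ 2)) ?sqr_ge0// normr_nat.
by rewrite ler_piMr ?sqr_ge0// lern1 leq_b1.
Qed.

(** [min23_add] separates drift from noise, whence the 8; the drift pays its cube and the noise is
    split at level [a]. The tail level is divided by [|sigma| + 1] because the coefficient may be 0,
    as for the Brownian row when [f = 0]. *)
Lemma incr_min23 (a : R) : 0 < a -> n%:R * \int[P]_w min23 (incr w) <=
  8 * (`|b| ^+ 3 / n%:R ^+ 2 + a * sigma ^+ 2 + sigma ^+ 2 * tail2 (a / (`|sigma| + 1))).
Proof.
move=> a0; have [mxi ixi2] := sxi.
have s1 : 0 < `|sigma| + 1 by rewrite ltr_pwDr.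
have sq0 : 0 < Num.sqrt n%:R :> R by rewrite sqrtr_gt0.
have it := integrable_tail (a / (`|sigma| + 1) * Num.sqrt n%:R) 1.
have it' : P.-integrable setT (EFin \o
    (fun w => xi w ^+ 2 * (a / (`|sigma| + 1) * Num.sqrt n%:R < `|xi w|)%R%:R)).
  by move: it; under eq_fun do rewrite mul1r.
pose Y w := 8 * (sigma ^+ 2 / n%:R) *
    (xi w ^+ 2 * (a / (`|sigma| + 1) * Num.sqrt n%:R < `|xi w|)%R%:R) +
   (8 * (a * (sigma ^+ 2 / n%:R)) * xi w ^+ 2 + 8 * (`|b / n%:R| ^+ 3)).
have ic := integrable_cst P (8 * (`|b / n%:R| ^+ 3)).
have iY : P.-integrable setT (EFin \o Y).
  by apply: integrable_lin => //; exact: integrable_lin.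
have le : \int[P]_w min23 (incr w) <= \int[P]_w Y w.
  apply: le_Rintegral => //; first exact: (integrable_min23 sq_incr).
  move=> w _; rewrite (le_trans (min23_add _ _))// /Y.
  have eS : (sigma / Num.sqrt n%:R * xi w) ^+ 2 = sigma ^+ 2 / n%:R * xi w ^+ 2.
    by rewrite exprMn sqr_sqrtn.
  have ind : (a < `|sigma / Num.sqrt n%:R * xi w|)%R%:R <=
      (a / (`|sigma| + 1) * Num.sqrt n%:R < `|xi w|)%R%:R :> R.
    rewrite ler_nat; case: (ltP a `|_|) => // h.
    rewrite (_ : _ < _ = true)//; apply/idP.
    rewrite -(@ltr_pM2r _ ((`|sigma| + 1) / Num.sqrt n%:R)) ?divr_gt0//.
    have -> : a / (`|sigma| + 1) * Num.sqrt n%:R * ((`|sigma| + 1) / Num.sqrt n%:R) = a.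
      by field; rewrite !gt_eqF.
    rewrite (lt_le_trans h)// !normrM (@ger0_norm _ (_^-1)) ?invr_ge0 ?(ltW sq0)//.
    rewrite mulrC ler_wpM2l// ler_wpM2r ?invr_ge0 ?(ltW sq0)//.
    by rewrite lerDl.
  have S0 : 0 <= sigma ^+ 2 / n%:R * xi w ^+ 2.
    by rewrite mulr_ge0 ?sqr_ge0// divr_ge0 ?sqr_ge0// ltW.
  have := min23_split (sigma / Num.sqrt n%:R * xi w) a0.
  have := min23_le3 (b / n%:R); have := ler_wpM2l S0 ind; rewrite eS.
  by lra.
rewrite (le_trans (ler_wpM2l (ltW nR) le))// /Y.
rewrite Rint_lin//; last exact: integrable_lin.
rewrite Rint_lin// xi2 Rint_cst mulr1 -/(tail2 _).
have -> : `|b / n%:R| = `|b| / n%:R by rewrite normrM normfV normr_nat.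
rewrite le_eqVlt; apply/orP; left; apply/eqP; field.
by rewrite gt_eqF.
Qed.

End row.
End array_moments.

(** * Moments of the centred normal law *)

Section gaussian.
Variables (R : realType) (s : R).
Hypothesis s0 : 0 < s.
Local Notation mu := (@lebesgue_measure R).
Local Notation pdf := (normal_pdf 0 s).
Local Notation peak := (normal_peak s).

Let k0 : 0 < peak. Proof. by rewrite normal_peak_gt0// gt_eqF. Qed.

Let pE (x : R) : pdf x = peak * expR (- (x ^+ 2 / (2 * s ^+ 2))).
Proof. by rewrite normal_pdfE ?gt_eqF// /normal_fun subr0 mulNr mulr_natl. Qed.

Let p_ge0 (x : R) : 0 <= pdf x. Proof. exact: normal_pdf_ge0. Qed.

Let cp : continuous pdf. Proof. by apply: continuous_normal_pdf; rewrite gt_eqF. Qed.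

Let dp (x : R) : is_derive x 1 pdf (- (x / s ^+ 2) * pdf x).
Proof.
rewrite (_ : pdf = fun x => peak * expR (- (x ^+ 2 / (2 * s ^+ 2)))); last first.
  by apply/funext => y; rewrite pE.
have d : is_derive x 1 (fun x : R => - (x ^+ 2 / (2 * s ^+ 2))) (- (x / s ^+ 2)).
  by apply: is_derive_eq; rewrite /GRing.scale/=; field; rewrite gt_eqF.
have d2 := @is_derive1_comp _ (@expR R) _ x _ _ (is_derive_expR _) d.
have := @is_deriveZ _ _ _ _ peak x 1 _ d2.
by move/is_derive_eq; apply; rewrite /GRing.scale/=; ring.
Qed.

(** The crude bound [y ^+ 2 / 4 <= expR y] makes [pdf x] of order [x ^ -4], which leaves room for
    the factor [x ^ 2]. *)
Let decay (F : R -> R) (A : R) : (forall x, 1 <= x -> `|F x| <= A * (x ^+ 2 * pdf x)) ->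
  F x @[x --> +oo] --> (0 : R).
Proof.
move=> FA; have A0 : 0 <= A.
  have : 0 < 1 ^+ 2 * pdf 1 by rewrite expr1n mul1r pE mulr_gt0// expR_gt0.
  move=> h; rewrite -(@pmulr_lge0 _ (1 ^+ 2 * pdf 1))//.
  exact: le_trans (normr_ge0 _) (FA 1 (lexx _)).
pose C := A * (16 * peak * s ^+ 4) + 1.
have C0 : 0 < C.
  by rewrite ltr_pwDr// mulr_ge0// mulr_ge0 ?exprn_ge0 ?(ltW s0)// mulr_ge0// ltW.
apply/cvgrPdist_lt => e e0; near=> x.
have x1 : 1 <= x by near: x; exact: nbhs_pinfty_ge.
have xC : C / e < x by near: x; apply: nbhs_pinfty_gt; exact: num_real.
have x0 : 0 < x by apply: lt_le_trans x1.
rewrite sub0r normrN (le_lt_trans (FA x x1))//.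
set y := x ^+ 2 / (2 * s ^+ 2).
have y0 : 0 < y by rewrite divr_gt0 ?exprn_gt0// mulr_gt0// exprn_gt0.
have ey : y ^+ 2 / 4 <= expR y.
  have -> : expR y = expR (y / 2) ^+ 2 by rewrite -expRM_natl; congr expR; field.
  have h : y / 2 <= expR (y / 2).
    by rewrite (le_trans _ (expR_ge1Dx _))// lerDr.
  rewrite (_ : y ^+ 2 / 4 = (y / 2) ^+ 2); last by field.
  by rewrite lerXn2r// nnegrE ?expR_ge0// divr_ge0// ltW.
have py : pdf x <= peak * (4 / y ^+ 2).
  rewrite pE -/y ler_pM2l// expRN -[leRHS]invrK lef_pV2 ?posrE ?expR_gt0 ?invr_gt0 ?divr_gt0 ?exprn_gt0//.
  by rewrite invf_div.
have : x ^+ 2 * pdf x <= 16 * peak * s ^+ 4 / x.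
  rewrite (@le_trans _ _ (x ^+ 2 * (peak * (4 / y ^+ 2))))//.
    by rewrite ler_wpM2l ?sqr_ge0.
  have -> : x ^+ 2 * (peak * (4 / y ^+ 2)) = 16 * peak * s ^+ 4 / x ^+ 2.
    by rewrite /y; field; rewrite !gt_eqF.
  rewrite ler_pM2l; last by rewrite !mulr_gt0// exprn_gt0.
  by rewrite lef_pV2 ?posrE ?exprn_gt0// expr2 ler_peMl// ltW.
move/(ler_wpM2l A0)/le_lt_trans; apply.
rewrite mulrA ltr_pdivrMr//; rewrite ltr_pdivrMr// mulrC in xC.
by rewrite (lt_trans _ xC)// /C ltrDl.
Unshelve. all: by end_near. Qed.

Let is_deriveE (F : R -> R) (x df : R) :
  is_derive x 1 F df -> derivable F x 1 /\ 'D_1 F x = df.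
Proof. by case. Qed.

Let FTCy (f F : R -> R) a l : (forall x, a <= x -> 0 <= f x) -> continuous f ->
  (forall x : R, derivable F x 1 /\ 'D_1 F x = f x) -> F x @[x --> +oo] --> l ->
  (\int[mu]_(x in `[a, +oo[) (f x)%:E = (l - F a)%:E)%E.
Proof.
move=> f0 cf dF Fl; rewrite (@ge0_continuous_FTC2y _ f F a l)//.
- exact: continuous_subspaceT.
- by move=> x _; have [] := dF x.
- apply: cvg_at_right_filter; apply: (@differentiable_continuous _ R^o R^o).
  by apply/derivable1_diffP; have [] := dF a.
- by move=> x _; rewrite derive1E; have [] := dF x.
Qed.

Let i0 : (\int[mu]_(x in `[0%R, +oo[) (pdf x)%:E = (2^-1)%:E)%E.
Proof.
have h : (1%:E = 2%:E * \int[mu]_(x in `[0%R, +oo[) (pdf x)%:E :> \bar R)%E.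
  rewrite -(integral_normal_pdf 0 s) ge0_symfun_integralT//.
    by rewrite set_itvcy.
  by move=> x /=; rewrite !pE sqrrN.
have : (2^-1%:E * 1%:E = 2^-1%:E * (2%:E * \int[mu]_(x in `[0%R, +oo[) (pdf x)%:E) :> \bar R)%E.
  by rewrite -h.
by rewrite muleA -!EFinM mulVf// mul1e mulr1.
Qed.

Let i1 : (\int[mu]_(x in `[0%R, +oo[) (x * pdf x)%:E = (s ^+ 2 * peak)%:E)%E.
Proof.
rewrite (@FTCy _ (fun x => - s ^+ 2 * pdf x) _ 0).
- by rewrite pE expr0n mul0r oppr0 expR0 mulr1 sub0r mulNr opprK.
- by move=> x x0; rewrite mulr_ge0.
- by move=> x; apply: cvgM; [exact: cvg_id|exact: cp].
- move=> x; have d := dp x; apply: is_deriveE; apply: is_derive_eq.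
  by rewrite /GRing.scale/=; field; rewrite gt_eqF.
- apply: (@decay _ (s ^+ 2)) => x x1.
  rewrite normrM normrN !ger0_norm ?sqr_ge0// ler_wpM2l ?sqr_ge0//.
  by rewrite ler_peMl// expr_ge1// (le_trans ler01).
Qed.

Let i3 : (\int[mu]_(x in `[0%R, +oo[) (x ^+ 3 * pdf x)%:E = (2 * s ^+ 4 * peak)%:E)%E.
Proof.
rewrite (@FTCy _ (fun x => - s ^+ 2 * ((x ^+ 2 + 2 * s ^+ 2) * pdf x)) _ 0).
- by rewrite pE expr0n/= mul0r oppr0 expR0; congr (_%:E); ring.
- by move=> x x0; rewrite mulr_ge0// exprn_ge0.
- by move=> x; apply: cvgM; [exact: exprn_continuous|exact: cp].
- move=> x; have d := dp x; apply: is_deriveE; apply: is_derive_eq.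
  by rewrite /GRing.scale/=; field; rewrite gt_eqF.
- apply: (@decay _ (s ^+ 2 * (1 + 2 * s ^+ 2))) => x x1.
  have s2 := sqr_ge0 s; have x2 : 1 <= x ^+ 2 by rewrite expr_ge1// (le_trans ler01).
  rewrite normrM normrN !ger0_norm ?sqr_ge0 ?mulr_ge0 ?addr_ge0 ?sqr_ge0//; last by rewrite mulr_ge0.
  rewrite -(mulrA (s ^+ 2)); apply: ler_wpM2l => //.
  have -> : (1 + 2 * s ^+ 2) * (x ^+ 2 * pdf x) =
      (x ^+ 2 + 2 * s ^+ 2 * x ^+ 2) * pdf x by ring.
  by apply: ler_wpM2r => //; rewrite lerD2l ler_peMr// mulr_ge0.
Qed.

Let mpdf (n : nat) (D : set R) : measurable_fun D (fun x => (x ^+ n * pdf x)%:E).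
Proof.
apply: measurable_funTS; apply/measurable_EFinP; apply: continuous_measurable_fun => x.
by apply: cvgM; [exact: exprn_continuous|exact: cp].
Qed.

Let mpdf0 (D : set R) : measurable_fun D (fun x => (pdf x)%:E).
Proof. by apply: measurable_funTS; apply/measurable_EFinP; exact: continuous_measurable_fun. Qed.

(* The fundamental theorem of calculus on a half-line is available for nonnegative
   integrands only, and the derivative of [- s ^+ 2 * x * pdf x] changes sign at
   [s]. *)
Let i2 : (\int[mu]_(x in `[0%R, +oo[) (x ^+ 2 * pdf x)%:E = (s ^+ 2 / 2)%:E)%E.
Proof.
have s2 := sqr_ge0 s.
pose F (x : R) : R := - s ^+ 2 * (x * pdf x).
have dF (x : R) : is_derive x 1 F ((x ^+ 2 - s ^+ 2) * pdf x).
  have d := dp x; rewrite /F; apply: is_derive_eq; rewrite /GRing.scale/=.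
  by field; rewrite gt_eqF.
have cF (c : R) : continuous (fun x : R => (x ^+ 2 - c) * pdf x).
  move=> x; apply: cvgM; last exact: cp.
  by apply: cvgB; [exact: exprn_continuous|exact: cvg_cst].
have scal D : measurable_fun D (fun x : R => (s ^+ 2)%:E * (pdf x)%:E)%E.
  by apply: measurable_funeM; exact: mpdf0.
have up : (\int[mu]_(x in `[s, +oo[) (x ^+ 2 * pdf x)%:E =
    (s ^+ 3 * pdf s)%:E + (s ^+ 2)%:E * \int[mu]_(x in `[s, +oo[) (pdf x)%:E)%E.
  have <- : (\int[mu]_(x in `[s, +oo[) ((x ^+ 2 - s ^+ 2) * pdf x)%:E = (s ^+ 3 * pdf s)%:E)%E.
    rewrite (@FTCy _ F _ 0)//.
    - by congr (_%:E); rewrite /F; ring.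
    - by move=> x sx; rewrite mulr_ge0// subr_ge0 lerXn2r// ?nnegrE (le_trans (ltW s0)).
    - by move=> x; apply: is_deriveE.
    - apply: (@decay _ (s ^+ 2)) => x x1.
      rewrite /F normrM normrN !ger0_norm ?sqr_ge0 ?mulr_ge0 ?(le_trans ler01 x1)//.
      by rewrite ler_wpM2l// ler_wpM2r// expr2 ler_peMl// (le_trans ler01).
  rewrite -ge0_integralZl//.
  rewrite -ge0_integralD//.
  - apply: eq_integral => x _; rewrite -EFinM -EFinD; congr (_%:E); ring.
  - move=> x; rewrite /= in_itv/= andbT => sx.
    by rewrite lee_fin mulr_ge0// subr_ge0 lerXn2r// ?nnegrE (le_trans (ltW s0)).
  - by apply: measurable_funTS; apply/measurable_EFinP; apply: continuous_measurable_fun; exact: cF.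
  - by move=> x _; rewrite mule_ge0// lee_fin.
  - exact: scal.
  - exact: mpdf0.
  - by move=> x _; rewrite lee_fin.
have lo : ((s ^+ 2)%:E * \int[mu]_(x in `[0%R, s]) (pdf x)%:E =
    (s ^+ 3 * pdf s)%:E + \int[mu]_(x in `[0%R, s]) (x ^+ 2 * pdf x)%:E)%E.
  have <- : (\int[mu]_(x in `[0%R, s]) ((s ^+ 2 - x ^+ 2) * pdf x)%:E = (s ^+ 3 * pdf s)%:E)%E.
    rewrite (@continuous_FTC2 _ (fun x => (s ^+ 2 - x ^+ 2) * pdf x) (fun x => - F x))//.
    - by rewrite -EFinB; congr (_%:E); rewrite /F; ring.
    - apply: continuous_subspaceT => x; apply: cvgM; last exact: cp.
      by apply: cvgB; [exact: cvg_cst|exact: exprn_continuous].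
    - have cF' : continuous (fun x : R => - F x).
        move=> x; apply: (@differentiable_continuous _ R^o R^o).
        by apply/derivable1_diffP; have [] := is_deriveN (dF x).
      split => [x _||].
      + by have [] := is_deriveN (dF x).
      + by apply: cvg_at_right_filter; exact: cF'.
      + by apply: cvg_at_left_filter; exact: cF'.
    - move=> x _; rewrite derive1E; have d := is_deriveN (dF x).
      by rewrite (@derive_val _ _ _ _ _ _ _ d) -mulNr opprB.
  rewrite -ge0_integralZl//.
  rewrite -ge0_integralD//.
  - apply: eq_integral => x _; rewrite -EFinM -EFinD; congr (_%:E); ring.
  - move=> x; rewrite /= in_itv/= => /andP[x0 xs].
    by rewrite lee_fin mulr_ge0// subr_ge0 lerXn2r// ?nnegrE// ltW.
  - apply: measurable_funTS; apply/measurable_EFinP; apply: continuous_measurable_fun => x.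
    apply: cvgM; last exact: cp.
    by apply: cvgB; [exact: cvg_cst|exact: exprn_continuous].
  - by move=> x _; rewrite lee_fin mulr_ge0// sqr_ge0.
  - exact: mpdf.
  - exact: mpdf0.
  - by move=> x _; rewrite lee_fin.
have split (f : R -> R) : (forall x, 0 <= f x) -> measurable_fun setT f ->
   (\int[mu]_(x in `[0%R, +oo[) (f x)%:E =
    \int[mu]_(x in `[0%R, s]) (f x)%:E + \int[mu]_(x in `[s, +oo[) (f x)%:E)%E.
  move=> f0 mf; have mf' D : measurable_fun D (EFin \o f).
    by apply: measurable_funTS; exact/measurable_EFinP.
  rewrite -[in RHS]integral_itv_obnd_cbnd//.
  rewrite (@itv_bndbnd_setU _ _ _ (BRight s)) ?bnd_simp//; last exact: ltW.
  rewrite ge0_integral_setU//=.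
  - exact: mf'.
  - by move=> x _; rewrite lee_fin.
  - rewrite disj_set2E; apply/eqP; apply/seteqP; split => // x [/=].
    by rewrite !in_itv/= andbT => /andP[_ xs] /(le_lt_trans xs); rewrite ltxx.
rewrite split//; last 2 first.
- by move=> x; rewrite mulr_ge0// sqr_ge0.
- apply: continuous_measurable_fun => x.
  by apply: cvgM; [exact: exprn_continuous|exact: cp].
(* The boundary term of [up] completes the integral over [[0, s]] to the right side of [lo]. Both
   identities are written with sums, which avoids subtraction of extended reals. *)
rewrite up addeA [X in (X + _)%E]addeC -lo -muleDr//; last first.
  by rewrite ge0_adde_def// inE integral_ge0// => x _; rewrite lee_fin.
by rewrite -split ?i0//; exact: continuous_measurable_fun.
Qed.

(** The Radon-Nikodym derivative of the normal law agrees almost everywhere with [pdf], as both have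
    the same integral over every measurable set. *)
Lemma ge0_integral_normal (f : R -> R) : (forall x, 0 <= f x) ->
  measurable_fun setT f ->
  (\int[normal_prob 0 s]_x (f x)%:E = \int[mu]_x (f x * pdf x)%:E)%E.
Proof.
move=> f0 mf; have dom := normal_prob_dominates 0 s.
have mfE : measurable_fun setT (EFin \o f) by exact/measurable_EFinP.
rewrite -(Radon_Nikodym_SigmaFinite.change_of_variables dom _ measurableT mfE)//.
apply: ge0_ae_eq_integral => //.
- apply: emeasurable_funM => //.
  exact: (measurable_int mu (Radon_Nikodym_SigmaFinite.f_integrable dom)).
- by apply/measurable_EFinP; apply: measurable_funM => //; exact: measurable_normal_pdf.
- by move=> x _; rewrite mule_ge0// ?lee_fin//; exact: Radon_Nikodym_SigmaFinite.f_ge0.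
- by move=> x _; rewrite lee_fin mulr_ge0.
have : ae_eq mu setT (Radon_Nikodym_SigmaFinite.f (normal_prob 0 s) mu) (EFin \o pdf).
  apply: integral_ae_eq => //.
  - exact: Radon_Nikodym_SigmaFinite.f_integrable.
  - by apply/measurable_EFinP; exact: measurable_normal_pdf.
  - by move=> A _ mA; rewrite -Radon_Nikodym_SigmaFinite.f_integral.
by apply: filterS => x /= /(_ I) -> _; rewrite EFinM.
Qed.

Let even_integral (f : R -> R) : (forall x, 0 <= f x) -> continuous f ->
  f =1 f \o -%R ->
  (\int[mu]_x (f x * pdf x)%:E = 2%:E * \int[mu]_(x in `[0%R, +oo[) (f x * pdf x)%:E)%E.
Proof.
move=> f0 cf fe; rewrite ge0_symfun_integralT//.
- by rewrite set_itvcy.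
- by move=> x; rewrite mulr_ge0.
- by move=> x; apply: cvgM; [exact: cf|exact: cp].
- by move=> x /=; rewrite {1}fe/= !pE sqrrN.
Qed.

Section normal_rv.
Context d (Omega : measurableType d) (P : probability Omega R) (N : {RV P >-> R}).
Hypothesis lawN : forall A, measurable A -> P (N @^-1` A) = normal_prob 0 s A.

Let intN (f : R -> R) : (forall x, 0 <= f x) -> measurable_fun setT f ->
  (\int[P]_w (f (N w))%:E = \int[mu]_x (f x * pdf x)%:E)%E.
Proof.
move=> f0 mf; have mfE : measurable_fun setT (EFin \o f) by exact/measurable_EFinP.
rewrite -ge0_integral_normal//.
have mN : measurable_fun setT (N : Omega -> measurableTypeR R) by exact: (@measurable_funPT _ _ _ _ N).
pose N' : {mfun Omega >-> measurableTypeR R} :=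
  HB.pack (N : Omega -> measurableTypeR R) (isMeasurableFun.Build _ _ _ _ _ mN).
transitivity (\int[distribution P N']_x (f x)%:E)%E.
  by rewrite ge0_integral_distribution// => x; rewrite lee_fin.
by apply: eq_measure_integral => A mA _; exact: (lawN mA).
Qed.

Let mN : measurable_fun setT N. Proof. exact: measurable_funPT. Qed.

Let mX n : measurable_fun setT (fun x : R => x ^+ n).
Proof. exact: exprn_measurable. Qed.

Let N2 : (\int[P]_w (N w ^+ 2)%:E = (s ^+ 2)%:E)%E.
Proof.
rewrite (intN (f := fun x => x ^+ 2))//; last by move=> x; exact: sqr_ge0.
rewrite even_integral//; last 3 first.
- by move=> x; exact: sqr_ge0.
- exact: exprn_continuous.
- by move=> x /=; rewrite sqrrN.
by rewrite i2 -EFinM; congr (_%:E); field.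
Qed.

Let N1 : (\int[P]_w (`|N w|)%:E = (2 * (s ^+ 2 * peak))%:E)%E.
Proof.
rewrite (intN (f := fun x => `|x|))//.
rewrite even_integral//; last 2 first.
- exact: norm_continuous.
- by move=> x /=; rewrite normrN.
rewrite EFinM -i1; congr (_ * _)%E; apply: eq_integral => x.
by rewrite inE/= in_itv/= andbT => x0; rewrite ger0_norm.
Qed.

Let Np : (\int[P]_w (Num.max 0 (N w))%:E = (s ^+ 2 * peak)%:E)%E.
Proof.
have mm : measurable_fun setT (fun x : R => Num.max 0 x).
  by apply: measurable_maxr.
rewrite (intN (f := fun x => Num.max 0 x))//; last by move=> x; rewrite le_max lexx.
rewrite -i1 [RHS]integral_mkcond; apply: eq_integral => x _.
rewrite patchE; case: ifPn => [|]; rewrite ?inE/= ?notin_setE/= in_itv/= andbT.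
  by move=> x0; rewrite (max_idPr x0).
by move/negP; rewrite -ltNge => /ltW x0; rewrite (max_idPl x0) mul0r.
Qed.

Let N3 : (\int[P]_w (`|N w| ^+ 3)%:E = (4 * s ^+ 4 * peak)%:E)%E.
Proof.
have mm : measurable_fun setT (fun x : R => `|x| ^+ 3).
  exact: measurable_funX.
have n3 (x : R) : 0 <= `|x| ^+ 3 by exact: exprn_ge0.
rewrite (intN n3 mm) (even_integral n3); last 2 first.
- move=> x; apply: (@continuous_comp _ _ _ (fun x : R => `|x|) (fun x => x ^+ 3)).
    exact: norm_continuous.
  exact: exprn_continuous.
- by move=> x /=; rewrite normrN.
rewrite (_ : 4 * s ^+ 4 * peak = 2 * (2 * s ^+ 4 * peak)); last by ring.
rewrite EFinM -i3; congr (_ * _)%E; apply: eq_integral => x.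
by rewrite inE/= in_itv/= andbT => x0; rewrite ger0_norm.
Qed.

Let intg (X : Omega -> R) (c : R) : measurable_fun setT X -> (forall w, 0 <= X w) ->
  (\int[P]_w (X w)%:E = c%:E)%E ->
  P.-integrable setT (EFin \o X) /\ \int[P]_w X w = c.
Proof.
move=> mX' X0 Xc; split; last by rewrite /Rintegral Xc.
apply/integrableP; split; first exact/measurable_EFinP.
under eq_integral do rewrite /= ger0_norm//.
by rewrite Xc ltry.
Qed.

Lemma normal_rv_sq : square_integrable P N.
Proof.
have m2 : measurable_fun setT (fun w => N w ^+ 2) by exact: measurable_funX.
by have [] := intg m2 (fun w => sqr_ge0 _) N2.
Qed.

Lemma normal_rv_var : \int[P]_w N w ^+ 2 = s ^+ 2.
Proof.
have m2 : measurable_fun setT (fun w => N w ^+ 2) by exact: measurable_funX.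
by have [] := intg m2 (fun w => sqr_ge0 _) N2.
Qed.

Lemma normal_rv_mean : \int[P]_w N w = 0.
Proof.
have mn : measurable_fun setT (fun w => `|N w|) by exact: measurableT_comp.
have mp : measurable_fun setT (fun w => Num.max 0 (N w)).
  by apply: measurable_maxr.
have [ia ea] := intg mn (fun w => normr_ge0 _) N1.
have p0 w : 0 <= Num.max 0 (N w) by rewrite le_max lexx.
have [ip ep] := intg mp p0 Np.
(* [N] is twice its positive part minus its absolute value, so its mean follows from two integrals
   of nonnegative functions. *)
transitivity (\int[P]_w (2 * Num.max 0 (N w) + (-1 * `|N w| + 0))).
  apply: eq_Rintegral => w _; have [Nw|/ltW Nw] := leP 0 (N w).
    by rewrite ger0_norm//; ring.
  by rewrite ler0_norm//; ring.
have ic := integrable_cst P (0 : R).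
rewrite Rint_lin//; last exact: integrable_lin.
by rewrite Rint_lin// ea ep Rint_cst; ring.
Qed.

Lemma normal_rv_abs3 : P.-integrable setT (EFin \o (fun w => `|N w| ^+ 3)) /\
  \int[P]_w `|N w| ^+ 3 <= 4 * s ^+ 3.
Proof.
have m3 : measurable_fun setT (fun w => `|N w| ^+ 3).
  by apply: measurable_funX; exact: measurableT_comp.
have [i e] := intg m3 (fun w => exprn_ge0 _ (normr_ge0 _)) N3.
split=> //; rewrite e.
have sp : s <= Num.sqrt (s ^+ 2 * pi *+ 2).
  rewrite -[leLHS](ger0_norm (ltW s0)) -sqrtr_sqr ler_wsqrtr//.
  rewrite mulr2n -mulrDr ler_peMr ?sqr_ge0//.
  by have := pi_ge2 R; lra.
have ps : s * peak <= 1.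
  by rewrite /normal_peak ler_pdivrMr ?mul1r//; exact: lt_le_trans s0 sp.
rewrite (_ : 4 * s ^+ 4 * peak = 4 * s ^+ 3 * (s * peak)); last by ring.
by rewrite ler_piMr// mulr_ge0// exprn_ge0// ltW.
Qed.

End normal_rv.

End gaussian.

(** * Limits of moments along triangular arrays *)

Section arrays.
Variable R : realType.

(** [a] and [v] are the drift and variance of the limit per unit time; the last clause is the
    Lindeberg condition in the form that the exchange of increments uses. *)
Definition array_limits (d : nat -> measure_display)
    (Omega : forall n, measurableType (d n)) (P : forall n, probability (Omega n) R)
    (X : forall n, Omega n -> R) (a v : R) :=
  [/\ forall n, (0 < n)%N -> square_integrable (P n) (X n),
      n%:R * \int[P n]_w X n w @[n --> \oo] --> a,
      n%:R * \int[P n]_w X n w ^+ 2 @[n --> \oo] --> v &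
      n%:R * \int[P n]_w min23 (X n w) @[n --> \oo] --> (0 : R)].

Lemma cvg_invn : (n%:R^-1 : R) @[n --> \oo] --> (0 : R).
Proof.
apply/cvgrPdist_lt => e e0; exists (Num.truncn e^-1).+1 => // n /= en.
have n0 : 0 < n%:R :> R by rewrite ltr0n (leq_ltn_trans _ en).
rewrite sub0r normrN gtr0_norm ?invr_gt0// -[ltRHS]invrK ltf_pV2 ?posrE ?invr_gt0//.
have /andP[_] := @truncn_itv _ e^-1 (ltW (ltac:(by rewrite invr_gt0) : 0 < e^-1)).
by move/lt_le_trans; apply; rewrite ler_nat.
Qed.

Lemma cvg_eqn (u v : nat -> R) (l : R) : (forall n, (0 < n)%N -> u n = v n) ->
  u n @[n --> \oo] --> l -> v n @[n --> \oo] --> l.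
Proof.
move=> uv; apply: cvg_trans; apply: near_eq_cvg.
by exists 1 => // n /= n1; exact: uv.
Qed.

Lemma cvg_squeeze0 (u v : nat -> R) : (forall n, (0 < n)%N -> `|u n| <= v n) ->
  v n @[n --> \oo] --> (0 : R) -> u n @[n --> \oo] --> (0 : R).
Proof.
move=> uv v0; apply/cvgrPdist_lt => e e0.
move/cvgrPdist_lt : v0 => /(_ e e0)[m _ mP].
exists m.+1 => // n /= mn; rewrite sub0r normrN.
have := mP n (ltnW mn); rewrite /= sub0r normrN => /(le_lt_trans (ler_norm _)).
by apply: le_lt_trans; apply: uv; exact: leq_ltn_trans mn.
Qed.

Lemma cvg_sub0l (u v : nat -> R) (l : R) : u n - v n @[n --> \oo] --> (0 : R) ->
  v n @[n --> \oo] --> l -> u n @[n --> \oo] --> l.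
Proof.
move=> uv vl; apply: (@cvg_eqn (fun n => (u n - v n) + v n)).
  by move=> n _; rewrite subrK.
by rewrite -[X in _ --> X]add0r; exact: cvgD.
Qed.

Section standardized.
Variables (d : nat -> measure_display) (Omega : forall n, measurableType (d n)).
Variables (P : forall n, probability (Omega n) R) (xi : forall n, Omega n -> R).
Arguments xi {n}.
Variables (b sigma : R).
Hypothesis sxi : forall n, (0 < n)%N -> square_integrable (P n) (@xi n).
Hypothesis xi1 : forall n, (0 < n)%N -> \int[P n]_w xi w = 0.
Hypothesis xi2 : forall n, (0 < n)%N -> \int[P n]_w xi w ^+ 2 = 1.
Hypothesis xi_tail : forall a, 0 < a ->
  tail2 (P n) n (@xi n) a @[n --> \oo] --> (0 : R).

Let X n (w : Omega n) := incr n b sigma xi w.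
Arguments X {n}.

(** Serves twice: for the log-returns of the asset and for the increments of the drifted Brownian
    motion. *)
Lemma standardized_limits : array_limits P (@X) b (sigma ^+ 2).
Proof.
split.
- by move=> n n0; apply: sq_incr => //; exact: sxi.
- apply: (@cvg_eqn (fun=> b)); last exact: cvg_cst.
  move=> n n0; rewrite incr_mean//; [|exact: sxi|exact: xi1].
  by rewrite mulrC divfK// gt_eqF// ltr0n.
- apply: (@cvg_eqn (fun n => b ^+ 2 * n%:R^-1 + sigma ^+ 2)).
    move=> n n0; rewrite incr_sq//; [|exact: sxi|exact: xi1|exact: xi2].
    by field; rewrite gt_eqF// ltr0n.
  rewrite -[X in _ --> X]add0r -[X in _ --> X + _](mulr0 (b ^+ 2)).
  by apply: cvgD; [apply: cvgM; [exact: cvg_cst|exact: cvg_invn]|exact: cvg_cst].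
- have g0 n : 0 <= n%:R * \int[P n]_w min23 (X w).
    by rewrite mulr_ge0// Rintegral_ge0// => w _; exact: min23_ge0.
  apply/cvgrPdist_lt => e e0.
  (* The level [a] is free in [incr_min23]; it is fixed so that the one term that does not vanish
     with [n] stays below [e / 3]. *)
  pose a := e / (24 * (sigma ^+ 2 + 1)).
  have s1 : 0 < sigma ^+ 2 + 1 by rewrite ltr_pwDr// sqr_ge0.
  have a0 : 0 < a by rewrite divr_gt0// mulr_gt0.
  have ae : 8 * (a * sigma ^+ 2) <= e / 3.
    have -> : e / 3 = 8 * (a * (sigma ^+ 2 + 1)) by rewrite /a; field; rewrite gt_eqF.
    by rewrite ler_pM2l// ler_pM2l// lerDl.
  have t0 : 8 * (`|b| ^+ 3 * (n%:R^-1 * n%:R^-1)) +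
     8 * (sigma ^+ 2 * tail2 (P n) n (@xi n) (a / (`|sigma| + 1)))
       @[n --> \oo] --> (0 : R).
    rewrite -[X in _ --> X](_ : 8 * (`|b| ^+ 3 * (0 * 0)) + 8 * (sigma ^+ 2 * 0) = 0); last by ring.
    apply: cvgD; apply: cvgM; [exact: cvg_cst| |exact: cvg_cst|]; apply: cvgM; do ?exact: cvg_cst.
      by apply: cvgM; exact: cvg_invn.
    by apply: xi_tail; rewrite divr_gt0// ltr_pwDr.
  move/cvgrPdist_lt : t0 => /(_ (e / 3) (divr_gt0 e0 (ltr0Sn _ 2)))[m _ mP].
  exists m.+1 => // n /= mn; have n0 : (0 < n)%N by exact: leq_ltn_trans mn.
  rewrite sub0r normrN ger0_norm//.
  rewrite (le_lt_trans (incr_min23 b sigma n0 (sxi n0) (xi2 n0) a0))//.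
  have := mP n (ltnW mn); rewrite /= sub0r normrN => /(le_lt_trans (ler_norm _)).
  have -> : 8 * (`|b| ^+ 3 / n%:R ^+ 2 + a * sigma ^+ 2 +
      sigma ^+ 2 * tail2 (P n) n xi (a / (`|sigma| + 1))) =
    8 * (`|b| ^+ 3 * (n%:R^-1 * n%:R^-1)) +
     8 * (sigma ^+ 2 * tail2 (P n) n xi (a / (`|sigma| + 1))) + 8 * (a * sigma ^+ 2).
    by rewrite -[n%:R ^- 2]exprVn; ring.
  by move: ae; lra.
Qed.

(** By [psi_taylor], the moments of [psi f X] are those of its quadratic expansion up to multiples
    of the mean of [min23 X], which is [o(1 / n)]. The quadratic term is what shifts the drift. *)
Lemma psi_limits (f : R) : 0 <= f <= 1 ->
  array_limits P (fun n w => psi f (@X n w))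
    (f * b + f * (1 - f) / 2 * sigma ^+ 2) (f ^+ 2 * sigma ^+ 2).
Proof.
move=> f01; have [sX l1 l2 l3] := standardized_limits.
have mpsi n : (0 < n)%N -> measurable_fun setT (fun w : Omega n => psi f (X w)).
  move=> n0; apply: (measurableT_comp (@measurable_ln R)).
  apply: measurable_funD => //; apply: measurable_funM => //.
  by apply: (measurableT_comp (@measurable_expR R)); have [] := sX n n0.
have spsi n : (0 < n)%N -> square_integrable (P n) (fun w => psi f (X w)).
  move=> n0; apply: (square_integrable_dom (mpsi n n0) _ (sX n n0)) => w.
  by have [] := psi_taylor (X w) f01.
split=> //.
- pose c := f * (1 - f) / 2.
  have lim : n%:R * (\int[P n]_w psi f (X w)) -
      (f * (n%:R * \int[P n]_w X w) + c * (n%:R * \int[P n]_w X w ^+ 2))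
      @[n --> \oo] --> (0 : R).
    apply: (@cvg_squeeze0 _ (fun n => 2 * (n%:R * \int[P n]_w min23 (X w)))); last first.
      by rewrite -[X in _ --> X](mulr0 2); apply: cvgM => //; exact: cvg_cst.
    move=> n n0; have [mX iX2] := sX n n0; have iX := sq_integrable1 (sX n n0).
    have ip := sq_integrable1 (spsi n n0); have ig := integrable_min23 (sX n n0).
    have ir := integrable_lin (- c) iX2 (integrable_lin (- f) iX ip).
    have -> : n%:R * (\int[P n]_w psi f (X w)) -
      (f * (n%:R * \int[P n]_w X w) + c * (n%:R * \int[P n]_w X w ^+ 2)) =
      n%:R * \int[P n]_w ((- c) * X w ^+ 2 + ((- f) * X w + psi f (X w))).
      by rewrite (Rint_lin (- c) iX2 (integrable_lin (- f) iX ip)) (Rint_lin (- f) iX ip); ring.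
    rewrite normrM normr_nat mulrCA ler_wpM2l// -RintegralZl//.
    apply: Rint_norm_le.
    - exact/measurable_EFinP/(measurable_int (P n) ir).
    - exact: (integrableZl measurableT 2 ig).
    move=> w; have [_ t _] := psi_taylor (X w) f01; rewrite (le_trans _ t)//.
    by rewrite le_eqVlt; apply/orP; left; apply/eqP; congr `|_|; rewrite /c; ring.
  apply: (cvg_sub0l lim).
  by apply: cvgD; apply: cvgM => //; exact: cvg_cst.
- have lim : n%:R * (\int[P n]_w psi f (X w) ^+ 2) - f ^+ 2 * (n%:R * \int[P n]_w X w ^+ 2)
      @[n --> \oo] --> (0 : R).
    apply: (@cvg_squeeze0 _ (fun n => 4 * (n%:R * \int[P n]_w min23 (X w)))); last first.
      by rewrite -[X in _ --> X](mulr0 4); apply: cvgM => //; exact: cvg_cst.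
    move=> n n0; have [mX iX2] := sX n n0.
    have [mp ip] := spsi n n0; have ig := integrable_min23 (sX n n0).
    have ir := integrable_lin (- f ^+ 2) iX2 ip.
    have -> : n%:R * (\int[P n]_w psi f (X w) ^+ 2) - f ^+ 2 * (n%:R * \int[P n]_w X w ^+ 2) =
      n%:R * \int[P n]_w ((- f ^+ 2) * X w ^+ 2 + psi f (X w) ^+ 2).
      by rewrite (Rint_lin (- f ^+ 2) iX2 ip); ring.
    rewrite normrM normr_nat mulrCA ler_wpM2l// -RintegralZl//.
    apply: Rint_norm_le.
    - exact/measurable_EFinP/(measurable_int (P n) ir).
    - exact: (integrableZl measurableT 4 ig).
    move=> w; have [_ _ t] := psi_taylor (X w) f01; rewrite (le_trans _ t)//.
    by rewrite le_eqVlt; apply/orP; left; apply/eqP; congr `|_|; ring.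
  apply: (cvg_sub0l lim).
  by apply: cvgM => //; exact: cvg_cst.
- apply: (@cvg_squeeze0 _ (fun n => n%:R * \int[P n]_w min23 (X w))) => // n n0.
  have ig := integrable_min23 (sX n n0); have ig' := integrable_min23 (spsi n n0).
  rewrite ger0_norm; last by rewrite mulr_ge0// Rintegral_ge0// => w _; exact: min23_ge0.
  rewrite ler_wpM2l//; apply: le_Rintegral => // w _; apply: le_min23_norm.
  by have [] := psi_taylor (X w) f01.
Qed.

End standardized.

End arrays.

(** * Independence of the increments *)

Section iid_facts.
Context d (Omega : measurableType d) (R : realType) (P : probability Omega R).

Lemma iid_comp (X : nat -> Omega -> R) (g : R -> R) : measurable_fun setT g ->
  iid P X -> iid P (fun i => g \o X i).
Proof.
move=> mg [mX idX indX].
have mpre A : measurable A -> measurable (g @^-1` A).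
  by move=> mA; rewrite -[X in measurable X]setTI; exact: mg.
split.
- by move=> l; exact: measurableT_comp.
- by move=> l A mA; exact: (idX l _ (mpre _ mA)).
- move=> J A JT mA.
  exact: (indX J (fun i => g @^-1` A i) JT (fun i => mpre _ (mA i))).
Qed.

Lemma iid_shift (xi : nat -> {RV P >-> R}) :
  mutually_independent P [set k | (0 < k)%N] (fun k => xi k : Omega -> R) ->
  (forall k, (0 < k)%N -> identically_distributed (xi k) (xi 1%N)) ->
  iid P (fun i => xi i.+1).
Proof.
move=> ind idxi; split.
- by move=> l; exact: measurable_funPT.
- by move=> l A mA; exact: (idxi l.+1).
move=> J A _ mA; have := ind [fset k.+1 | k in J]%fset (fun k => A k.-1) _ (fun k => mA k.-1).
rewrite big_imfset/=; last by move=> x y _ _ [].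
move=> <-; last by move=> i /imfsetP[k _ ->].
congr (P _); apply/seteqP; split=> [w Jw k /= /imfsetP[j /= jJ ->]|w Jw k /= kJ].
  exact: Jw.
by apply: (Jw k.+1); apply/imfsetP; exists k.
Qed.

Lemma bm_incr_law (B : brownian_motion P) (n i : nat) (A : set R) : (0 < n)%N ->
  measurable A ->
  P ((bm B (i.+1%:R / n%:R) \- bm B (i%:R / n%:R)) @^-1` A) =
    normal_prob 0 (Num.sqrt n%:R^-1) A.
Proof.
move=> n0 mA; have n0R : 0 < n%:R :> R by rewrite ltr0n.
have i0 : 0 <= i%:R / n%:R :> R by rewrite divr_ge0.
have ii : i%:R / n%:R < i.+1%:R / n%:R :> R by rewrite ltr_pM2r ?invr_gt0// ltr_nat.
have e : i.+1%:R / n%:R - i%:R / n%:R = n%:R^-1 :> R.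
  by rewrite -mulrBl -natrB// subSnn mul1r.
by have := bm_gaussian_increments B i0 ii mA; rewrite [_ - _]e.
Qed.

Lemma bm_iid (B : brownian_motion P) (n : nat) : (0 < n)%N ->
  iid P (fun i => (bm B (i.+1%:R / n%:R) \- bm B (i%:R / n%:R)) : Omega -> R).
Proof.
move=> n0; have n0R : 0 < n%:R :> R by rewrite ltr0n.
split.
- by move=> l; apply: measurable_funB; exact: measurable_funPT.
- by move=> l A mA; rewrite !bm_incr_law.
- apply: (bm_independent_increments B (t := fun i => i%:R / n%:R)).
    by rewrite mul0r.
  by move=> i j ij; rewrite ler_pM2r ?invr_gt0// ler_nat.
Qed.

End iid_facts.

Section tails.
Variable R : realType.

(** The factor [n] is at least 1 on positive rows, so [tail2] is squeezed between 0 and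
    [n * tail2]. *)
Lemma lindeberg_tail (d : nat -> measure_display)
    (Omega : forall n, measurableType (d n)) (P : forall n, probability (Omega n) R)
    (xi : forall n, Omega n -> R) :
  (forall n, (0 < n)%N -> square_integrable (P n) (xi n)) ->
  (forall a : R, 0 < a ->
      (n%:R%:E * 'E_(P n)[fun w => (`|xi n w| ^+ 2 *
         \1_[set w' | a * Num.sqrt n%:R < `|xi n w'|] w)%R])%E
        @[n --> \oo] --> (0 : \bar R)) ->
  forall a : R, 0 < a -> tail2 (P n) n (xi n) a @[n --> \oo] --> (0 : R).
Proof.
move=> sxi lin a a0.
apply: (@cvg_squeeze0 _ _ (fun n => n%:R * tail2 (P n) n (xi n) a)).
  move=> n n0; rewrite ger0_norm; last first.
    by apply: Rintegral_ge0 => w _; rewrite mulr_ge0 ?sqr_ge0.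
  rewrite ler_peMl ?ler1n//; apply: Rintegral_ge0 => w _.
  by rewrite mulr_ge0 ?sqr_ge0.
have := lin a a0 => /fine_cvg; apply: cvg_eqn => n n0 /=.
have it := integrable_tail (sxi n n0) (a * Num.sqrt n%:R) 1.
rewrite unlock (_ : (\int[P n]_w _)%E = (tail2 (P n) n (xi n) a)%:E); first by [].
rewrite /tail2 /Rintegral fineK; last first.
  apply: integrable_fin_num => //.
  by move: it; under eq_fun do rewrite mul1r.
apply: eq_integral => w _; rewrite real_normK ?num_real// indicE.
congr (_ * _)%:E; congr (_%:R); congr nat_of_bool.
by apply/idP/idP; rewrite inE.
Qed.

Section brownian_row.
Context d (Omega : measurableType d) (P : probability Omega R).
Variable B : brownian_motion P.

(** Rescaling to unit variance lets Brownian increments enter [standardized_limits] as a noise like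
    any other. *)
Definition bm_step (n : nat) (w : Omega) : R :=
  Num.sqrt n%:R * (bm B (1%:R / n%:R) \- bm B (0%:R / n%:R)) w.

Let N (n : nat) : {RV P >-> R} := bm B (1%:R / n%:R) \- bm B (0%:R / n%:R).

Let s0 n : (0 < n)%N -> 0 < Num.sqrt (n%:R^-1 : R).
Proof. by move=> n0; rewrite sqrtr_gt0 invr_gt0 ltr0n. Qed.

Let law n A : (0 < n)%N -> measurable A ->
  P (N n @^-1` A) = normal_prob 0 (Num.sqrt n%:R^-1) A.
Proof. by move=> n0 mA; exact: (bm_incr_law B 0 n0). Qed.

Let bm_stepE n : bm_step n = fun w => 0 + Num.sqrt n%:R * N n w.
Proof. by apply/funext => w; rewrite add0r. Qed.

Lemma bm_step_sq n : (0 < n)%N -> square_integrable P (bm_step n).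
Proof.
move=> n0; rewrite bm_stepE; apply: square_integrable_affine.
exact: (normal_rv_sq (s0 n0) (fun A => law n0)).
Qed.

Lemma bm_step_mean n : (0 < n)%N -> \int[P]_w bm_step n w = 0.
Proof.
move=> n0; rewrite /bm_step RintegralZl//.
  by rewrite [X in _ * X](normal_rv_mean (s0 n0) (fun A => @law n A n0)) mulr0.
exact: sq_integrable1 (normal_rv_sq (s0 n0) (fun A => @law n A n0)).
Qed.

Lemma bm_step_var n : (0 < n)%N -> \int[P]_w bm_step n w ^+ 2 = 1.
Proof.
move=> n0; have n0R : 0 <= n%:R :> R by [].
transitivity (\int[P]_w (n%:R * N n w ^+ 2)).
  by apply: eq_Rintegral => w _; rewrite /bm_step exprMn sqr_sqrtr.
have [_ i2] := normal_rv_sq (s0 n0) (fun A => @law n A n0).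
rewrite RintegralZl// (normal_rv_var (s0 n0) (fun A => @law n A n0)).
by rewrite sqr_sqrtr ?invr_ge0// mulfV// pnatr_eq0 -lt0n.
Qed.

(** Beyond the level [a * sqrt n] the square is at most the cube divided by that level, and the
    third absolute moment of the rescaled increment is at most 4 for every [n]. *)
Lemma bm_step_tail a : 0 < a -> tail2 P n (bm_step n) a @[n --> \oo] --> (0 : R).
Proof.
move=> a0.
apply: (@cvg_squeeze0 _ _ (fun n => 4 / a * Num.sqrt n%:R^-1)); last first.
  rewrite -[X in _ --> X](mulr0 (4 / a)); apply: cvgM; first exact: cvg_cst.
  rewrite -[X in _ --> X](@sqrtr0 R).
  by apply: continuous_cvg; [exact: sqrt_continuous|exact: cvg_invn].
move=> n n0; have n0R : 0 < n%:R :> R by rewrite ltr0n.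
have q0 : 0 < Num.sqrt n%:R :> R by rewrite sqrtr_gt0.
have [i3 e3] := normal_rv_abs3 (s0 n0) (fun A => @law n A n0).
have aq : 0 < a * Num.sqrt n%:R by rewrite mulr_gt0.
apply: (@le_trans _ _ (\int[P]_w ((Num.sqrt n%:R) ^+ 3 / (a * Num.sqrt n%:R) * `|N n w| ^+ 3))).
  apply: Rint_norm_le.
  - have := (measurable_tail (a * Num.sqrt n%:R) 1 (bm_step_sq n0).1).
    by under eq_fun do rewrite mul1r.
  - exact: (integrableZl measurableT _ i3).
  move=> w; rewrite normrM normr_nat normrX.
  have -> : Num.sqrt n%:R ^+ 3 / (a * Num.sqrt n%:R) * `|N n w| ^+ 3 =
      `|bm_step n w| ^+ 2 * (`|bm_step n w| / (a * Num.sqrt n%:R)).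
    by rewrite /bm_step normrM (gtr0_norm q0); field; rewrite !gt_eqF.
  apply: ler_wpM2l; first exact: sqr_ge0.
  case: ltP => h /=; last by rewrite divr_ge0// ltW.
  by rewrite ler_pdivlMr// mul1r ltW.
rewrite RintegralZl//.
apply: (le_trans (ler_wpM2l _ e3)); first by rewrite divr_ge0 ?exprn_ge0// ltW.
rewrite sqrtrV//; rewrite le_eqVlt; apply/orP; left; apply/eqP.
by field; rewrite !gt_eqF.
Qed.

End brownian_row.
End tails.

(** * Functionals of paths *)

Section inf_convolution.
Variables (R : realType) (S : Type) (near : R -> S -> S -> Prop).
Hypothesis near_refl : forall x, near 0 x x.
Hypothesis near_sym : forall e x y, near e x y -> near e y x.
Hypothesis near_trans : forall e1 e2 x y z, near e1 x y -> near e2 y z ->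
  near (e1 + e2) x z.
Hypothesis near_ge0 : forall e x y, near e x y -> 0 <= e.
Variables (Phi : S -> R) (M : R).
Hypothesis PhiM : forall x, `|Phi x| <= M.

(** The Pasch-Hausdorff envelope, with [near e x y] read as distance at most [e]: the greatest
    [k]-Lipschitz minorant of [Phi]. *)
Definition infconv (k : R) (x : S) : R :=
  inf [set r | exists y e, near e x y /\ r = Phi y + k * e].

Let below k x : 0 <= k -> lbound [set r | exists y e, near e x y /\ r = Phi y + k * e] (- M).
Proof.
move=> k0 _ [y [e [/near_ge0 e0 ->]]].
have := PhiM y; rewrite ler_norml => /andP[+ _]; move/le_trans; apply.
by rewrite lerDl mulr_ge0.
Qed.

Lemma infconv_le k x : 0 <= k -> infconv k x <= Phi x.
Proof.
move=> k0; apply: ge_inf; first by exists (- M); exact: below.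
by exists x, 0; split=> //; rewrite mulr0 addr0.
Qed.

Let infconv_lb k x (c : R) : (forall y e, near e x y -> c <= Phi y + k * e) -> c <= infconv k x.
Proof.
move=> h; apply: lb_le_inf; first by exists (Phi x + k * 0), x, 0.
by move=> _ [y [e [xy ->]]]; exact: h.
Qed.

Lemma infconv_bounded k x : 0 <= k -> `|infconv k x| <= M.
Proof.
move=> k0; rewrite ler_norml; apply/andP; split.
  apply: infconv_lb => y e xy; apply: (@below k x k0).
  by exists y, e; split.
rewrite (le_trans (infconv_le x k0))//.
by have := PhiM x; rewrite ler_norml => /andP[].
Qed.

Lemma infconv_lipschitz k x x' e : 0 <= k -> near e x x' ->
  `|infconv k x - infconv k x'| <= k * e.
Proof.
move=> k0 xx'; have half a b : near e a b -> infconv k a - k * e <= infconv k b.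
  move=> ab; apply: infconv_lb => y e' by_.
  rewrite lerBlDr -addrA -mulrDr; apply: ge_inf; first by exists (- M); exact: below.
  by exists y, (e' + e); split=> //; rewrite addrC; exact: near_trans ab by_.
rewrite ler_norml; apply/andP; split.
  by rewrite lerBrDr addrC half//; exact: near_sym.
by rewrite lerBlDr -lerBlDl half.
Qed.

(** Points within [delta] are handled by lower semicontinuity at [x]; for farther ones the penalty
    is at least [2 * M], the largest possible drop of [Phi], once [k * delta] is. *)
Lemma infconv_cvg x :
  (forall e, 0 < e -> exists2 delta, 0 < delta & forall y e', e' < delta ->
    near e' x y -> Phi x - e <= Phi y) ->
  infconv k%:R x @[k --> \oo] --> Phi x.
Proof.
move=> cPhi; apply/cvgrPdist_le => e e0.
have [delta d0 dP] := cPhi e e0.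
exists (Num.truncn (2 * M / delta)).+1 => // k /= kM.
rewrite ger0_norm ?subr_ge0 ?infconv_le// lerBlDr -lerBlDl.
have M0 : 0 <= M by exact: le_trans (PhiM x).
apply: infconv_lb => y e' xy; have e'0 := near_ge0 xy.
have [lt|ge] := ltP e' delta.
  by rewrite (le_trans (dP y e' lt xy))// lerDl mulr_ge0.
have := PhiM x; have := PhiM y; rewrite !ler_norml => /andP[y1 y2] /andP[x1 x2].
have : 2 * M <= k%:R * e'.
  rewrite (@le_trans _ _ (k%:R * delta))//; last by rewrite ler_wpM2l.
  rewrite -ler_pdivrMr//.
  have /andP[_ /ltW] := @truncn_itv _ (2 * M / delta) (divr_ge0 (mulr_ge0 (ler0n _ _) M0) (ltW d0)).
  by move/le_trans; apply; rewrite ler_nat.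
by move: e0; lra.
Qed.

End inf_convolution.

Section paths.
Variables (R : realType) (T : R).
Implicit Types (x y : skorokhod T) (p : nat -> R).

Lemma skorokhod_eq x y : (forall t, x t = y t) -> x = y.
Proof.
case: x y => [x cx] [y cy] /= xy; have e : x = y by apply/funext.
by move: cx; rewrite e => cx; congr Skorokhod; exact: Prop_irrelevance.
Qed.

(** [0 <= e] is explicit because [[0, T]] is empty for negative [T]. *)
Definition unif_close (e : R) x y := 0 <= e /\ forall t, t \in `[0, T] -> `|x t - y t| <= e.

Lemma unif_close_refl x : unif_close 0 x x.
Proof. by split=> // t _; rewrite subrr normr0. Qed.

Lemma unif_close_sym e x y : unif_close e x y -> unif_close e y x.
Proof. by move=> [e0 xy]; split=> // t tT; rewrite distrC xy. Qed.

Lemma unif_close_trans e1 e2 x y z : unif_close e1 x y -> unif_close e2 y z -> unif_close (e1 + e2) x z.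
Proof.
move=> [e10 xy] [e20 yz]; split=> [|t tT]; first exact: addr_ge0.
by rewrite (le_trans (ler_distD (y t) _ _))// lerD ?xy ?yz.
Qed.

Lemma unif_close_ge0 e x y : unif_close e x y -> 0 <= e. Proof. by case. Qed.

Lemma cadlag_exp (u : R -> R) : cadlag T u -> cadlag T (expR \o u).
Proof.
move=> [cr cl]; split=> t tT.
  by apply: (cvg_comp u expR); [exact: cr|exact: continuous_expR].
have /cvg_ex[l ul] := cl t tT.
by apply/cvg_ex; exists (expR l); apply: (cvg_comp u expR); [exact: ul|exact: continuous_expR].
Qed.

Definition exp_path x : skorokhod T := Skorokhod (cadlag_exp (skorokhod_cadlag x)).

Lemma expR_dist (K a b : R) : a <= K -> b <= K -> `|expR a - expR b| <= expR K * `|a - b|.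
Proof.
have half c e : c <= e -> e <= K -> `|expR c - expR e| <= expR K * `|c - e|.
  move=> ce eK; rewrite !ler0_norm ?subr_le0 ?ler_expR// !opprB.
  rewrite (@le_trans _ _ (expR e * (e - c)))//; last first.
    by rewrite ler_wpM2r ?subr_ge0// ler_expR.
  have := expR_ge1Dx (c - e); rewrite -(ler_pM2l (expR_gt0 e)) -expRD (_ : e + (c - e) = c); last by ring.
  by have := expR_gt0 e; lra.
move=> aK bK; have [ab|/ltW ba] := leP a b; first exact: half.
by rewrite distrC (distrC a); exact: half.
Qed.

(** [expR] is Lipschitz only below a level: [delta <= 1] keeps [y] under [K + 1]. The identity time
    change turns uniform into Skorokhod closeness. *)
Lemma exp_path_near x (K e : R) : (forall t, t \in `[0, T] -> x t <= K) -> 0 < e ->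
  exists2 delta, 0 < delta & forall y e', e' < delta -> unif_close e' x y ->
    ball (exp_path x) e (exp_path y).
Proof.
move=> xK e0; exists (Num.min 1 (e / 2 / expR (K + 1))).
  by rewrite lt_min ltr01 !divr_gt0// expR_gt0.
move=> y e' + [e'0 xy]; rewrite lt_min => /andP[e'1 e'e].
split=> //; apply/skorokhod_dist_ltP => //; exists id, (e / 2); split.
- exact: time_change_id.
- by rewrite ltr_pdivrMr// ltr_pMr// ltr1n.
move=> t tT; rewrite subrr normr0; split; first by rewrite divr_ge0// ltW.
have h := xy t tT; have hK := xK t tT.
rewrite /= (le_trans (@expR_dist (K + 1) _ _ _ _))//.
- by rewrite (le_trans hK)// lerDl.
- by move: h; rewrite ler_norml => /andP[? ?]; lra.
rewrite mulrC -ler_pdivlMr ?expR_gt0//.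
by rewrite (le_trans h)// ltW.
Qed.

Definition step (n : nat) p : skorokhod T := Skorokhod (@cadlag_truncn R T n p).

Lemma truncn_le (n : nat) (t : R) : t \in `[0, T] ->
  (Num.truncn (n%:R * t) <= Num.truncn (n%:R * T))%N.
Proof.
by rewrite in_itv/= => /andP[t0 tT]; apply: le_truncn; rewrite ler_wpM2l.
Qed.

Lemma step_bounded n p : exists K, forall t, t \in `[0, T] -> step n p t <= K.
Proof.
exists (\sum_(i < (Num.truncn (n%:R * T)).+1) `|p i|) => t tT /=.
have tl : (Num.truncn (n%:R * t) < (Num.truncn (n%:R * T)).+1)%N.
  by rewrite ltnS truncn_le.
rewrite (bigD1 (Ordinal tl))//= (le_trans (ler_norm _))// lerDl.
by apply: sumr_ge0.
Qed.

Lemma unif_step n p p' e :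
  0 <= e -> (forall k, (k <= Num.truncn (n%:R * T))%N -> `|p k - p' k| <= e) ->
  unif_close e (step n p) (step n p').
Proof. by move=> e0 h; split=> // t tT /=; apply: h; exact: truncn_le. Qed.

Lemma plip_step n (Psi : skorokhod T -> R) (M L : R) :
  (forall x, `|Psi x| <= M) ->
  (forall e x y, unif_close e x y -> `|Psi x - Psi y| <= L * e) ->
  plip (Num.truncn (n%:R * T)) M L (fun p => Psi (step n p)).
Proof.
move=> PM PL; split=> // p p' e h; apply: PL.
by apply: unif_step => //; exact: le_trans (h 0%N (leq0n _)).
Qed.

Lemma seqcont_step n (g : seq R -> nat -> R) :
  (forall s t k, size s = size t -> `|g s k - g t k| <= sdist s t) ->
  seqcont (fun s => exp_path (step n (g s)) : skorokhod T).
Proof.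
move=> gL s t u y uy; apply/cvg_ballP => e e0.
have [K xK] := step_bounded n (g (s ++ y :: t)).
have [delta d0 dP] := exp_path_near xK e0.
move/cvgrPdist_lt : uy => /(_ delta d0)[m _ mP].
exists m => // k /mP /= uk; apply: (dP _ `|y - u k|) => //.
apply: unif_step => // j _; rewrite (le_trans (gL _ _ _ _)) ?size_cat//.
by rewrite sdist_cat// sdistss add0r /= sdistss addr0.
Qed.

End paths.

(** * Invariance principle *)

Section discretization.
Variables (R : realType) (T : R).

(** Compactness of [[0, T]] makes uniform an estimate that is joint in [t] near a point and [n] near
    infinity. The grid point is nonnegative and within [1 / n] of [t], so both lie within [eta] of
    the centre. *)
Lemma grid_uniform (y : R -> R) (e : R) : {within `[0, +oo[, continuous y} -> 0 < e ->
  \forall n \near \oo, forall t, t \in `[0, T] ->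
    `|y ((Num.truncn (n%:R * t))%:R / n%:R) - y t| <= e.
Proof.
move=> cy e0.
have cover := iffLR (@compact_near_coveringP R `[0, T]%classic) (@segment_compact R 0 T).
have := @cover nat \oo (fun n t => t \in `[0, T] ->
  `|y ((Num.truncn (n%:R * t))%:R / n%:R) - y t| <= e) _ _.
have h : forall x, `[0, T]%classic x -> \forall x' \near x & i \near \oo,
    x' \in `[0, T] -> `|y ((Num.truncn (i%:R * x'))%:R / i%:R) - y x'| <= e.
  move=> x; rewrite /= in_itv/= => /andP[x0 xT].
  have xy : `[0, +oo[%classic x by rewrite /= in_itv/= x0.
  have /cvgrPdist_le/(_ (e / 2) (divr_gt0 e0 (ltr0Sn _ _))) := (iffLR (subspace_continuousP _ _) cy) x xy.
  rewrite near_withinE => /nbhs_ballP[eta /= eta0 etaP].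
  have eta2 : 0 < eta / 2 by rewrite divr_gt0.
  exists (ball x (eta / 2), [set n | (Num.truncn (eta / 2)^-1 < n)%N]) => /=.
    split; first exact: nbhsx_ballx.
    by exists (Num.truncn (eta / 2)^-1).+1.
  move=> [t n] /= [tx nn]; rewrite in_itv/= => /andP[t0 tT].
  have n0 : 0 < n%:R :> R by rewrite ltr0n (leq_ltn_trans _ nn).
  have n1 : n%:R^-1 < eta / 2.
    rewrite -[ltRHS]invrK ltf_pV2 ?posrE ?invr_gt0//.
    have /andP[_] := @truncn_itv _ (eta / 2)^-1 (ltW (ltac:(by rewrite invr_gt0) : 0 < (eta / 2)^-1)).
    by move/lt_le_trans; apply; rewrite ler_nat.
  have nt0 : 0 <= n%:R * t by rewrite mulr_ge0// ltW.
  have /andP[f1 f2] := truncn_itv nt0.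
  set u := (Num.truncn (n%:R * t))%:R / n%:R.
  have u0 : 0 <= u by rewrite divr_ge0// ltW.
  have ut : u <= t by rewrite /u ler_pdivrMr// (mulrC t).
  have tu : t < u + n%:R^-1.
    by rewrite /u -[X in _ + X]mul1r -mulrDl ltr_pdivlMr// natr1 (mulrC t).
  have itvE (v : R) : 0 <= v -> v \in `[0, +oo[ by rewrite in_itv/= => ->.
  move: tx; rewrite /ball/= ltr_norml => /andP[tx1 tx2].
  have b1 : `|y x - y t| <= e / 2.
    apply: (etaP t _ (itvE t t0)); rewrite /ball/= ltr_norml; apply/andP; split; lra.
  have b2 : `|y x - y u| <= e / 2.
    apply: (etaP u _ (itvE u u0)); rewrite /ball/= ltr_norml; apply/andP; split; lra.
  rewrite (le_trans (ler_distD (y x) _ _))// (distrC (y u)).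
  by move: b1 b2; lra.
move/(_ _ h); apply: filterS => n H t tT.
exact: (H t tT tT).
Qed.

Lemma continuous_bounded (y : R -> R) : {within `[0, +oo[, continuous y} ->
  exists K, forall t, t \in `[0, T] -> y t <= K.
Proof.
move=> cy; have [T0|T0] := leP 0 T; last first.
  by exists 0 => t; rewrite in_itv/= => /andP[/le_trans] /[apply]; rewrite leNgt T0.
have [|c _ cP] := @EVT_max R y 0 T T0; last by exists (y c).
apply: continuous_subspaceW cy => t /=; rewrite !in_itv/= andbT.
by move=> /andP[].
Qed.

End discretization.

Section invariance.
Variables (R : realType) (T : R).
Hypothesis T0 : 0 < T.
Implicit Types (Psi : skorokhod T -> R).

Definition walk d (Omega : measurableType d) (n : nat) (X : nat -> Omega -> R) (w : Omega) :
  skorokhod T := step T n (fun m => \sum_(i < m) X i w).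

Lemma sumk_sample d (Omega : measurableType d) (X : nat -> Omega -> R) (N k : nat) w :
  (k <= N)%N -> sumk (sample X 0 N w) k = \sum_(i < k) X i w.
Proof.
move=> kN; apply: eq_bigr => i _; have iN := leq_trans (ltn_ord i) kN.
by rewrite /sample (nth_map 0%N) ?size_iota// nth_iota.
Qed.

(** The two paths agree on [[0, T]] but may differ later, where the sample has run out; being
    uniformly close with [e = 0], they have the same image under [Psi]. *)
Lemma walkE d (Omega : measurableType d) (n : nat) (X : nat -> Omega -> R) Psi w (L : R) :
  (forall e x y, unif_close e x y -> `|Psi x - Psi y| <= L * e) ->
  Psi (walk n X w) = Psi (step T n (sumk (sample X 0 (Num.truncn (n%:R * T)) w))).
Proof.
move=> PL; apply/eqP; rewrite -subr_eq0 -normr_le0 -(mulr0 L); apply: PL.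
by apply: unif_step => // k kN; rewrite sumk_sample// subrr normr0.
Qed.

Section one_space.
Context d (Omega : measurableType d) (P : probability Omega R).
Variables (n : nat) (X : nat -> Omega -> R) (Psi : skorokhod T -> R) (M L : R).
Hypotheses (L0 : 0 <= L) (PM : forall x, `|Psi x| <= M).
Hypothesis PL : forall e x y, unif_close e x y -> `|Psi x - Psi y| <= L * e.

Let bF : blip (M + L) (fun s => Psi (step T n (sumk s))).
Proof.
by apply: (blip_plip L0 (plip_step n PM PL)) => s t k st; exact: sumk_lip.
Qed.

Lemma measurable_walk : (forall l, measurable_fun setT (X l)) ->
  measurable_fun setT (fun w => Psi (walk n X w)).
Proof.
move=> mX.
rewrite (_ : (fun w => _) = fun w => Psi (step T n (sumk (sample X 0 (Num.truncn (n%:R * T)) w)))).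
  apply: borel_measurable.
  exact: (borel_sample (F := fun s => Psi (step T n (sumk s))) 0 _ mX (blip_seqcont bF)).
by apply/funext => w; exact: walkE PL.
Qed.

Lemma mean_walk : iid P X -> \int[P]_w Psi (walk n X w) =
  imean (law P (X 0%N)) (Num.truncn (n%:R * T)) (fun s => Psi (step T n (sumk s))).
Proof.
by move=> iX; rewrite -(imean_law iX _ bF); apply: eq_Rintegral => w _; exact: walkE PL.
Qed.

End one_space.

(** [mean_walk] reduces each integral to an iterated mean of one marginal law, so the walks may live
    on unrelated spaces; the array limits supply the bounds asked by [lindeberg_swap]. *)
Lemma walk_compare (d d' : nat -> measure_display)
    (Omega : forall n, measurableType (d n)) (P : forall n, probability (Omega n) R)
    (Omega' : forall n, measurableType (d' n)) (P' : forall n, probability (Omega' n) R)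
    (X : forall n, nat -> Omega n -> R) (X' : forall n, nat -> Omega' n -> R)
    (a v : R) Psi (M L : R) :
  (forall n, (0 < n)%N -> iid (P n) (X n)) ->
  (forall n, (0 < n)%N -> iid (P' n) (X' n)) ->
  array_limits P (fun n => X n 0%N) a v ->
  array_limits P' (fun n => X' n 0%N) a v ->
  0 <= L -> (forall x, `|Psi x| <= M) ->
  (forall e x y, unif_close e x y -> `|Psi x - Psi y| <= L * e) ->
  \int[P n]_w Psi (walk n (X n) w) - \int[P' n]_w Psi (walk n (X' n) w)
    @[n --> \oo] --> (0 : R).
Proof.
move=> iX iX' [sX l1 l2 l3] [sX' l1' l2' l3'] L0 PM PL.
have M0 : 0 <= M by apply: le_trans (PM point).
apply/cvgrPdist_le => e e0.
pose A := `|a| + `|v| + 1.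
have A0 : 0 <= A by rewrite !addr_ge0.
have [kap [n0 [kap0 cmp]]] := lindeberg_swap A0 M0 L0 (ltW T0) e0.
pose al n := \int[P n]_w X n 0%N w.
pose vl n := \int[P n]_w X n 0%N w ^+ 2.
pose dl n := \int[P n]_w min23 (X n 0%N w).
pose al' n := \int[P' n]_w X' n 0%N w.
pose vl' n := \int[P' n]_w X' n 0%N w ^+ 2.
pose dl' n := \int[P' n]_w min23 (X' n 0%N w).
have big (x y : nat -> R) : n%:R * x n @[n --> \oo] --> a -> n%:R * y n @[n --> \oo] --> v ->
    \forall n \near \oo, n%:R * (`|x n| + `|y n|) <= A.
  move=> xa yv.
  have h : `|n%:R * x n| + `|n%:R * y n| @[n --> \oo] --> `|a| + `|v|.
    by apply: cvgD; exact: cvg_norm.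
  have lt : `|a| + `|v| < A by rewrite /A ltrDl.
  near=> n; rewrite (_ : n%:R * _ = `|n%:R * x n| + `|n%:R * y n|).
    by near: n; exact: (cvgr_le _ h _ lt).
  by rewrite !normrM normr_nat -mulrDr.
have small : \forall n \near \oo, n%:R * (`|al n - al' n| + `|vl n - vl' n| + dl n + dl' n) <= kap.
  have h : `|n%:R * al n - n%:R * al' n| + `|n%:R * vl n - n%:R * vl' n| + n%:R * dl n + n%:R * dl' n
      @[n --> \oo] --> `|a - a| + `|v - v| + 0 + 0.
    apply: cvgD; last exact: l3'.
    apply: cvgD; last exact: l3.
    by apply: cvgD; apply: cvg_norm; [exact: cvgB l1 l1'|exact: cvgB l2 l2'].
  have lt : `|a - a| + `|v - v| + 0 + 0 < kap by rewrite !subrr !normr0 !addr0.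
  near=> n.
  rewrite (_ : n%:R * _ = `|n%:R * al n - n%:R * al' n| + `|n%:R * vl n - n%:R * vl' n| +
     n%:R * dl n + n%:R * dl' n); first by near: n; exact: (cvgr_le _ h _ lt).
  by rewrite -!mulrBr !normrM normr_nat -!mulrDr.
have bg := big _ _ l1 l2; have bg' := big _ _ l1' l2'.
near=> n.
have n1 : (0 < n)%N by near: n; exact: nbhs_infty_gt.
have n0n : (n0 <= n)%N by near: n; exact: nbhs_infty_ge.
rewrite sub0r normrN.
have [mX _ _] := iX n n1; have [mX' _ _] := iX' n n1.
rewrite (mean_walk n L0 PM PL (iX n n1)) (mean_walk n L0 PM PL (iX' n n1)).
apply: (cmp n (law (P n) (X n 0%N)) (law (P' n) (X' n 0%N)) (al n) (vl n) (dl n)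
  (al' n) (vl' n) (dl' n) _ (fun p => Psi (step T n p))) => //.
- exact: mean_law.
- exact: mean_law.
- exact: moments_law (sX n n1).
- exact: moments_law (sX' n n1).
- by apply: Rintegral_ge0 => w _; exact: min23_ge0.
- by apply: Rintegral_ge0 => w _; exact: min23_ge0.
- by near: n.
- by near: n.
- by near: n.
- have /andP[h _] := @truncn_itv _ (n%:R * T) (mulr_ge0 (ler0n _ _) (ltW T0)).
  by rewrite (mulrC T).
- exact: plip_step.
Unshelve. all: by end_near. Qed.

(* Only lower semicontinuity along the limit paths is used; applying the
   conclusion to [Phi] and [- Phi] gives convergence of the integrals. *)
Lemma walk_liminf (d : nat -> measure_display)
    (Omega : forall n, measurableType (d n)) (P : forall n, probability (Omega n) R)
    (d' : measure_display) (Omega' : measurableType d') (Q : probability Omega' R)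
    (X : forall n, nat -> Omega n -> R) (X' : forall n : nat, nat -> Omega' -> R)
    (Y : Omega' -> skorokhod T)
    (a v : R) (Phi : skorokhod T -> R) (M : R) :
  (forall n, (0 < n)%N -> iid (P n) (X n)) ->
  (forall n, (0 < n)%N -> iid Q (X' n)) ->
  array_limits P (fun n => X n 0%N) a v ->
  array_limits (fun=> Q) (fun n => X' n 0%N) a v ->
  (forall w e, 0 < e -> \forall n \near \oo, unif_close e (walk n (X' n) w) (Y w)) ->
  (forall x, `|Phi x| <= M) ->
  (forall n, (0 < n)%N -> measurable_fun setT (fun w => Phi (walk n (X n) w))) ->
  measurable_fun setT (fun w => Phi (Y w)) ->
  (forall w e, 0 < e -> exists2 delta, 0 < delta & forall y e', e' < delta ->
    unif_close e' (Y w) y -> Phi (Y w) - e <= Phi y) ->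
  forall e, 0 < e -> \forall n \near \oo,
    \int[Q]_w Phi (Y w) - e <= \int[P n]_w Phi (walk n (X n) w).
Proof.
move=> iX iX' lX lX' XY PhiM mPX mPY lsc e e0.
pose Phik k := infconv (@unif_close R T) Phi k%:R.
have PkM k x : `|Phik k x| <= M.
  exact: (infconv_bounded (@unif_close_refl R T) (@unif_close_ge0 R T) PhiM).
have PkL k e' x y : unif_close e' x y -> `|Phik k x - Phik k y| <= k%:R * e'.
  exact: (infconv_lipschitz (@unif_close_refl R T) (@unif_close_sym R T)
    (@unif_close_trans R T) (@unif_close_ge0 R T) PhiM).
have Pkle k x : Phik k x <= Phi x.
  exact: (infconv_le (@unif_close_refl R T) (@unif_close_ge0 R T) PhiM).
have YX k w : Phik k (walk n (X' n) w) @[n --> \oo] --> Phik k (Y w).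
  apply/cvgrPdist_le => e' e'0.
  have k1 : 0 < k%:R + 1 :> R by rewrite ltr_pwDr.
  have := XY w (e' / (k%:R + 1)) (divr_gt0 e'0 k1); apply: filterS => n u.
  rewrite distrC (le_trans (PkL k _ _ _ u))// mulrCA ler_piMr ?(ltW e'0)//.
  by rewrite ler_pdivrMr// mul1r lerDl.
have mw k n : (0 < n)%N -> measurable_fun setT (fun w => Phik k (walk n (X' n) w)).
  move=> n1; have [mX' _ _] := iX' n n1.
  exact: (measurable_walk n (ler0n _ k) (PkM k) (PkL k) mX').
(* Nothing is known of row 0; the shift to [n.+1] skips it without changing the limit. *)
have YX1 k w : Phik k (walk n.+1 (X' n.+1) w) @[n --> \oo] --> Phik k (Y w).
  by have := YX k w; rewrite -(cvg_shiftS (fun n => Phik k (walk n (X' n) w))).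
have mPkY k : measurable_fun setT (fun w => Phik k (Y w)).
  apply: (@measurable_fun_cvg _ _ _ setT (fun n w => Phik k (walk n.+1 (X' n.+1) w))) => //.
  by move=> n; exact: mw.
have lim1 : \int[Q]_w Phik k (Y w) @[k --> \oo] --> \int[Q]_w Phi (Y w).
  apply: (@Rint_cvg _ _ _ Q (fun k w => Phik k (Y w)) _ M) => // w.
  apply: (infconv_cvg (@unif_close_refl R T) (@unif_close_ge0 R T) PhiM).
  exact: lsc.
have e3 : 0 < e / 3 by rewrite divr_gt0.
(* [k] is fixed before [n] grows, so only one Lipschitz functional has to be compared. *)
move/cvgrPdist_le : lim1 => /(_ _ e3)[k _ /(_ k (leqnn _))/= kP].
have lim2 : \int[Q]_w Phik k (walk n (X' n) w) @[n --> \oo] --> \int[Q]_w Phik k (Y w).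
  rewrite -(cvg_shiftS (fun n => \int[Q]_w Phik k (walk n (X' n) w))).
  apply: (@Rint_cvg _ _ _ Q (fun n w => Phik k (walk n.+1 (X' n.+1) w)) _ M) => //.
  by move=> n; exact: mw.
have lim3 := walk_compare iX iX' lX lX' (ler0n _ k) (PkM k) (PkL k).
move/cvgrPdist_le : lim2 => /(_ _ e3) lim2; move/cvgrPdist_le : lim3 => /(_ _ e3) lim3.
near=> n.
have n1 : (0 < n)%N by near: n; exact: nbhs_infty_gt.
have [mX _ _] := iX n n1.
have h2 : `|\int[Q]_w Phik k (Y w) - \int[Q]_w Phik k (walk n (X' n) w)| <= e / 3.
  by near: n.
have h3 : `|0 - (\int[P n]_w Phik k (walk n (X n) w) - \int[Q]_w Phik k (walk n (X' n) w))| <= e / 3.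
  by near: n.
have h4 : \int[P n]_w Phik k (walk n (X n) w) <= \int[P n]_w Phi (walk n (X n) w).
  apply: le_Rintegral => //.
  - apply: (@bounded_integrable _ _ _ _ _ M) => //.
    exact: (measurable_walk n (ler0n _ k) (PkM k) (PkL k) mX).
  - by apply: (@bounded_integrable _ _ _ _ _ M) => //; exact: mPX.
by move: kP h2 h3 h4; rewrite !ler_norml => /andP[? ?] /andP[? ?] /andP[? ?]; lra.
Unshelve. all: by end_near. Qed.

End invariance.

(** * Measurability of random paths *)

Section random_paths.
Context (R : realType) (T : R) d (Omega : measurableType d).

Lemma sdist_nth (s t : seq R) k : size s = size t -> `|s`_k - t`_k| <= sdist s t.
Proof.
elim: s t k => [|x s IH] [|y t] // k st; first by rewrite nth_nil subrr normr0.
case: k => [|k] /=; first by rewrite lerDl sdist_ge0.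
by rewrite (le_trans (IH t k _)) ?lerDr//; case: st.
Qed.

Lemma borel_exp_step n (p : Omega -> nat -> R) :
  (forall k, measurable_fun setT (fun w => p w k)) ->
  borel (fun w => exp_path (step T n (p w))).
Proof.
move=> mp; pose X k w := p w k; pose N := (Num.truncn (n%:R * T)).+1.
pose F (s : seq R) : skorokhod T := exp_path (step T n (fun k => s`_k)).
(* A constant sequence: its term and the target agree on [[0, T]] only, so they are at Skorokhod
   distance 0 without being equal, and the one is a limit of the other. *)
apply: (@borel_cvg _ _ _ _ (fun _ w => F (sample X 0 N w))).
  move=> _; apply: borel_sample => //; apply: (@seqcont_step _ _ n (fun s k => s`_k)).
  by move=> s t k; exact: sdist_nth.
move=> w; apply/cvg_ballP => e e0; apply: nearW => _.
have [K xK] := step_bounded T n (p w).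
have [delta d0 dP] := exp_path_near xK e0; apply: (dP _ 0) => //.
apply: unif_step => // k kN.
by rewrite /sample (nth_map 0%N) ?size_iota ?ltnS// nth_iota ?ltnS// subrr normr0.
Qed.

Definition continuous_path (y : R -> R) (cy : {within `[0, +oo[, continuous y}) : skorokhod T :=
  Skorokhod (@cadlag_continuous R T y cy).

Lemma unif_grid (y : R -> R) (cy : {within `[0, +oo[, continuous y}) (e : R) : 0 < e ->
  \forall n \near \oo, unif_close e (step T n (fun m => y (m%:R / n%:R))) (continuous_path cy).
Proof.
by move=> e0; have := @grid_uniform R T y e cy e0; apply: filterS => n h; split; [exact: ltW|].
Qed.

(** Continuous paths are uniform limits on [[0, T]] of their grid samples, which are measurable by
    [borel_exp_step]. *)
Lemma borel_exp_path (y : Omega -> R -> R)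
    (cy : forall w, {within `[0, +oo[, continuous (y w)}) :
  (forall t, measurable_fun setT (fun w => y w t)) ->
  borel (fun w => exp_path (continuous_path (cy w))).
Proof.
move=> my.
apply: (@borel_cvg _ _ _ _ (fun n w => exp_path (step T n (fun m => y w (m%:R / n%:R))))).
  by move=> n; exact: borel_exp_step.
move=> w; apply/cvg_ballP => e e0.
have [K yK] := continuous_bounded T (cy w).
have [delta d0 dP] := exp_path_near (x := continuous_path (cy w)) yK e0.
have d2 : 0 < delta / 2 by rewrite divr_gt0.
have := unif_grid (cy w) d2; apply: filterS => n /unif_close_sym u.
by apply: (dP _ _ _ u); rewrite ltr_pdivrMr// ltr_pMr// ltr1n.
Qed.

End random_paths.

(** * The wealth process as an exponential walk, and the convergence in law *)

Section returns.
Variable R : realType.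

(** [1 + f * r] equals [1 - f + f * (r + 1)], the argument of the logarithm in [psi]. *)
Lemma wealth_walk d (Omega : measurableType d) (T : R) (n : nat) (f b sigma : R)
    (r : nat -> Omega -> R) (xi : nat -> Omega -> R) w :
  0 <= f <= 1 ->
  (forall k, (0 < k)%N ->
    r k w + 1 = expR (b / n%:R + sigma / Num.sqrt n%:R * xi k w)) ->
  wealth T n f (fun k => r k w) =
  exp_path (walk T n (fun i w => psi f (incr n b sigma (xi i.+1) w)) w).
Proof.
move=> f01 hr; apply: skorokhod_eq => t /=.
rewrite expR_sum big_add1 /= big_mkord; apply: eq_bigr => i _.
rewrite /psi lnK ?posrE ?psi_arg_gt0// /incr -hr//; ring.
Qed.

Lemma standardized_rv d (Omega : measurableType d) (P : probability Omega R)
    (xi : {RV P >-> R}) : ('E_P[xi] = 0)%E -> ('V_P[xi] = 1)%E ->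
  [/\ square_integrable P xi, \int[P]_w xi w = 0 & \int[P]_w xi w ^+ 2 = 1].
Proof.
move=> E0 V1; have mxi : measurable_fun setT xi by exact: measurable_funPT.
have sq : (\int[P]_w (xi w ^+ 2)%:E = 1)%E.
  rewrite -V1 /variance covariance.unlock E0 expectation.unlock; apply: eq_integral => w _.
  by congr (_%:E); rewrite -[RHS]/((xi w - 0) * (xi w - 0)) subr0 expr2.
split.
- split=> //; apply/integrableP; split.
    by apply/measurable_EFinP; exact: measurable_funX.
  under eq_integral do rewrite /= ger0_norm ?sqr_ge0//.
  by rewrite sq ltry.
- by move: E0; rewrite unlock /Rintegral => ->.
- by rewrite /Rintegral sq.
Qed.

End returns.

Theorem theorem4p2 (R : realType) (b sigma : R) (sigma_gt0 : 0 < sigma)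
    (d : nat -> measure_display) (Omega : forall n, measurableType (d n))
    (P : forall n, probability (Omega n) R)
    (xi : forall n, nat -> {RV (P n) >-> R})
    (r : forall n, nat -> Omega n -> R)
    (hr : forall n k w, (0 < n)%N -> (0 < k)%N ->
      r n k w + 1 = expR (b / n%:R + sigma / Num.sqrt n%:R * xi n k w))
    (xi_indep : forall n, (0 < n)%N ->
      mutually_independent (P n) [set k | (0 < k)%N] (fun k => xi n k : Omega n -> R))
    (xi_id : forall n k, (0 < n)%N -> (0 < k)%N ->
      identically_distributed (xi n k) (xi n 1%N))
    (xi_mean : forall n k, (0 < n)%N -> (0 < k)%N -> ('E_(P n)[xi n k] = 0)%E)
    (xi_var : forall n k, (0 < n)%N -> (0 < k)%N -> ('V_(P n)[xi n k] = 1)%E)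
    (xi_lindeberg : forall a : R, 0 < a ->
      (n%:R%:E * 'E_(P n)[fun w => (`|xi n 1%N w| ^+ 2 *
         \1_[set w' | a * Num.sqrt n%:R < `|xi n 1%N w'|] w)%R])%E
        @[n --> \oo] --> (0 : \bar R))
    (mu : R) (hmu : mu = b + sigma ^+ 2 / 2)
    (d' : measure_display) (Omega' : measurableType d')
    (Q : probability Omega' R) (B : brownian_motion Q)
    (T : R) (T_gt0 : 0 < T) (f : R) (f01 : 0 <= f <= 1) :
  cvg_in_law P (fun n w => wealth T n f (fun k => r n k w))
    Q (fun w => limit_wealth T mu sigma f (bm_continuous B w)).
Proof.
pose X n i w := psi f (incr n b sigma (xi n i.+1) w).
pose s := f * sigma.
pose al := f * mu - f ^+ 2 * sigma ^+ 2 / 2.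
(* The factor [sqrt n] standardizes the Brownian increment and [incr] divides it out again: for
   [n > 0], [Z n i] is [al / n] plus [s] times the increment. *)
pose Z n i w := incr n al s
  (fun w => Num.sqrt n%:R * (bm B (i.+1%:R / n%:R) \- bm B (i%:R / n%:R)) w) w.
have std n : (0 < n)%N -> [/\ square_integrable (P n) (xi n 1%N),
    \int[P n]_w xi n 1%N w = 0 & \int[P n]_w xi n 1%N w ^+ 2 = 1].
  by move=> n0; apply: standardized_rv; [exact: xi_mean|exact: xi_var].
have mincr n a c : measurable_fun setT (fun x : R => a / n%:R + c / Num.sqrt n%:R * x).
  by move=> ?; apply: measurable_funD => //; exact: measurable_funM.
have iX n : (0 < n)%N -> iid (P n) (X n).
  move=> n0; have ixi : iid (P n) (fun i => xi n i.+1).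
    apply: iid_shift; first exact: xi_indep.
    by move=> k k0; exact: xi_id.
  apply: (iid_comp (g := fun x => psi f (b / n%:R + sigma / Num.sqrt n%:R * x)) _ ixi).
  apply: (measurableT_comp (@measurable_ln R)); apply: measurable_funD => //.
  by apply: measurable_funM => //; apply: (measurableT_comp (@measurable_expR R)).
have iZ n : (0 < n)%N -> iid Q (Z n).
  move=> n0; apply: (iid_comp
    (g := fun x => al / n%:R + s / Num.sqrt n%:R * (Num.sqrt n%:R * x)) _ (bm_iid B n0)).
  by apply: measurable_funD => //; apply: measurable_funM => //; exact: measurable_funM.
have lX : array_limits P (fun n => X n 0%N) al (s ^+ 2).
  (* With [mu = b + sigma ^+ 2 / 2], the drift from [psi_limits] is the one in the exponent of the
     limit. *)
  have -> : al = f * b + f * (1 - f) / 2 * sigma ^+ 2 by rewrite /al hmu; field.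
  rewrite exprMn; apply: psi_limits => //.
  - by move=> n n0; have [] := std n n0.
  - by move=> n n0; have [] := std n n0.
  - by move=> n n0; have [] := std n n0.
  - apply: lindeberg_tail => // n n0; by have [] := std n n0.
have lZ : array_limits (fun=> Q) (fun n => Z n 0%N) al (s ^+ 2).
  apply: standardized_limits.
  - exact: bm_step_sq.
  - exact: bm_step_mean.
  - exact: bm_step_var.
  - exact: bm_step_tail.
have mB t : measurable_fun setT (bm B t) by exact: measurable_funPT.
pose y w t := al * t + s * bm B t w.
(* [B 0 = 0] holds only almost surely, hence the recentred path [y0]. *)
pose y0 w t := al * t + s * (bm B t w - bm B 0 w).
have cid : {within `[0, +oo[, continuous (fun t : R => al * t)}.
  by apply: continuous_subspaceT => t; apply: cvgM; [exact: cvg_cst|exact: cvg_id].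
have cy w : {within `[0, +oo[, continuous (y w)}.
  move=> t; apply: continuousD; first exact: cid.
  by apply: continuousM; [exact: cvg_cst|exact: bm_continuous].
have cy0 w : {within `[0, +oo[, continuous (y0 w)}.
  move=> t; apply: continuousD; first exact: cid.
  apply: continuousM; first exact: cvg_cst.
  by apply: continuousB; [exact: bm_continuous|exact: cvg_cst].
have my t : measurable_fun setT (fun w => y w t).
  by apply: measurable_funD => //; exact: measurable_funM.
have my0 t : measurable_fun setT (fun w => y0 w t).
  apply: measurable_funD => //; apply: measurable_funM => //.
  exact: measurable_funB.
have wE n w : (0 < n)%N -> wealth T n f (fun k => r n k w) = exp_path (walk T n (X n) w).
  move=> n0; apply: (@wealth_walk R _ _ T n f b sigma (r n) (fun k => xi n k) w f01) => k k0.
  exact: hr.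
have lE w : limit_wealth T mu sigma f (bm_continuous B w) = exp_path (continuous_path T (cy w)).
  exact: skorokhod_eq.
have bX n : borel (fun w => wealth T n f (fun k => r n k w)).
  (* For [n = 0] the formula for the returns is not assumed, but the product is empty and the wealth
     constantly 1. *)
  have [->|n0] := posnP n.
    rewrite (_ : (fun w => _) = fun=> exp_path (step T 0 (fun=> 0))); first exact: borel_cst.
    apply/funext => w; apply: skorokhod_eq => t /=.
    by rewrite mul0r truncn0 big_geq// expR0.
  rewrite (_ : (fun w => _) = fun w => exp_path (walk T n (X n) w)); last first.
    by apply/funext => w; exact: wE.
  apply: (@borel_exp_step _ _ _ _ n (fun w m => \sum_(i < m) X n i w)) => m.
  by have [mX _ _] := iX n n0; apply: measurable_sum => i; exact: mX.
have bY : borel (fun w => limit_wealth T mu sigma f (bm_continuous B w)).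
  rewrite (_ : (fun w => _) = fun w => exp_path (continuous_path T (cy w))); last exact/funext.
  exact: (borel_exp_path cy my).
have bY0 : borel (fun w => exp_path (continuous_path T (cy0 w))) by exact: (borel_exp_path cy0 my0).
split; [by move=> n; exact: borel_random_element|exact: borel_random_element|].
move=> Phi cPhi [M PhiM].
have mPhi d0 (O : measurableType d0) (U : O -> skorokhod T) : borel U ->
    measurable_fun setT (fun w => Phi (U w)).
  by move=> bU; apply: borel_measurable; exact: (borel_comp cPhi bU).
have ExpE d0 (O : measurableType d0) (P0 : probability O R) (U : O -> skorokhod T) :
    borel U -> ('E_P0[Phi \o U] = (\int[P0]_w Phi (U w))%:E)%E.
  move=> bU; rewrite unlock /Rintegral fineK//; apply: integrable_fin_num => //.
  by apply: (@bounded_integrable _ _ _ P0 _ M) => //; exact: mPhi.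
have -> : ('E_Q[Phi \o (fun w => limit_wealth T mu sigma f (bm_continuous B w))] =
    (\int[Q]_w Phi (exp_path (continuous_path T (cy0 w))))%:E)%E.
  rewrite ExpE//; congr (_%:E); rewrite /Rintegral; congr fine.
  apply: ae_eq_integral => //.
  - by apply/measurable_EFinP; exact: mPhi.
  - by apply/measurable_EFinP; exact: mPhi.
  have := bm_start B; apply: filterS => w B0 _; congr (Phi _)%:E.
  by apply: skorokhod_eq => t /=; rewrite /y0 B0 subr0.
under eq_fun do rewrite ExpE//.
apply: cvg_EFin; first exact: nearW.
have grid w e : 0 < e -> \forall n \near \oo, unif_close e (walk T n (Z n) w) (continuous_path T (cy0 w)).
  move=> e0; near=> n.
  have n0 : (0 < n)%N by near: n; exact: nbhs_infty_gt.
  have n0R : 0 < n%:R :> R by rewrite ltr0n.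
  have q0 : 0 < Num.sqrt n%:R :> R by rewrite sqrtr_gt0.
  (* The increments telescope to the sampled path itself, as [y0] vanishes at 0. *)
  have -> : walk T n (Z n) w = step T n (fun m => y0 w (m%:R / n%:R)).
    apply: skorokhod_eq => t /=; move: (Num.truncn _) => m.
    have ZE i : Z n i w = y0 w (i.+1%:R / n%:R) - y0 w (i%:R / n%:R).
      by rewrite /Z /incr /y0 /= -natr1; field; rewrite !gt_eqF.
    under eq_bigr do rewrite ZE.
    rewrite -(big_mkord xpredT (fun i => y0 w (i.+1%:R / n%:R) - y0 w (i%:R / n%:R))).
    rewrite telescope_sumr// mul0r [y0 w 0](_ : _ = 0) ?subr0//.
    by rewrite /y0 subrr !mulr0 addr0.
  by near: n; exact: unif_grid.
(* Continuity of [Phi] at the exponential of the limit path, transported by [exp_path_near] to the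
   uniform distance before exponentiation. It is two-sided and so serves both [Phi] and its
   opposite. *)
have lsc w e : 0 < e -> exists2 delta, 0 < delta & forall z e', e' < delta ->
    unif_close e' (continuous_path T (cy0 w)) z ->
    `|Phi (exp_path (continuous_path T (cy0 w))) - Phi (exp_path z)| <= e.
  move=> e0; have /cvgrPdist_le/(_ e e0)/nbhs_ballP[e1 e10 Phie] := cPhi (exp_path (continuous_path T (cy0 w))).
  have [K yK] := continuous_bounded T (cy0 w).
  have [delta d0 dP] := exp_path_near (x := continuous_path T (cy0 w)) yK e10.
  by exists delta => // z e' ed u; apply: Phie; exact: dP u.
have mPX n : (0 < n)%N -> measurable_fun setT (fun w => Phi (exp_path (walk T n (X n) w))).
  move=> n0; have := mPhi _ _ _ (bX n).
  by under eq_fun do rewrite wE//.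
have mPY := mPhi _ _ _ bY0.
have PhiN z : `|- Phi z| <= M by rewrite normrN.
apply/cvgrPdist_le => e e0.
have low := @walk_liminf R T T_gt0 d Omega P d' Omega' Q X Z (fun w => continuous_path T (cy0 w))
  al (s ^+ 2) (fun z => Phi (exp_path z)) M iX iZ lX lZ grid (fun z => PhiM (exp_path z)) mPX mPY.
have upp := @walk_liminf R T T_gt0 d Omega P d' Omega' Q X Z (fun w => continuous_path T (cy0 w))
  al (s ^+ 2) (fun z => - Phi (exp_path z)) M iX iZ lX lZ grid (fun z => PhiN (exp_path z)).
have {}low : \forall n \near \oo, \int[Q]_w Phi (exp_path (continuous_path T (cy0 w))) - e <=
    \int[P n]_w Phi (exp_path (walk T n (X n) w)).
  apply: low => // w e' /(lsc w)[delta d0 dP]; exists delta => // z e'' h u.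
  by have := dP z e'' h u; rewrite ler_norml => /andP[_]; lra.
have {}upp : \forall n \near \oo, \int[Q]_w - Phi (exp_path (continuous_path T (cy0 w))) - e <=
    \int[P n]_w - Phi (exp_path (walk T n (X n) w)).
  apply: upp => //.
  - by move=> n n0; apply: measurable_funN; exact: mPX.
  - exact: measurable_funN.
  move=> w e' /(lsc w)[delta d0 dP]; exists delta => // z e'' h u.
  by have := dP z e'' h u; rewrite ler_norml => /andP[]; lra.
near=> n; have n0 : (0 < n)%N by near: n; exact: nbhs_infty_gt.
have l1 : \int[Q]_w Phi (exp_path (continuous_path T (cy0 w))) - e <=
    \int[P n]_w Phi (exp_path (walk T n (X n) w)) by near: n.
have l2 : \int[Q]_w - Phi (exp_path (continuous_path T (cy0 w))) - e <=
    \int[P n]_w - Phi (exp_path (walk T n (X n) w)) by near: n.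
have oppE d0 (O : measurableType d0) (P0 : probability O R) (U : O -> R) :
    measurable_fun setT U -> (forall w, `|U w| <= M) ->
    \int[P0]_w - U w = - \int[P0]_w U w.
  move=> mU UM; rewrite -[RHS]mulN1r -RintegralZl//.
    by apply: eq_Rintegral => w _; rewrite mulN1r.
  exact: (@bounded_integrable _ _ _ P0 U M).
rewrite !oppE// in l2; last exact: mPX.
have EX : \int[P n]_w Phi (wealth T n f (fun k => r n k w)) =
    \int[P n]_w Phi (exp_path (walk T n (X n) w)).
  by apply: eq_Rintegral => w _; rewrite wE.
rewrite /= EX ler_norml; apply/andP; split; lra.
Unshelve. all: by end_near. Qed.
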